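(* Suppose the following hold. (A2) (i) For any $\varepsilon>0$, $x\mapsto j(x,M\setminus B(x,\varepsilon))$ is locally integrable with respect to $m$; (ii) for all non-negative Borel $u,v$, $\int_Mu(x)(jv)(x)m(dx)=\int_M(ju)(x)v(x)m(dx)\ (\le\infty)$, where $ju(x):=\int_{M\setminus\{x\}}u(y)j(x,dy)$; (iii) for any compact $K\subset M$, $\sup_{x\in K}\int_M(\rho(x,y)\wedge1)^2j(x,dy)<\infty$. (A3)* (i) $\mathrm{Lip}_c(M)$ is dense in $(\mathcal{F},\mathcal{E}(\cdot,\cdot)+\|\cdot\|_2^2)$; (ii) $\mathcal{L}_{i,\delta}f$ is continuous on $B_i$ for all $f\in\mathrm{Lip}_c(M)$ (for all $i\in\mathbb{N}$, $\delta>0$). (A4)* (i) For any compact $K\subset M$, $$\lim_{\eta\to0}\limsup_{k\to\infty}\iint_{\{(x,y)\in K\times K:\rho(x,y)\le\eta\}}\rho(x,y)^2\mathcal{C}^{(k)}(x,y)m(dx)m(dy)=0,\qquad\lim_{i\to\infty}\limsup_{k\to\infty}\int_K\int_{B_i^c}\mathcal{C}^{(k)}(x,y)m(dx)m(dy)=0;$$ (ii) for any sufficiently small $\delta>0$ and large $i\in\mathbb{N}$, $\lim_{k\to\infty}\int_{B_i}(\overline{\mathcal{L}}^{(k)}_{i,\delta}f(x))^2m(dx)=\int_{B_i}(\mathcal{L}_{i,\delta}f(x))^2m(dx)$ for all $f\in\mathrm{Lip}_c(M)$; (iii) for any sufficiently small $\delta>0$ and large $i\in\mathbb{N}$, $\lim_{k\to\infty}\overline{\mathcal{E}}^{(k)}_{i,\delta}(f,f)=\mathcal{E}_{i,\delta}(f,f)$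 for every $f\in C_b(B_i)$. Then $(\mathcal{E}^{(k)},\mathcal{F}^{(k)})$ is Mosco convergent to $(\mathcal{E},\mathcal{F})$ in the generalized sense, that is: (a) if $v_k\in L^2(V_k;m_k)$, $u\in L^2(M;m)$ and $E_kv_k\to u$ weakly in $L^2(M;m)$, then $\liminf_{k\to\infty}\mathcal{E}^{(k)}(v_k,v_k)\ge\mathcal{E}(u,u)$; (b) for every $u\in L^2(M;m)$ there exist $u_k\in L^2(V_k;m_k)$ such that $E_ku_k\to u$ strongly in $L^2(M;m)$ and $\limsup_{k\to\infty}\mathcal{E}^{(k)}(u_k,u_k)\le\mathcal{E}(u,u)$.
   Context: Space. $(M,\rho)$ is a locally compact separable connected metric space, $m$ is a Radon measure on $M$, $B(x,r)$ is the open ball, $V(x,r):=m(B(x,r))$, $\partial B(x,r):=\overline{B(x,r)}\setminus B(x,r)$; it is assumed that $V(x,r)\in(0,\infty)$ and $m(\partial B(x,r))=0$ for all $x\in M$, $r>0$, and: (MMS.1) $\overline{B(x,r)}$ is compact for all $x,r$; (MMS.2) $\rho$ is geodesic: for all $x,y\in M$ there is a continuous $\gamma:[0,\rho(x,y)]\to M$ with $\gamma(0)=x$, $\gamma(\rho(x,y))=y$, $\rho(\gamma(s),\gamma(t))=t-s$ for $0\le s\le t\le\rho(x,y)$; (MMS.3) there is $c_1>0$ with $V(x,2r)\le c_1V(x,r)$ for all $x,r$. Fix $x_0\in M$, $B_r:=B(x_0,r)$. Approximating graphs. For $k\in\mathbb{N}$, $(V_k,B_k)$ is a graph (vertices $V_k$,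 edges $B_k$) with graph distance $\rho_k$ and an associated partition $\{U_k(x):x\in V_k\}$ of $M$ into measurable sets, such that, with positive constants $C_1,\dots,C_5$ not depending on $k$ or the points: (AG.1) $(V_k,B_k)$ is connected and has uniformly bounded degree; (AG.2) $V_k\subset M$, $\bigcup_kV_k$ is dense in $M$, $\frac{C_1}{k}\rho_k(x,y)\le\rho(x,y)\le\frac{C_2}{k}\rho_k(x,y)$ for $x,y\in V_k$; (AG.3) $\bigcup_{x\in V_k}U_k(x)=M$, $m(U_k(x)\cap U_k(y))=0$ for $x\ne y$, $\sup\{\rho(\xi,\eta):\xi,\eta\in U_k(x)\}\le C_3/k$, and for each $x\in V_k$, $V_k\cap\mathrm{Int}\,U_k(x)=\{x\}$ and $C_4m(U_k(x))\le V(x,1/k)\le C_5m(U_k(x))$. Discrete forms. $m_k(A)=\sum_{y\in A}m(U_k(y))$ for $A\subset V_k$, $m_k(y):=m_k(\{y\})$. $\mathcal{C}^{(k)}(x,y)=\mathcal{C}^{(k)}(y,x)\ge0$, $x,y\in V_k$, are conductances (unrelated to $B_k$). $\mathcal{F}^{(k)}:=\{u\in L^2(V_k;m_k):\sum_{x,y\in V_k}(u(x)-u(y))^2\mathcal{C}^{(k)}(x,y)m_k(x)m_k(y)<\infty\}$, $\mathcal{E}^{(k)}(u,v):=\frac12\sum_{x,y\in V_k}(u(x)-u(y))(v(x)-v(y))\mathcal{C}^{(k)}(x,y)m_k(x)m_k(y)$, and $\mathcal{E}^{(k)}(u,u):=\infty$ for $u\in L^2(V_k;m_k)\setminus\mathcal{F}^{(k)}$.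 Limit form. $j$ is a kernel such that for $m$-a.e. $x\in M$, $j(x,\cdot)$ is a positive measure on $M\setminus\{x\}$; $J(dx,dy)=j(x,dy)m(dx)$ on $M\times M\setminus\widehat d$, $\widehat d$ the diagonal. $\mathcal{F}:=\{u\in L^2(M,m):\int_{M\times M\setminus\widehat d}(u(x)-u(y))^2J(dx,dy)<\infty\}$, $\mathcal{E}(u,v):=\frac12\int_{M\times M\setminus\widehat d}(u(x)-u(y))(v(x)-v(y))J(dx,dy)$, and $\mathcal{E}(u,u):=\infty$ for $u\in L^2(M;m)\setminus\mathcal{F}$. Operators. $E_kg(z)=g(x)$ for $g\in L^2(V_k,m_k)$ and $m$-a.e. $z\in U_k(x)$, $x\in V_k$. $\mathcal{C}^{(k)}$ is extended to $M\times M$ ($m\otimes m$-a.e.) by $\mathcal{C}^{(k)}(z,w)=\mathcal{C}^{(k)}(x,y)$ for $z\in U_k(x)$, $w\in U_k(y)$. For a function $f$ on $M$ or on $B_i$, $$\overline{\mathcal{E}}^{(k)}_{i,\delta}(f,f):=\tfrac12\iint_{\{(z,w)\in B_i\times B_i:\rho(z,w)>\delta\}}(f(w)-f(z))^2\mathcal{C}^{(k)}(w,z)m(dw)m(dz),\quad\mathcal{E}_{i,\delta}(f,f):=\tfrac12\iint_{\{(z,w)\in B_i\times B_i:\rho(z,w)>\delta\}}(f(w)-f(z))^2J(dw,dz),$$ and for $x\in B_i$, $\overline{\mathcal{L}}^{(k)}_{i,\delta}u(x)=\int_{B_i}(u(y)-u(x))\mathcal{C}^{(k)}(x,y)\mathbf{1}_{\{\rho(x,y)>\delta\}}m(dy)$,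 $\mathcal{L}_{i,\delta}u(x)=\int_{B_i}(u(y)-u(x))\mathbf{1}_{\{\rho(x,y)>\delta\}}j(x,dy)$. $\mathrm{Lip}_c(M)$: Lipschitz functions on $M$ with compact support; $C_b(B_i)$: bounded continuous functions on $B_i$. *)

(* Defs.v *)
From HB Require Import structures.
From mathcomp Require Import all_boot all_order all_algebra.
From mathcomp Require Import all_classical all_reals all_analysis.

Set Implicit Arguments.
Unset Strict Implicit.
Unset Printing Implicit Defensive.

Import Order.TTheory GRing.Theory Num.Theory.
Import numFieldNormedType.Exports.

Local Open Scope classical_set_scope.
Local Open Scope ring_scope.
Local Open Scope ereal_scope.

HB.mixin Record isBorel d T & Topological T & Measurable d T := {
  measurable_borelE : @measurable d T = <<s [set A : set T | open A] >>
}.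

#[short(type=borelMetricType)]
HB.structure Definition BorelMetric (R : numDomainType) d :=
  {T of Metric R T & Measurable d T & isBorel d T}.

Section metric_measure_space.
Context (R : realType) d (M : borelMetricType R d).
Implicit Types (m : {measure set M -> \bar R}).

Definition radon m :=
  [/\ forall K : set M, compact K -> m K < +oo,
      forall A : set M, measurable A ->
        m A = ereal_inf [set m O | O in [set O | open O /\ A `<=` O]] &
      forall O : set M, open O ->
        m O = ereal_sup [set m K | K in [set K | compact K /\ K `<=` O]] ].

Record metric_measure_space m : Prop := MetricMeasureSpace {
  mms_locally_compact : locally_compact [set: M] ;
  mms_separable : exists2 A : set M, countable A & dense A ;
  mms_connected : connected [set: M] ;
  mms_radon : radon m ;
  mms_volume : forall (x : M) (r : R), (0 < r)%R -> 0 < m (ball x r) < +oo ;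
  mms_sphere : forall (x : M) (r : R), (0 < r)%R ->
    m (closure (ball x r) `\` ball x r) = 0 ;
  mms_compact : forall (x : M) (r : R), (0 < r)%R ->
    compact (closure (ball x r)) ;
  mms_geodesic : forall x y : M, exists gamma : R -> M,
    [/\ {within `[0%R, mdist x y], continuous gamma},
        gamma 0%R = x, gamma (mdist x y) = y &
        forall s t : R, (0 <= s <= t)%R -> (t <= mdist x y)%R ->
          mdist (gamma s) (gamma t) = (t - s)%R ] ;
  mms_doubling : exists2 c1 : R, (0 < c1)%R &
    forall (x : M) (r : R), (0 < r)%R ->
      m (ball x (2 * r)) <= c1%:E * m (ball x r)
}.

(* Edges are a boolean relation; the distance is +oo between vertices that no
   path joins. *)
Definition graph_dist (E : rel M) (x y : M) : \bar R :=
  ereal_inf [set (size p)%:R%:E | p in [set p : seq M |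
    path E x p /\ last x p = y]].

(* The level k ranges over the positive integers: 1 / k occurs in the axioms. *)
Record approximating_graphs m (V : nat -> set M) (E : nat -> rel M)
    (U : nat -> M -> set M) : Prop := ApproximatingGraphs {
  ag_edge : forall k, (0 < k)%N -> forall x y, E k x y -> V k x /\ V k y ;
  ag_undirected : forall k, (0 < k)%N -> symmetric (E k) ;
  ag_cell_measurable : forall k, (0 < k)%N -> forall x, V k x ->
    measurable (U k x) ;
  ag_connected : forall k, (0 < k)%N -> forall x y, V k x -> V k y ->
    exists2 p : seq M, path (E k) x p & last x p = y ;
  ag_degree : exists D : nat, forall k, (0 < k)%N -> forall x, V k x ->
    ([set y | E k x y] #<= `I_D)%card ;
  ag_dense : dense (\bigcup_(k in [set k | (0 < k)%N]) V k) ;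
  ag_dist : exists C1 C2 : R, [/\ (0 < C1)%R, (0 < C2)%R &
    forall k, (0 < k)%N -> forall x y, V k x -> V k y ->
      (C1 / k%:R)%:E * graph_dist (E k) x y <= (mdist x y)%:E
        <= (C2 / k%:R)%:E * graph_dist (E k) x y ] ;
  ag_cover : forall k, (0 < k)%N -> \bigcup_(x in V k) U k x = setT ;
  ag_disjoint : forall k, (0 < k)%N -> forall x y, V k x -> V k y ->
    x <> y -> m (U k x `&` U k y) = 0 ;
  ag_diameter : exists2 C3 : R, (0 < C3)%R &
    forall k, (0 < k)%N -> forall x, V k x ->
      forall xi eta, U k x xi -> U k x eta -> (mdist xi eta <= C3 / k%:R)%R ;
  ag_center : forall k, (0 < k)%N -> forall x, V k x ->
    V k `&` interior (U k x) = [set x] ;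
  ag_volume : exists C4 C5 : R, [/\ (0 < C4)%R, (0 < C5)%R &
    forall k, (0 < k)%N -> forall x, V k x ->
      C4%:E * m (U k x) <= m (ball x k%:R^-1) <= C5%:E * m (U k x) ]
}.

Section one_level.
Variables (m : {measure set M -> \bar R}) (Vk : set M) (Uk : M -> set M).

(* A function on Vk is a function on M whose values off Vk are never used;
   vertices have positive mass, so no quotient is needed. *)
Definition discrete_L2 (v : M -> R) :=
  \esum_(x in Vk) (((v x) ^+ 2)%:E * m (Uk x)) < +oo.

Definition discrete_sum (C : M -> M -> R) (v : M -> R) : \bar R :=
  \esum_(p in Vk `*` Vk)
    (((v p.1 - v p.2) ^+ 2 * C p.1 p.2)%:E * m (Uk p.1) * m (Uk p.2)).

Definition discrete_domain (C : M -> M -> R) (v : M -> R) :=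
  discrete_L2 v /\ discrete_sum C v < +oo.

Definition discrete_energy (C : M -> M -> R) (v : M -> R) : \bar R :=
  if `[< discrete_domain C v >] then (2^-1)%:E * discrete_sum C v else +oo.

Definition cells (z : M) : set M := [set x | Vk x /\ Uk x z].

(* The points in several cells form a null set; sending them to 0 keeps the
   extended functions Borel measurable. *)
Definition extend (g : M -> R) (z : M) : R :=
  if `[< exists x, cells z = [set x] >] then g (get (cells z)) else 0%R.

Definition extend2 (C : M -> M -> R) (z w : M) : R :=
  extend (fun x => extend (C x) w) z.

End one_level.

Definition far (B : set M) (delta : R) (x : M) : set M :=
  B `&` [set y | (delta < mdist x y)%R].

Definition truncated_conductance_energy m (c : M -> M -> R) (B : set M) (delta : R)
    (f : M -> R) : \bar R :=
  (2^-1)%:E * \int[m]_(z in B) \int[m]_(w in far B delta z)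
    ((f w - f z) ^+ 2 * c w z)%:E.

Definition truncated_conductance_generator m (c : M -> M -> R) (B : set M)
    (delta : R) (u : M -> R) (x : M) : R :=
  (\int[m]_(y in far B delta x) ((u y - u x) * c x y))%R.

Section jump_kernel.
Variables (m : {measure set M -> \bar R}) (j : R.-ker M ~> M).

Definition jump_integral (u : M -> R) : \bar R :=
  \int[m]_x \int[j x]_(y in [set~ x]) ((u x - u y) ^+ 2)%:E.

Definition jump_domain (u : M -> R) :=
  u \in Lfun m 2%:E /\ jump_integral u < +oo.

Definition jump_energy (u : M -> R) : \bar R :=
  if `[< jump_domain u >] then (2^-1)%:E * jump_integral u else +oo.

Definition truncated_jump_energy (B : set M) (delta : R) (f : M -> R) :
    \bar R :=
  (2^-1)%:E * \int[m]_(w in B) \int[j w]_(z in far B delta w)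
    ((f w - f z) ^+ 2)%:E.

Definition truncated_jump_generator (B : set M) (delta : R) (u : M -> R)
    (x : M) : R :=
  (\int[j x]_(y in far B delta x) (u y - u x))%R.

Definition jump_op (u : M -> R) (x : M) : \bar R :=
  \int[j x]_(y in [set~ x]) (u y)%:E.

End jump_kernel.

Definition Lip_c (f : M -> R) :=
  (exists L : R, forall x y, (`|f x - f y| <= L * mdist x y)%R) /\
  compact (closure [set x | f x != 0%R]).

Definition bounded_continuous_on (B : set M) (f : M -> R) :=
  {within B, continuous f} /\
  exists c : R, forall x, B x -> (`|f x| <= c)%R.

(* j x is a measure on M minus x, i.e. one without mass at x, for x outside the
   null set N only. Every x must carry some measure in j : R.-ker M ~> M, so for
   x in N it is arbitrary, and the pointwise assumptions are asked off N. *)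
Definition assumption_A2 m (j : R.-ker M ~> M) (N : set M) :=
  [/\ forall eps : R, (0 < eps)%R -> forall K : set M, compact K ->
        m.-integrable K (fun x => j x (~` ball x eps)),
      forall u v : M -> R,
        measurable_fun setT u -> measurable_fun setT v ->
        (forall x, (0 <= u x)%R) -> (forall x, (0 <= v x)%R) ->
        \int[m]_x ((u x)%:E * jump_op j v x) =
        \int[m]_x (jump_op j u x * (v x)%:E) &
      forall K : set M, compact K ->
        ereal_sup [set \int[j x]_y ((Num.min (mdist x y) 1) ^+ 2)%:E
                  | x in K `\` N] < +oo ].

Definition assumption_A3star m (j : R.-ker M ~> M) (N : set M) (x0 : M) :=
  [/\ forall f, Lip_c f -> jump_domain m j f,
      forall u, jump_domain m j u -> forall eps : R, (0 < eps)%R ->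
        exists2 f, Lip_c f &
          jump_energy m j (u \- f)%R + 'N[m]_2%:E[EFin \o (u \- f)%R] ^+ 2
            < eps%:E &
      forall (i : nat) (delta : R), (0 < delta)%R -> forall f, Lip_c f ->
        {within ball x0 i%:R `\` N,
          continuous (truncated_jump_generator j (ball x0 i%:R) delta f)} ].

(* C k is the extension to M * M of the k-th conductances. *)
Definition assumption_A4star m (j : R.-ker M ~> M) (x0 : M)
    (C : nat -> M -> M -> R) :=
  (forall K : set M, compact K ->
    limn_esup (fun k => \int[m]_(x in K)
        \int[m]_(y in K `&` [set y | (mdist x y <= eta)%R])
          ((mdist x y) ^+ 2 * C k x y)%:E)
      @[eta --> (0 : R)^'+] --> 0 /\
    limn_esup (fun k => \int[m]_(x in K)
        \int[m]_(y in ~` ball x0 i%:R) (C k x y)%:E)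
      @[i --> \oo] --> 0) /\
  exists (delta0 : R) (i0 : nat), (0 < delta0)%R /\
    forall (delta : R) (i : nat), (0 < delta < delta0)%R -> (i0 <= i)%N ->
    let B := ball x0 i%:R in
    (forall f, Lip_c f ->
      \int[m]_(x in B)
        ((truncated_conductance_generator m (C k) B delta f x) ^+ 2)%:E
        @[k --> \oo] -->
      \int[m]_(x in B) ((truncated_jump_generator j B delta f x) ^+ 2)%:E) /\
    (forall f, bounded_continuous_on B f ->
      truncated_conductance_energy m (C k) B delta f @[k --> \oo] -->
      truncated_jump_energy m j B delta f).

Definition weakly_cvg_L2 m (w : nat -> M -> R) (u : M -> R) :=
  forall g, g \in Lfun m 2%:E ->
    (\int[m]_z (w k z * g z))%R @[k --> \oo] --> (\int[m]_z (u z * g z))%R.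

Definition strongly_cvg_L2 m (w : nat -> M -> R) (u : M -> R) :=
  'N[m]_2%:E[EFin \o (w k \- u)%R] @[k --> \oo] --> 0.

End metric_measure_space.

(* Main.v *)
(* Restricted to pairs at distance above delta in B = ball x0 i, the limit form E and
   its generator L satisfy, for bounded f and g, - 2 <g, L f> - E f <= E g, with
   equality when g = f; so do the discrete forms E_k and L_k.

   Lower bound. By polarization, convergence of E_k gives <g, L_k f> -> <g, L f> for f
   and g in Lip_c; with the convergence of |L_k f|^2 this makes L_k f eventually
   L2-close to any g in Lip_c that is close to L f. Hence - 2 <w_k, L_k f> - E_k f, a
   lower bound of the k-th energy of w_k, tends to - 2 <u, L f> - E f along a weakly
   convergent (thus bounded) sequence w_k. As f tends to u in L2 this tends to E u, the
   truncated form being L2-continuous; then i -> oo, delta -> 0 and Fatou.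

   Recovery sequence. By Jensen, the cell means of f in Lip_c have energy at most
   1/2 times the double integral of (f z - f w)^2 C_k(z, w). Pairs of B at distance
   above delta contribute E_k f -> E f <= energy of f, near pairs at most the integral
   of Lip(f)^2 rho^2 C_k, and pairs with a point off B, where f vanishes, at most
   that of 2 sup(f)^2 C_k over K * B^c. A diagonal sequence handles general u. *)

Require Import Defs.
From HB Require Import structures.
From mathcomp Require Import all_boot all_order all_algebra.
From mathcomp Require Import all_classical all_reals all_analysis.
From mathcomp Require Import measurable_realfun finmap ring lra.

Set Implicit Arguments.
Unset Strict Implicit.
Unset Printing Implicit Defensive.

Import Order.TTheory GRing.Theory Num.Theory.
Import numFieldNormedType.Exports.

Local Open Scope classical_set_scope.
Local Open Scope ring_scope.
Local Open Scope ereal_scope.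

(** * Square-integrable functions *)

(** The two sides are not on an equal footing. By the last part of [assumption_A2] the limit kernel
    has jump rates at distance above delta that are bounded on B off a null set, so its truncated
    form is dominated by the L2 norm. For the conductances no such bound is at hand: only the total
    mass of far pairs is finite, for large k, and even this is read off from the convergence of the
    energies of finitely many test functions. Hence the lower bound at level k is first proved for
    bounded functions and reaches w_k by clipping, which needs L_k f in L2; the convergence of its
    norm provides that. The second obstacle is measurability. The kernel [j] need not be s-finite
    and is symmetric only against products, so functions of two variables are integrated against a
    finite kernel cut out of [j], and estimates for the untruncated form are obtained by
    exhaustion. *)

Section nonmeasurable_integrands.
Context d (T : measurableType d) (R : realType).
Variable m : {measure set T -> \bar R}.
Import HBNNSimple.

(** Simple functions below f are below g, and the integral of a nonnegative function is a supremum
    over them, so no measurability is asked. Inner integrals against [j] can thus be compared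
    without knowing that they depend measurably on the point. *)
Lemma ge0_le_integralW (D : set T) (f g : T -> \bar R) :
  (forall x, D x -> 0 <= f x) -> (forall x, D x -> f x <= g x) ->
  \int[m]_(x in D) f x <= \int[m]_(x in D) g x.
Proof.
move=> f0 fg; rewrite !ge0_integralE//; last first.
  by move=> x Dx; exact: le_trans (f0 _ Dx) (fg _ Dx).
apply: le_ereal_sup => _ [h hf <-]; exists h => // x.
apply: le_trans (hf x) _; rewrite /patch; case: ifPn => // /set_mem; exact: fg.
Qed.

(** A simple function below f is multiplied by the indicator of the complement of N, which puts it
    below g and leaves its integral unchanged. *)
Lemma ge0_le_integral_negligible (D N : set T) (f g : T -> \bar R) :
  measurable N -> m N = 0 ->
  (forall x, D x -> 0 <= f x) -> (forall x, D x -> 0 <= g x) ->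
  (forall x, D x -> ~ N x -> f x <= g x) ->
  \int[m]_(x in D) f x <= \int[m]_(x in D) g x.
Proof.
move=> mN N0 f0 g0 fg; rewrite !ge0_integralE//.
apply: ge_ereal_sup => _ [h hf <-].
have mC : measurable (~` N) by exact: measurableC.
pose h' : {nnsfun T >-> R} := proj_nnsfun h mC.
have h'E x : h' x = (h x * \1_(~` N) x)%R by [].
apply: ereal_sup_ubound.
exists h'; first move=> x.
  rewrite h'E indicE in_setC /patch.
  have [Nx|Nx] := boolP (x \in N); rewrite /= ?(mulr0, mulr1).
    by case: ifPn => // /set_mem; exact: g0.
  apply: le_trans (hf x) _; rewrite /patch; case: ifPn => // /set_mem Dx.
  by apply: fg => //; move: Nx; rewrite notin_setE.
rewrite -!integralT_nnsfun; apply: ge0_ae_eq_integral => //.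
- exact/measurable_EFinP.
- exact/measurable_EFinP.
- by move=> x _; rewrite lee_fin.
- by move=> x _; rewrite lee_fin.
exists N; split => // x /= /not_implyP[_ hx]; apply: contrapT => Nx; apply: hx.
by rewrite mindicE in_setC memNset// mulr1.
Qed.

Lemma ge0_eq_integral_negligible (D N : set T) (f g : T -> \bar R) :
  measurable N -> m N = 0 ->
  (forall x, D x -> 0 <= f x) -> (forall x, D x -> 0 <= g x) ->
  (forall x, D x -> ~ N x -> f x = g x) ->
  \int[m]_(x in D) f x = \int[m]_(x in D) g x.
Proof.
move=> mN N0 f0 g0 fg; apply/eqP; rewrite eq_le; apply/andP; split;
  by apply: (@ge0_le_integral_negligible _ N) => // x Dx Nx; rewrite fg.
Qed.

Lemma eq_integral_negligible (D N : set T) (f g : T -> \bar R) :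
  measurable N -> m N = 0 ->
  (forall x, D x -> ~ N x -> f x = g x) ->
  \int[m]_(x in D) f x = \int[m]_(x in D) g x.
Proof.
move=> mN N0 fg; rewrite integralE [RHS]integralE; congr (_ - _);
  apply: (@ge0_eq_integral_negligible _ N) => // x Dx Nx;
  by rewrite ?funeposE ?funenegE fg.
Qed.

End nonmeasurable_integrands.

Lemma EFin_cvg (R : realType) (I : Type) (F : set_system I) {FF : Filter F}
    (u : I -> R) (l : R) :
  u x @[x --> F] --> l -> (u x)%:E @[x --> F] --> l%:E.
Proof. by move=> ul; apply: cvg_EFin; [exact: nearW|exact: ul]. Qed.

Section square_integrable.
Context d (T : measurableType d) (R : realType).
Variable m : {measure set T -> \bar R}.
Implicit Types (D : set T) (f g : T -> R).

(** Squared norms avoid square roots: the convergence of generators is assumed for them, and errors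
    are balanced by Young's inequality. *)
Definition sqnorm D f : \bar R := \int[m]_(x in D) ((f x) ^+ 2)%:E.

Definition L2on D f := measurable_fun D f /\ sqnorm D f < +oo.

Lemma sqnorm_ge0 D f : 0 <= sqnorm D f.
Proof. by apply: integral_ge0 => x _; rewrite lee_fin sqr_ge0. Qed.

Lemma L2on_fin_num D f : L2on D f -> sqnorm D f \is a fin_num.
Proof. by case=> _ fy; rewrite ge0_fin_numE ?sqnorm_ge0. Qed.

Lemma sqnorm_fine_ge0 D f : (0 <= fine (sqnorm D f))%R.
Proof. by rewrite fine_ge0 ?sqnorm_ge0. Qed.

Lemma L2on_integrable D f : measurable D -> L2on D f ->
  m.-integrable D (fun x => ((f x) ^+ 2)%:E).
Proof.
move=> mD [mf fy]; apply/integrableP; split.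
  exact/measurable_EFinP/measurable_funX.
rewrite (eq_integral (fun x => ((f x) ^+ 2)%:E))// => x _.
by rewrite gee0_abs ?lee_fin ?sqr_ge0.
Qed.

Lemma L2onM D f g : measurable D -> L2on D f -> L2on D g ->
  m.-integrable D (fun x => (f x * g x)%:E).
Proof.
move=> mD Lf Lg.
have /= I := integrableD mD (L2on_integrable mD Lf) (L2on_integrable mD Lg).
apply: le_integrable I => //.
  by apply/measurable_EFinP/measurable_funM; [exact: Lf.1|exact: Lg.1].
move=> x _; rewrite -EFinD !abse_EFin lee_fin.
rewrite [leRHS]ger0_norm ?addr_ge0 ?sqr_ge0// normrM.
rewrite -[(f x ^+ 2)%R]real_normK ?num_real// -[(g x ^+ 2)%R]real_normK ?num_real//.
have := sqr_ge0 (`|f x| - `|g x|)%R.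
have := normr_ge0 (f x); have := normr_ge0 (g x).
nra.
Qed.

Lemma fine_sqnorm D f : fine (sqnorm D f) = (\int[m]_(x in D) ((f x) ^+ 2))%R.
Proof. by []. Qed.

Lemma sqnormD_le D f g : measurable D -> measurable_fun D f -> measurable_fun D g ->
  sqnorm D (fun x => f x + g x)%R <= 2%:E * (sqnorm D f + sqnorm D g).
Proof.
move=> mD mf mg.
have mf2 (h : T -> R) : measurable_fun D h -> measurable_fun D (fun x => ((h x) ^+ 2)%:E).
  by move=> mh; exact/measurable_EFinP/measurable_funX.
rewrite -ge0_integralD//; last 4 first.
- by move=> x _; rewrite lee_fin sqr_ge0.
- exact: mf2.
- by move=> x _; rewrite lee_fin sqr_ge0.
- exact: mf2.
rewrite -ge0_integralZl_EFin//; last 2 first.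
- by move=> x _; rewrite -EFinD lee_fin addr_ge0 ?sqr_ge0.
- by apply: emeasurable_funD; exact: mf2.
apply: ge0_le_integralW => x _; first by rewrite lee_fin sqr_ge0.
rewrite -EFinD -EFinM lee_fin; have := sqr_ge0 (f x - g x)%R; nra.
Qed.

Lemma L2onD D f g : measurable D -> L2on D f -> L2on D g ->
  L2on D (fun x => f x + g x)%R.
Proof.
move=> mD Lf Lg; split.
  by apply: measurable_funD; [exact: Lf.1|exact: Lg.1].
apply: le_lt_trans (sqnormD_le mD Lf.1 Lg.1) _.
by rewrite -(fineK (L2on_fin_num Lf)) -(fineK (L2on_fin_num Lg)) -EFinD -EFinM ltry.
Qed.

Lemma L2onZ D (a : R) f : measurable D -> L2on D f -> L2on D (fun x => a * f x)%R.
Proof.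
move=> mD Lf; split; first by apply: measurable_funM => //; exact: Lf.1.
rewrite /sqnorm (eq_integral (fun x => (a ^+ 2)%:E * ((f x) ^+ 2)%:E)); last first.
  by move=> x _; rewrite exprMn EFinM.
rewrite ge0_integralZl_EFin ?sqr_ge0//.
- by rewrite -/(sqnorm D f) -(fineK (L2on_fin_num Lf)) -EFinM ltry.
- by move=> x _; rewrite lee_fin sqr_ge0.
- by apply/measurable_EFinP/measurable_funX; exact: Lf.1.
Qed.

Lemma L2onB D f g : measurable D -> L2on D f -> L2on D g ->
  L2on D (fun x => f x - g x)%R.
Proof.
move=> mD Lf Lg; have := L2onD mD Lf (L2onZ (-1) mD Lg).
by under eq_fun do rewrite mulN1r.
Qed.

Lemma L2onS D E f : measurable D -> measurable E -> D `<=` E ->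
  L2on E f -> L2on D f.
Proof.
move=> mD mE DE [mf fy]; split; first exact: measurable_funS mf.
apply: le_lt_trans fy; apply: ge0_subset_integral => //.
  exact/measurable_EFinP/measurable_funX.
by move=> x _; rewrite lee_fin sqr_ge0.
Qed.

Lemma L2on_bounded D f (b : R) : measurable D -> m D < +oo ->
  measurable_fun D f -> (forall x, D x -> `|f x| <= b)%R -> L2on D f.
Proof.
move=> mD Dy mf fb; split => //.
apply: (@le_lt_trans _ _ (\int[m]_(x in D) (cst (b ^+ 2)%:E x))).
  apply: ge0_le_integralW => x Dx; first by rewrite lee_fin sqr_ge0.
  rewrite lee_fin -[leLHS]real_normK ?num_real// lerXn2r ?nnegrE//.
    exact: le_trans (fb x Dx).
  exact: fb.
by rewrite integral_cst// lte_mul_pinfty// lee_fin sqr_ge0.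
Qed.

(** Young's inequality with a free weight s, in place of Cauchy-Schwarz: a small s tames a factor
    that is only bounded, and the other factor is then taken small compared with s. *)
Lemma le_Rintegral_mul D f g (s : R) : measurable D -> L2on D f -> L2on D g ->
  (0 < s)%R ->
  (`|\int[m]_(x in D) (f x * g x)| <=
   2^-1 * (s * fine (sqnorm D f) + s^-1 * fine (sqnorm D g)))%R.
Proof.
move=> mD Lf Lg s0.
have I := L2onM mD Lf Lg.
have If := L2on_integrable mD Lf; have Ig := L2on_integrable mD Lg.
apply: le_trans (le_normr_Rintegral mD I) _.
rewrite !fine_sqnorm -!RintegralZl//; last first.
rewrite -RintegralD//; last 2 first.
- by rewrite /comp; under eq_fun do rewrite EFinM; exact: integrableZl.
- by rewrite /comp; under eq_fun do rewrite EFinM; exact: integrableZl.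
have IZ a b : m.-integrable D (fun x => (a * f x ^+ 2 + b * g x ^+ 2)%:E).
  under eq_fun do rewrite EFinD !EFinM.
  by apply: integrableD => //; exact: integrableZl.
rewrite -RintegralZl//; last exact: IZ.
apply: le_Rintegral => //.
- exact/(integrable_norm I).
- rewrite /comp; under eq_fun do rewrite EFinM; apply: integrableZl => //; exact: IZ.
move=> x _ /=.
have e : (s * f x ^+ 2 + s^-1 * g x ^+ 2 - 2 * (`|f x| * `|g x|) =
   s^-1 * (s * `|f x| - `|g x|) ^+ 2)%R.
  rewrite -(real_normK (num_real (f x))) -(real_normK (num_real (g x))).
  by field; rewrite gt_eqF.
have : (0 <= s^-1 * (s * `|f x| - `|g x|) ^+ 2)%R.
  by rewrite mulr_ge0 ?sqr_ge0// invr_ge0 ltW.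
rewrite -e normrM; lra.
Qed.

Lemma fine_sqnormB D f g : measurable D -> L2on D f -> L2on D g ->
  (fine (sqnorm D (fun x => f x - g x)%R) =
   fine (sqnorm D f) - 2 * (\int[m]_(x in D) (f x * g x)) + fine (sqnorm D g))%R.
Proof.
move=> mD Lf Lg.
have I := L2onM mD Lf Lg.
have If := L2on_integrable mD Lf; have Ig := L2on_integrable mD Lg.
have I2 : m.-integrable D (EFin \o (fun x => 2 * (f x * g x))%R).
  by rewrite /comp; under eq_fun do rewrite EFinM; exact: integrableZl.
rewrite !fine_sqnorm -RintegralZl// -RintegralB// -RintegralD//; last first.
  by rewrite /comp; under eq_fun do rewrite EFinB; exact: integrableB.
by apply: eq_Rintegral => x _; ring.
Qed.

Lemma le_sqnorm D f g : (forall x, D x -> `|f x| <= `|g x|)%R ->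
  sqnorm D f <= sqnorm D g.
Proof.
move=> fg; apply: ge0_le_integralW => x Dx; first by rewrite lee_fin sqr_ge0.
by rewrite lee_fin -(real_normK (num_real (f x))) -(real_normK (num_real (g x)))
  lerXn2r ?nnegrE// fg.
Qed.

Lemma L2_dominated_cvg D (f_ : nat -> T -> R) f h : measurable D ->
  (forall n, measurable_fun D (f_ n)) -> measurable_fun D f -> L2on D h ->
  (forall n x, D x -> `|f_ n x - f x| <= h x)%R ->
  (forall x, D x -> f_ n x @[n --> \oo] --> f x) ->
  sqnorm D (fun x => f_ n x - f x)%R @[n --> \oo] --> 0.
Proof.
move=> mD mf_ mf Lh fh ff.
have -> : 0 = \int[m]_(x in D) cst 0 x :> \bar R by rewrite integral0.
apply: (@dominated_cvg _ _ _ _ _ mD _ _ (fun x => ((h x) ^+ 2)%:E)).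
- by move=> n; exact/measurable_EFinP/measurable_funX/measurable_funB.
- move=> x Dx; have -> : cst 0 x = ((f x - f x) * (f x - f x))%:E :> \bar R.
    by rewrite subrr mul0r.
  apply: EFin_cvg; under eq_fun do rewrite expr2.
  by apply: cvgM; apply: cvgB; [exact: ff|exact: cvg_cst|exact: ff|exact: cvg_cst].
- by [].
- exact: L2on_integrable.
- move=> n x Dx; rewrite gee0_abs ?lee_fin ?sqr_ge0//.
  rewrite -real_normK ?num_real// lerXn2r ?nnegrE ?fh//.
  exact: le_trans (fh n x Dx).
Qed.

Lemma Lfun2P f : f \in Lfun m 2%:E <-> L2on setT f.
Proof.
have sqE : sqnorm setT f = \int[m]_x (`|(f x)%:E| `^ 2).
  by apply: eq_integral => x _; rewrite /= powR_mulrn// real_normK ?num_real.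
split=> [|[mf fy]].
  move=> /andP[/[!classical_sets.inE]/= mf lf]; split => //.
  by have /(poweR_lty 2) := lf; rewrite poweR_Lnorm ?pnatr_eq0// sqE.
apply/andP; split; rewrite classical_sets.inE//= /finite_norm unlock; apply: poweR_lty.
by rewrite -sqE.
Qed.

Lemma Lnorm2E f : 'N[m]_2%:E[EFin \o f] = sqrte (sqnorm setT f).
Proof.
rewrite unlock /= poweR12_sqrt; last by apply: integral_ge0 => x _; rewrite lee_fin powR_ge0.
congr sqrte; apply: eq_integral => x _ /=.
by rewrite powR_mulrn// real_normK ?num_real.
Qed.

Lemma Lnorm2_sqr f : 'N[m]_2%:E[EFin \o f] ^+ 2 = sqnorm setT f.
Proof. by rewrite Lnorm2E sqr_sqrte// sqnorm_ge0. Qed.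

End square_integrable.

(** Induction on n: from X^2 <= A Q the arithmetic-geometric inequality bounds the cross term 2 |X
    b_n| by A b_n^2 + Q, which are the cross terms on the right. *)
Lemma weighted_cauchy_schwarz (R : realType) (q b e : nat -> R) (n : nat) :
  (forall i, 0 <= q i)%R -> (forall i, `|e i| <= 1)%R ->
  ((\sum_(0 <= i < n) e i * q i * b i) ^+ 2 <=
   (\sum_(0 <= i < n) q i) * (\sum_(0 <= i < n) q i * b i ^+ 2))%R.
Proof.
move=> q0 e1; elim: n => [|n IH]; first by rewrite !big_geq// mulr0 expr0n.
rewrite !big_nat_recr//=.
set X := (\sum_(0 <= i < n) _)%R in IH *; set A := (\sum_(0 <= i < n) q i)%R in IH *.
set Q := (\sum_(0 <= i < n) _)%R in IH *.
have A0 : (0 <= A)%R by apply: sumr_ge0.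
have Q0 : (0 <= Q)%R by apply: sumr_ge0 => i _; apply: mulr_ge0 => //; exact: sqr_ge0.
have cross : (2 * `|X * b n| <= A * b n ^+ 2 + Q)%R.
  have AQ0 : (0 <= A * b n ^+ 2 + Q)%R.
    by apply: addr_ge0 => //; apply: mulr_ge0 => //; exact: sqr_ge0.
  rewrite -ler_sqr ?nnegrE ?mulr_ge0//.
  rewrite exprMn real_normK ?num_real// exprMn.
  have := sqr_ge0 (A * b n ^+ 2 - Q)%R.
  have : (X ^+ 2 * b n ^+ 2 <= A * Q * b n ^+ 2)%R by rewrite ler_wpM2r ?sqr_ge0.
  by nra.
have e2 : (e n ^+ 2 <= 1)%R.
  by rewrite -real_normK ?num_real// expr_le1.
have : (e n * (X * b n) <= `|X * b n|)%R.
  by rewrite (le_trans (ler_norm _))// (normrM (e n)) ler_piMl.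
have qn := q0 n; have b2 := sqr_ge0 (b n).
have : (q n * (2 * (e n * (X * b n))) <= q n * (A * b n ^+ 2 + Q))%R -> 
  (e n ^+ 2 * (q n * q n * b n ^+ 2) <= 1 * (q n * q n * b n ^+ 2))%R -> 
  ((X + e n * q n * b n) ^+ 2 <= (A + q n) * (Q + q n * b n ^+ 2))%R.
  by move=> h1 h2; nra.
move=> h h'; apply: h; first by rewrite ler_wpM2l//; lra.
by rewrite ler_wpM2r//; apply: mulr_ge0 => //; exact: mulr_ge0.
Qed.

Lemma sum_exp3_tail (R : realType) (n p : nat) :
  (\sum_(0 <= i < p) 3^-1 ^+ (n + i) <= 3 / 2 * 3^-1 ^+ n :> R)%R.
Proof.
under eq_bigr do rewrite exprD.
rewrite -mulr_sumr mulrC ler_wpM2r ?exprn_ge0 ?invr_ge0//.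
have -> : (3 / 2 = 1 / (1 - 3^-1) :> R)%R by field.
have := @geometric_le_lim R p 1 3^-1 ler01.
rewrite /series /geometric /=.
under eq_bigr do rewrite mul1r.
by apply; rewrite ?ger0_norm ?invr_gt0 ?invr_ge0// invf_lt1 ?ltr1n.
Qed.

(** * Uniform boundedness in L2 *)

Section uniform_boundedness.
Context d (T : measurableType d) (R : realType).
Variable m : {measure set T -> \bar R}.
Variable w : nat -> T -> R.
Hypothesis Lw : forall k, L2on m setT (w k).
Let pairing k (f : T -> R) : R := (\int[m]_x (w k x * f x))%R.

(* Sokal's gliding hump: signs e_i make |pairing (k_n) g_n.+1| >= q_n |w_(k_n)|,
   and the tail of the series moves the pairing by half of that at most. *)
Lemma L2_uniform_boundedness :
  (forall f, L2on m setT f -> exists c : R, forall k, `|pairing k f| <= c)%R ->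
  exists c : R, forall k, (fine (sqnorm m setT (w k)) <= c)%R.
Proof.
move=> bnd; apply: contrapT => /forallNP unb.
(* With ratio 1/3 the tail 3/2 q_(n+1) equals q_n / 2, half of the n-th hump. *)
pose q i : R := (3^-1 ^+ i)%R.
have q0 i : (0 < q i)%R by rewrite exprn_gt0.
(* The threshold makes q_n times the norm exceed 2 (n + 1), so that half of the n-th hump still
   exceeds n + 1. *)
have /choice[ks ksP] n : exists k,
    ((2 * n.+1%:R / q n) ^+ 2 < fine (sqnorm m setT (w k)))%R.
  have /existsNP[k /negP] := unb ((2 * n.+1%:R / q n) ^+ 2)%R.
  by rewrite -ltNge; exists k.
pose r n : R := Num.sqrt (fine (sqnorm m setT (w (ks n)))).
have r2 n : (r n ^+ 2 = fine (sqnorm m setT (w (ks n))))%R.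
  by rewrite sqr_sqrtr ?sqnorm_fine_ge0.
have rn n : (2 * n.+1%:R / q n < r n)%R.
  rewrite -ltr_sqr ?nnegrE ?sqrtr_ge0 ?r2//.
  by rewrite divr_ge0// ?mulr_ge0// ltW.
have r0 n : (0 < r n)%R.
  by apply: le_lt_trans (rn n); rewrite divr_ge0// ltW.
pose a n x : R := (w (ks n) x / r n)%R.
have La n : L2on m setT (a n).
  rewrite /a; under eq_fun do rewrite mulrC; exact: L2onZ.
have ma n : measurable_fun setT (a n) by exact: (La n).1.
have a1 n : sqnorm m setT (a n) = 1.
  rewrite -(fineK (L2on_fin_num (La n))) /sqnorm; congr EFin.
  transitivity (r n ^- 2 * fine (sqnorm m setT (w (ks n))))%R.
    rewrite !fine_sqnorm -RintegralZl//; last exact: L2on_integrable.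
    by apply: eq_Rintegral => x _; rewrite /a expr_div_n mulrC.
  by rewrite -r2 mulVf// expf_neq0// gt_eqF.
(* The value 1 at 0 makes the hump count in full also when the pairing vanishes. *)
pose sgn (t : R) : R := if (0 <= t)%R then 1%R else (-1)%R.
have sgn1 t : (`|sgn t| <= 1)%R by rewrite /sgn; case: ifP; rewrite ?normrN normr1.
pose g := fix g n : T -> R := if n is n'.+1 then
  (fun x => g n' x + sgn (pairing (ks n') (g n')) * q n' * a n' x)%R else cst 0%R.
pose e n := sgn (pairing (ks n) (g n)).
have gE n x : g n x = (\sum_(0 <= i < n) e i * q i * a i x)%R.
  elim: n => [|n IH]; first by rewrite big_geq.
  by rewrite big_nat_recr//= -IH.
have Lg n : L2on m setT (g n).
  elim: n => [|n IH]; last by apply: L2onD => //; exact: L2onZ.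
  split; first exact: measurable_cst.
  rewrite /sqnorm (eq_integral (cst 0)) ?integral0//.
  by move=> x _; rewrite /= expr0n.
have hump n : (q n * r n <= `|pairing (ks n) (g n.+1)|)%R.
  have -> : pairing (ks n) (g n.+1) =
      (pairing (ks n) (g n) + e n * (q n * r n))%R.
    rewrite /pairing /= -[X in (_ + X)%R]/(e n * (q n * r n))%R.
    have -> : (e n * (q n * r n) = \int[m]_x (w (ks n) x * (e n * q n * a n x)))%R.
      transitivity (e n * q n / r n * fine (sqnorm m setT (w (ks n))))%R.
        by rewrite -r2; field; rewrite gt_eqF.
      rewrite fine_sqnorm -RintegralZl//; last exact: L2on_integrable.
      by apply: eq_Rintegral => x _; rewrite /a; ring.
    rewrite -RintegralD//; last 2 first.
    - exact: L2onM.
    - by apply: L2onM => //; exact: L2onZ.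
    by apply: eq_Rintegral => x _; rewrite -mulrDr.
  have qr : (0 <= q n * r n)%R by rewrite mulr_ge0// ltW.
  rewrite /e /sgn; case: ifPn => t0.
    by rewrite mul1r ger0_norm ?addr_ge0// lerDr.
  rewrite mulN1r -ltNge in t0 *.
  by rewrite ler0_norm; lra.
(* This weighted tail has integral at most 3/2 q_n, hence is finite almost everywhere, and by
   Cauchy-Schwarz it controls the increments of g pointwise. The limit is thus built pointwise,
   without completeness of L2. *)
pose S n x := \sum_(0 <= i <oo) (q (n + i)%N * a (n + i)%N x ^+ 2)%:E.
have S0 n i x : 0 <= (q (n + i)%N * a (n + i)%N x ^+ 2)%:E.
  by rewrite lee_fin mulr_ge0 ?sqr_ge0// ltW.
have mS n : measurable_fun setT (S n).
  apply: ge0_emeasurable_sum => // i _.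
  by apply/measurable_EFinP/measurable_funM => //; exact: measurable_funX.
have iS n : \int[m]_x S n x <= (3 / 2 * q n)%:E.
  rewrite integral_nneseries//; last first.
    by move=> i; apply/measurable_EFinP/measurable_funM => //; exact: measurable_funX.
  have iE i : \int[m]_x (q (n + i)%N * a (n + i)%N x ^+ 2)%:E = (q (n + i)%N)%:E.
    under eq_integral do rewrite EFinM.
    rewrite ge0_integralZl_EFin//; last 3 first.
    - by move=> x _; rewrite lee_fin sqr_ge0.
    - exact/measurable_EFinP/measurable_funX.
    - exact: ltW.
    by rewrite -/(sqnorm _ _ _) a1 mule1.
  under eq_eseriesr do rewrite iE.
  apply: lime_le; first by apply: is_cvg_nneseries => i _ _; rewrite lee_fin ltW.
  by apply: nearW => p; rewrite sumEFin lee_fin sum_exp3_tail.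
have gB n p x : S n x < +oo ->
    ((g (n + p)%N x - g n x) ^+ 2 <= 3 / 2 * q n * fine (S n x))%R.
  move=> Sy.
  have -> : (g (n + p)%N x - g n x =
      \sum_(0 <= i < p) e (n + i)%N * q (n + i)%N * a (n + i)%N x)%R.
    elim: p => [|p IH]; first by rewrite addn0 subrr big_geq.
    by rewrite big_nat_recr//= -IH addnS /= -/(e _) addrAC.
  apply: le_trans (@weighted_cauchy_schwarz _ (fun i => q (n + i)%N)
    (fun i => a (n + i)%N x) (fun i => e (n + i)%N) _ _ _) _.
  - by move=> i; exact: ltW.
  - by move=> i; exact: sgn1.
  rewrite ler_pM ?sum_exp3_tail//.
  - by apply: sumr_ge0 => i _; rewrite ltW.
  - by apply: sumr_ge0 => i _; rewrite mulr_ge0 ?sqr_ge0// ltW.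
  rewrite -lee_fin fineK; last first.
    by rewrite ge0_fin_numE//; apply: nneseries_ge0 => i _ _; exact: S0.
  by rewrite -sumEFin; apply: nneseries_lim_ge => i _ _; exact: S0.
(* The upper limit is measurable on the whole space, and it is a limit where [S 0] is finite. *)
pose G x := fine (limn_esup (fun n => (g n x)%:E)).
have mG : measurable_fun setT G.
  apply: measurableT_comp => //; apply: measurable_fun_limn_esup => n.
  by apply/measurable_EFinP; exact: (Lg n).1.
have gG x : S 0%N x < +oo -> g n x @[n --> \oo] --> G x.
  move=> Sy.
  (* Absolute convergence, from q |a| <= (q + q a^2) / 2. *)
  have cg : cvgn (series (fun i => e i * q i * a i x)%R).
    apply: normed_cvg.
    have cq : cvgn (series (fun i => (2^-1 * (q i + q i * a i x ^+ 2)))%R).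
      have -> : (fun i => (2^-1 * (q i + q i * a i x ^+ 2)))%R =
          2^-1%R *: ((q + (fun i => (q i * a i x ^+ 2)%R)) : nat -> R).
        by apply/funext => i; rewrite /= fctE.
      apply: is_cvg_seriesZ; apply: is_cvg_seriesD.
        have -> : q = geometric 1%R 3^-1%R by apply/funext => i; rewrite /geometric /= mul1r.
        apply: is_cvg_geometric_series.
        by rewrite ger0_norm ?invr_ge0// invf_lt1 ?ltr1n.
      apply: nnseries_is_cvg => // i; by rewrite mulr_ge0 ?sqr_ge0// ltW.
    apply: series_le_cvg cq => i /=.
    - by [].
    - apply: mulr_ge0 => //; apply: addr_ge0; first exact: ltW.
      by apply: mulr_ge0; [exact: ltW|exact: sqr_ge0].
    rewrite 2!(normrM _ _) (gtr0_norm (q0 i)).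
    apply: (@le_trans _ _ (1 * q i * `|a i x|)%R).
      by apply: ler_wpM2r => //; apply: ler_wpM2r; [exact: ltW|exact: sgn1].
    rewrite mul1r -{2}(mulr1 (q i)) -mulrDr mulrCA; apply: ler_wpM2l; first exact: ltW.
    have := sqr_ge0 (`|a i x| - 1)%R; rewrite sqrrB real_normK ?num_real//; lra.
  have {}cg : cvgn (g^~ x).
    by move: cg; congr (cvg (_ @ \oo)); apply/funext => n; rewrite gE.
  have cgE : (g n x)%:E @[n --> \oo] --> (limn (g^~ x))%:E by exact: EFin_cvg.
  rewrite /G is_cvg_limn_esupE; last by apply/cvg_ex; eexists; exact: cgE.
  by have -> : limn (fun n => (g n x)%:E) = (limn (g^~ x))%:E by exact: cvg_lim.
have Sae : {ae m, forall x, S 0%N x < +oo}.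
  have : m.-integrable setT (S 0%N).
    apply/integrableP; split; first exact: mS.
    apply: le_lt_trans (ltry (3 / 2 * q 0%N)); apply: le_trans (iS 0%N).
    apply: ge0_le_integralW => // x _; rewrite gee0_abs//.
    by apply: nneseries_ge0 => i _ _; exact: S0.
  move=> /(integrable_ae measurableT); apply: filterS => x /(_ I).
  by rewrite ge0_fin_numE//; apply: nneseries_ge0 => i _ _; exact: S0.
have S0y x n : S 0%N x < +oo -> S n x < +oo.
  apply: le_lt_trans; rewrite /S.
  rewrite [leRHS](nneseries_split _ n)//.
  rewrite add0n -[leLHS]add0e leeD//.
    by apply: sume_ge0 => i _; exact: (S0 0%N).
  rewrite -[leRHS](@nneseries_addn R (fun i => (q (0 + i)%N * a (0 + i)%N x ^+ 2)%:E) n)//.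
  by apply: lee_nneseries => i; rewrite ?add0n ?(addnC i).
(* Let p tend to infinity in [gB] and integrate: one factor 3/2 q_n is the sum of the weights, the
   other bounds the integral of [S n]. *)
have LGg n : sqnorm m setT (fun x => G x - g n x)%R <= ((3 / 2 * q n) ^+ 2)%:E.
  have mgn := (Lg n).1.
  rewrite expr2 EFinM.
  apply: (@le_trans _ _ ((3 / 2 * q n)%:E * \int[m]_x S n x)); last first.
    by rewrite lee_pmul2l// lte_fin mulr_gt0// divr_gt0.
  rewrite -ge0_integralZl_EFin//; last 2 first.
  - by move=> x _; apply: nneseries_ge0 => i _ _; exact: S0.
  - by rewrite mulr_ge0 ?divr_ge0// ltW.
  apply: ae_ge0_le_integral => //.
  - by move=> x _; rewrite lee_fin sqr_ge0.
  - exact/measurable_EFinP/measurable_funX/measurable_funB.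
  - move=> x _; apply: mule_ge0; first by rewrite lee_fin mulr_ge0 ?divr_ge0// ltW.
    by apply: nneseries_ge0 => i _ _; exact: S0.
  - exact: measurable_funeM.
  apply: filterS Sae => x Sx _.
  have Sn := S0y x n Sx.
  rewrite -(@fineK _ (S n x)); last first.
    by rewrite ge0_fin_numE//; apply: nneseries_ge0 => i _ _; exact: S0.
  rewrite -EFinM lee_fin.
  have h : (g (p + n)%N x - g n x)%R @[p --> \oo] --> (G x - g n x)%R.
    apply: cvgB; last exact: cvg_cst.
    by have := gG x Sx; rewrite -(cvg_shiftn n).
  have hh : ((g (p + n)%N x - g n x) * (g (p + n)%N x - g n x))%R @[p --> \oo] -->
      ((G x - g n x) * (G x - g n x))%R by exact: cvgM.
  rewrite expr2; apply: (cvgr_to_le hh); apply: nearW => p.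
  by rewrite -expr2 addnC; exact: gB.
have LG : L2on m setT G.
  have := L2onD measurableT (Lg 0%N) (conj (measurable_funB mG (Lg 0%N).1)
    (le_lt_trans (LGg 0%N) (ltry _))).
  by congr L2on; apply/funext => x; rewrite addrC subrK.
have [c bndc] := bnd _ LG.
have [n nc] : exists n : nat, (c < n%:R)%R.
  by exists (Num.truncn `|c|).+1; rewrite (le_lt_trans (ler_norm _))// truncnS_gt.
have := bndc (ks n); apply/negP; rewrite -ltNge.
have LD : L2on m setT (fun x => G x - g n.+1 x)%R.
  exact: L2onB.
have split_ : pairing (ks n) G = (pairing (ks n) (g n.+1) +
    pairing (ks n) (fun x => G x - g n.+1 x))%R.
  rewrite -RintegralD//; last 2 first.
  - exact: L2onM.
  - exact: L2onM.
  by apply: eq_Rintegral => x _; rewrite -mulrDr addrC subrK.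
have tail : (`|pairing (ks n) (fun x => G x - g n.+1 x)| <= 2^-1 * (q n * r n))%R.
  (* This weight balances the two terms of Young's inequality: both become q_n r_n / 2. *)
  have s0 : (0 < 2^-1 * q n / r n)%R by rewrite divr_gt0// mulr_gt0// invr_gt0.
  apply: le_trans (le_Rintegral_mul measurableT (Lw (ks n)) LD s0) _.
  rewrite -r2.
  have : (fine (sqnorm m setT (fun x => G x - g n.+1 x)) <= (2^-1 * q n) ^+ 2)%R.
    rewrite -lee_fin fineK ?L2on_fin_num//.
    apply: le_trans (LGg n.+1) _; rewrite lee_fin /q [(_ ^+ n.+1)%R]exprS.
    by rewrite le_eqVlt; apply/orP; left; apply/eqP; field.
  rewrite -(ler_pM2l (x := (2^-1 * q n / r n)^-1%R)) ?invr_gt0// => h.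
  apply: (@le_trans _ _ (2^-1 * (2^-1 * q n / r n * r n ^+ 2 +
    (2^-1 * q n / r n)^-1 * (2^-1 * q n) ^+ 2)))%R.
    by rewrite ler_pM2l ?invr_gt0// lerD2l.
  rewrite le_eqVlt; apply/orP; left; apply/eqP; field.
  by rewrite !gt_eqF.
have := hump n; have := rn n.
rewrite ltr_pdivrMr// [X in (_ < X)%R]mulrC => h1 h2.
rewrite split_; have := lerB_normD (pairing (ks n) (g n.+1)) 
  (pairing (ks n) (fun x => G x - g n.+1 x)%R).
have n1 : (n%:R < n.+1%:R :> R)%R by rewrite ltr_nat.
lra.
Qed.
End uniform_boundedness.

(** * Jensen's inequality for mean values *)

Section mean_value.
Context d (T : measurableType d) (R : realType).
Variable m : {measure set T -> \bar R}.

Definition mean (A : set T) (f : T -> R) : R :=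
  ((\int[m]_(x in A) f x) / fine (m A))%R.

Lemma sqr_mean_le (A : set T) (f : T -> R) (t : R) : measurable A ->
  0 < m A < +oo -> L2on m A f ->
  ((t - mean A f) ^+ 2)%:E * m A <= sqnorm m A (fun x => t - f x)%R.
Proof.
move=> mA /andP[A0 Ay] Lf.
have Afin : m A \is a fin_num by rewrite ge0_fin_numE.
have mf : measurable_fun A f := Lf.1.
have L1 c : L2on m A (cst c) by apply: (@L2on_bounded _ _ _ _ _ _ `|c|%R).
have Lt : L2on m A (fun x => t - f x)%R by exact: L2onB (L1 t) Lf.
have If : m.-integrable A (EFin \o f).
  by have := L2onM mA (L1 1%R) Lf; under eq_fun do rewrite mul1r.
have Ic c : m.-integrable A (EFin \o cst c).
  by have := L2onM mA (L1 1%R) (L1 c); under eq_fun do rewrite mul1r.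
rewrite -(fineK (L2on_fin_num Lt)) -(fineK Afin) -EFinM lee_fin.
set a := mean A f.
have A0' : (fine (m A) != 0)%R by rewrite gt_eqF// fine_gt0// A0 Ay.
have aE : (\int[m]_(x in A) f x = a * fine (m A))%R by rewrite /a /mean divfK.
(* The integrand is the tangent at f x = a to the parabola (t - f x)^2. It lies below the parabola
   by (a - f x)^2, and being affine in f x it has an integral that only depends on the mean. *)
have -> : ((t - a) ^+ 2 * fine (m A) =
    \int[m]_(x in A) (((t - a) ^+ 2 + 2 * (t - a) * a) - 2 * (t - a) * f x))%R.
  rewrite RintegralB//; last 2 first.
  - exact: Ic.
  - by rewrite /comp; under eq_fun do rewrite EFinM; exact: integrableZl.
  by rewrite RintegralZl// Rintegral_cst// aE; ring.
rewrite fine_sqnorm; apply: le_Rintegral => //.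
- rewrite /comp; under eq_fun do rewrite EFinB EFinM.
  by apply: integrableB => //; [exact: Ic|exact: integrableZl].
- exact: L2on_integrable.
move=> x _; have := sqr_ge0 (a - f x)%R; nra.
Qed.

End mean_value.

(** * Lipschitz functions with compact support *)

Lemma cvge_lt_near (R : realType) (I : Type) (F : set_system I) {FF : Filter F}
    (f : I -> \bar R) (l : \bar R) : f x @[x --> F] --> l ->
  forall r : \bar R, l < r -> \forall x \near F, f x < r.
Proof.
move=> fl r lr; apply: (fl [set y | y < r]); apply: open_nbhs_nbhs; split => //.
exact: open_ereal_lt_ereal.
Qed.

Lemma measure_mono d (T : measurableType d) (R : realType)
    (m : {measure set T -> \bar R}) (A B : set T) :
  measurable A -> measurable B -> A `<=` B -> m A <= m B.
Proof. by move=> mA mB AB; apply: le_measure => //; exact: mem_set. Qed.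

Section borel_metric.
Context (R : realType) d (M : borelMetricType R d).
Implicit Types (x y z : M) (r : R) (f : M -> R).

Lemma borel_open_measurable (A : set M) : open A -> measurable A.
Proof. by move=> oA; rewrite measurable_borelE; exact: sub_sigma_algebra. Qed.

Lemma in_ballE x r y : ball x r y = (mdist x y < r)%R.
Proof. by rewrite ballEmdist. Qed.

Lemma metric_openP (A : set M) :
  open A <-> forall x, A x -> exists2 r, (0 < r)%R & ball x r `<=` A.
Proof.
rewrite openE; split=> [oA x /oA|h x /h [r r0 xrA]].
  by move=> /nbhs_ballP[r /= r0 xr]; exists r.
by apply/nbhs_ballP; exists r.
Qed.

Lemma metric_ball_open x r : open (ball x r).
Proof.
apply/metric_openP => y; rewrite in_ballE => xy.
exists (r - mdist x y)%R; rewrite ?subr_gt0// => z; rewrite !in_ballE ltrBrDl.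
exact: le_lt_trans (metric_triangle _ _ _).
Qed.

Lemma metric_ball_measurable x r : measurable (ball x r).
Proof. exact/borel_open_measurable/metric_ball_open. Qed.

Lemma mdistB_le x y z : (`|mdist x z - mdist y z| <= mdist x y)%R.
Proof.
rewrite ler_norml; have := metric_triangle y x z; have := metric_triangle x y z.
rewrite (metric_sym y x); lra.
Qed.

Definition lipschitz_with (L : R) f := forall x y, (`|f x - f y| <= L * mdist x y)%R.

Lemma lipschitz_mdist z : lipschitz_with 1 (fun x => mdist x z).
Proof. by move=> x y; rewrite mul1r mdistB_le. Qed.

Lemma lipschitz_with_ge L L' f : (L <= L')%R -> lipschitz_with L f ->
  lipschitz_with L' f.
Proof.
by move=> LL' lf x y; rewrite (le_trans (lf x y))// ler_wpM2r// mdist_ge0.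
Qed.

Lemma lipschitz_open f L a : lipschitz_with L f -> open [set x | (a < f x)%R].
Proof.
move=> lf; apply/metric_openP => x /= ax.
have l1 : (0 < `|L| + 1)%R by rewrite ltr_wpDl.
exists ((f x - a) / (`|L| + 1))%R; first by rewrite divr_gt0// subr_gt0.
move=> y /=; rewrite in_ballE ltr_pdivlMr// => xy.
have := lf x y; rewrite ler_norml => /andP[_ h].
have : (L * mdist x y <= mdist x y * (`|L| + 1))%R.
  by rewrite mulrC ler_wpM2l ?mdist_ge0// (le_trans (ler_norm _))// lerDl.
lra.
Qed.

Lemma lipschitz_measurable f L : lipschitz_with L f -> measurable_fun setT f.
Proof.
move=> lf; apply: (measurability _ (RGenOInfty.measurableE R)).
move=> _ [_ [a ->] <-]; rewrite setTI; apply: borel_open_measurable.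
have -> : f @^-1` `]a, +oo[ = [set x | (a < f x)%R].
  by apply/seteqP; split=> x /=; rewrite in_itv/= andbT.
exact: lipschitz_open lf.
Qed.

Lemma lipschitz_continuous f L : lipschitz_with L f -> continuous f.
Proof.
move=> lf; apply/continuousP => A oA; apply/metric_openP => x Ax.
have /nbhs_ballP[e /= e0 eA] : nbhs (f x) A by exact: open_nbhs_nbhs.
have l1 : (0 < `|L| + 1)%R by rewrite ltr_wpDl.
exists (e / (`|L| + 1))%R; first by rewrite divr_gt0.
move=> y; rewrite in_ballE ltr_pdivlMr// => xy; apply: eA; rewrite /ball /=.
apply: le_lt_trans (lf x y) _; apply: le_lt_trans xy.
by rewrite mulrC ler_wpM2l ?mdist_ge0// (le_trans (ler_norm _))// lerDl.
Qed.

Lemma lipschitz_withD L L' f g : lipschitz_with L f -> lipschitz_with L' g ->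
  lipschitz_with (L + L') (fun x => f x + g x)%R.
Proof.
move=> lf lg x y; rewrite opprD addrACA (le_trans (ler_normD _ _))// mulrDl.
by rewrite lerD.
Qed.

Lemma lipschitz_withZ a L f : lipschitz_with L f ->
  lipschitz_with (`|a| * L) (fun x => a * f x)%R.
Proof. by move=> lf x y; rewrite -mulrBr normrM -mulrA ler_wpM2l. Qed.

Lemma lipschitz_with_min L f c : lipschitz_with L f ->
  lipschitz_with L (fun x => Num.min (f x) c).
Proof.
move=> lf x y; apply: le_trans (lf x y).
rewrite /Num.min; case: ltP => h1; case: ltP => h2; rewrite ?subrr ?normr0//;
 rewrite !ler_normr !ler_norml; lra.
Qed.

Section separable_borel_metric.
Hypothesis sepM : exists2 A : set M, countable A & dense A.

Lemma dense_sequence : exists a : nat -> M,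
  forall x r, (0 < r)%R -> exists n, (mdist x (a n) < r)%R.
Proof.
have [A cA dA] := sepM.
have A0 : A !=set0.
  have [|x [_ Ax]] := dA setT _ openT; last by exists x.
  by exists point.
have /pfcard_geP[A0'|/unsquash a] := cA; first by move: A0; rewrite A0' => -[].
exists a => x r r0.
have [|y [xy Ay]] := dA (ball x r) _ (metric_ball_open _ _).
  by exists x; rewrite in_ballE mdistxx.
have [n _ any] := 'surj_a Ay.
by exists n; rewrite any -in_ballE.
Qed.

(** Measurability is for the product of the Borel sigma-algebras, and separability provides it: the
    distance of x and y exceeds r exactly when mdist x a_n - mdist y a_n does for some a_n, one
    close to y. *)
Lemma measurable_mdist : measurable_fun setT (fun p : M * M => mdist p.1 p.2).
Proof.
have [a adense] := dense_sequence.
apply: (measurability _ (RGenOInfty.measurableE R)).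
move=> _ [_ [r ->] <-]; rewrite setTI.
have -> : (fun p : M * M => mdist p.1 p.2) @^-1` `]r, +oo[ =
    \bigcup_n [set p | (r < mdist p.1 (a n) - mdist p.2 (a n))%R].
  apply/seteqP; split=> [[x y]|[x y] [n _]] /=; rewrite in_itv/= andbT.
    move=> rxy; have [n yn] := adense y ((mdist x y - r) / 2)%R ltac:(by
      rewrite divr_gt0 ?subr_gt0).
    exists n => //=; have := metric_triangle x (a n) y.
    rewrite (metric_sym (a n) y) => h.
    rewrite ltr_pdivlMr// in yn; lra.
  have := metric_triangle x y (a n); lra.
apply: bigcup_measurable => n _.
rewrite -[X in measurable X]setTI.
have md : measurable_fun setT (fun p : M * M => mdist p.1 (a n) - mdist p.2 (a n))%R.
  apply: measurable_funB.
    exact: (measurableT_comp (lipschitz_measurable (lipschitz_mdist (a n)))).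
  exact: (measurableT_comp (lipschitz_measurable (lipschitz_mdist (a n)))).
have := md measurableT `]r, +oo[%classic (measurable_itv _).
by congr measurable; apply/seteqP; split=> p /=; rewrite in_itv/= andbT.
Qed.

Lemma measurable_mdist_gt r : measurable [set p : M * M | (r < mdist p.1 p.2)%R].
Proof.
have := measurable_mdist measurableT (measurable_itv `]r, +oo[).
by rewrite setTI; congr measurable; apply/seteqP; split=> p /=; rewrite in_itv/= andbT.
Qed.

End separable_borel_metric.
End borel_metric.

Section compactly_supported_lipschitz.
Context (R : realType) d (M : borelMetricType R d).
Variables (m : {measure set M -> \bar R}) (x0 : M).
Hypothesis Mmms : metric_measure_space m.
Implicit Types (x y z : M) (r : R) (f : M -> R).

Lemma measure_ball_lty x r : m (ball x r) < +oo.
Proof.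
have [r0|r0] := ltP 0%R r; first by have /andP[] := mms_volume Mmms x r0.
suff -> : ball x r = set0 by rewrite measure0.
by apply/seteqP; split=> y //; rewrite in_ballE => /(le_lt_trans (mdist_ge0 _ _));
  rewrite ltNge r0.
Qed.

(** The net indexes the finitely many test functions that detect every jump longer than delta. *)
Lemma closure_ball_net r (e : R) : (0 < r)%R -> (0 < e)%R ->
  exists s : seq M, forall x, ball x0 r x -> exists2 p, p \in s & (mdist x p < e)%R.
Proof.
move=> r0 e0; have := mms_compact Mmms (x := x0) r0; rewrite compact_cover.
move=> /(_ M setT (fun p => ball p e)).
case=> [p _|x _|D _ cov].
- exact: metric_ball_open.
- by exists x => //; rewrite in_ballE mdistxx.
exists (enum_fset D) => x /(@subset_closure _ _ x)/cov[p /= pD].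
by rewrite in_ballE metric_sym => px; exists p.
Qed.

Lemma compact_sub_ball (K : set M) : compact K -> exists2 i : nat, (0 < i)%N & K `<=` ball x0 i%:R.
Proof.
rewrite compact_cover => /(_ nat setT (fun i => ball x0 i%:R)).
case=> [i _|x _|D _ cov].
- exact: metric_ball_open.
- exists (Num.truncn (mdist x0 x)).+1 => //; rewrite in_ballE.
  exact: truncnS_gt.
exists (\max_(i <- enum_fset D) i).+1 => // x /cov[i /= iD]; rewrite !in_ballE => xi.
apply: lt_le_trans xi _; rewrite ler_nat; apply: leqW.
by rewrite (big_rem i)//= leq_maxl.
Qed.

Lemma Lip_cW f L i : lipschitz_with L f -> (forall x, ~ ball x0 i%:R x -> f x = 0%R) ->
  Lip_c f.
Proof.
move=> lf f0; split; first by exists L.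
(* The successor keeps the radius positive when i = 0, as compactness of closed balls requires. *)
have sub : [set x | f x != 0%R] `<=` ball x0 i.+1%:R.
  move=> x /= fx; apply: contrapT => xi; move: fx; rewrite f0 ?eqxx//.
  move=> /= xi'; apply: xi; rewrite !in_ballE in xi' *; apply: lt_le_trans xi' _.
  by rewrite ler_nat.
apply: subclosed_compact (mms_compact Mmms (x := x0) (ltr0Sn R i)) _.
  exact: closed_closure.
exact: closure_subset.
Qed.

Lemma Lip_c_support f : Lip_c f -> exists2 i : nat, (0 < i)%N &
  forall x, ~ ball x0 i%:R x -> f x = 0%R.
Proof.
move=> [_ /compact_sub_ball[i i0 iK]]; exists i => // x xi.
by apply: contrapT => /eqP fx; apply/xi/iK/subset_closure.
Qed.

Lemma Lip_c_lipschitz f : Lip_c f -> exists2 L, (0 <= L)%R & lipschitz_with L f.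
Proof.
move=> [[L lf] _]; exists `|L|%R => //; apply: lipschitz_with_ge lf; exact: ler_norm.
Qed.

Lemma Lip_c_measurable f : Lip_c f -> measurable_fun setT f.
Proof. by move=> /Lip_c_lipschitz[L _ /lipschitz_measurable]. Qed.

Lemma Lip_c_bounded f : Lip_c f -> exists2 b : R, (0 <= b)%R & forall x, (`|f x| <= b)%R.
Proof.
move=> cf; have [L L0 lf] := Lip_c_lipschitz cf; have [i i0 f0] := Lip_c_support cf.
exists (`|f x0| + L * i%:R)%R => [|x]; first by rewrite addr_ge0// mulr_ge0.
have [xi|/f0 ->] := pselect (ball x0 i%:R x); last first.
  by rewrite normr0 addr_ge0// mulr_ge0.
rewrite -lerBlDl; apply: le_trans (lerB_dist _ _) _.
apply: le_trans (lf _ _) _; rewrite ler_wpM2l// metric_sym ltW//.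
by move: xi; rewrite in_ballE.
Qed.

Lemma L2on_bounded_support f b i : measurable_fun setT f ->
  (forall x, `|f x| <= b)%R -> (forall x, ~ ball x0 i%:R x -> f x = 0%R) ->
  L2on m setT f.
Proof.
move=> mf fb f0; split => //.
have mB := @metric_ball_measurable _ _ _ x0 i%:R.
have [_ ] := L2on_bounded mB (measure_ball_lty x0 i%:R)
  (measurable_funS measurableT (@subsetT _ _) mf) (fun x _ => fb x).
apply: le_lt_trans; rewrite /sqnorm [leRHS]integral_mkcond.
apply: ge0_le_integralW => x _; first by rewrite lee_fin sqr_ge0.
rewrite patchE; case: ifPn => // /negP xi.
by rewrite f0 ?expr0n// => xB; apply: xi; rewrite mem_set.
Qed.

Lemma Lip_c_L2on f : Lip_c f -> L2on m setT f.
Proof.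
move=> cf; have [b _ fb] := Lip_c_bounded cf; have [i _ f0] := Lip_c_support cf.
exact: L2on_bounded_support (Lip_c_measurable cf) fb f0.
Qed.

Lemma Lip_cD f g : Lip_c f -> Lip_c g -> Lip_c (fun x => f x + g x)%R.
Proof.
move=> cf cg; have [L _ lf] := Lip_c_lipschitz cf; have [i _ f0] := Lip_c_support cf.
have [L' _ lg] := Lip_c_lipschitz cg; have [i' _ g0] := Lip_c_support cg.
apply: (@Lip_cW _ _ (maxn i i') (lipschitz_withD lf lg)) => x xi.
rewrite f0 ?g0 ?addr0// => xi'; apply: xi; rewrite !in_ballE in xi' *;
  by rewrite (lt_le_trans xi')// ler_nat ?leq_maxl ?leq_maxr.
Qed.

Lemma Lip_cZ (a : R) f : Lip_c f -> Lip_c (fun x => a * f x)%R.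
Proof.
move=> cf; have [L _ lf] := Lip_c_lipschitz cf; have [i _ f0] := Lip_c_support cf.
by apply: (@Lip_cW _ _ i (lipschitz_withZ a lf)) => x /f0 ->; rewrite mulr0.
Qed.

Lemma Lip_cB f g : Lip_c f -> Lip_c g -> Lip_c (fun x => f x - g x)%R.
Proof.
by move=> cf /(Lip_cZ (-1)) cg; have := Lip_cD cf cg; under eq_fun do rewrite mulN1r.
Qed.

Lemma Lip_c0 : Lip_c (fun _ : M => 0%R : R).
Proof. by apply: (@Lip_cW _ 0 0) => // x y; rewrite subrr normr0 mul0r. Qed.

(** A stand-in for the distance to the complement of O: 1-Lipschitz, zero off O, and positive on O
    if O is open. The cap at 1 keeps the supremum finite when O is the whole space. *)
Definition inner_radius (O : set M) x : R :=
  sup [set r | (0 <= r <= 1)%R /\ ball x r `<=` O].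

Lemma has_sup_inner_radius (O : set M) x :
  has_sup [set r | (0 <= r <= 1)%R /\ ball x r `<=` O].
Proof.
split; last by exists 1%R => r [/andP[]].
exists 0%R; split; first by rewrite lexx ler01.
by move=> y; rewrite in_ballE ltNge mdist_ge0.
Qed.

Lemma inner_radius_ge0 (O : set M) x : (0 <= inner_radius O x)%R.
Proof.
apply: sup_upper_bound (has_sup_inner_radius O x) _ _.
split; first by rewrite lexx ler01.
by move=> y; rewrite in_ballE ltNge mdist_ge0.
Qed.

Lemma inner_radius_gt0 (O : set M) x : open O -> O x -> (0 < inner_radius O x)%R.
Proof.
move=> /metric_openP oO /oO[r r0 xrO].
apply: (@lt_le_trans _ _ (Num.min r 1)%R); first by rewrite lt_min r0 ltr01.
apply: sup_upper_bound (has_sup_inner_radius O x) _ _.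
split; first by rewrite le_min (ltW r0) ler01 ge_min lexx orbT.
move=> y; rewrite in_ballE lt_min => /andP[xy _]; apply: xrO.
by rewrite in_ballE.
Qed.

Lemma inner_radius_out (O : set M) x : ~ O x -> inner_radius O x = 0%R.
Proof.
move=> Ox; apply/eqP; rewrite eq_le inner_radius_ge0 andbT.
apply: ge_sup; first by have [] := has_sup_inner_radius O x.
move=> r [/andP[r0 _] xrO]; rewrite leNgt; apply/negP => r0'.
by apply/Ox/xrO; rewrite in_ballE mdistxx.
Qed.

Lemma lipschitz_inner_radius (O : set M) : lipschitz_with 1 (inner_radius O).
Proof.
have key x y : (inner_radius O x <= inner_radius O y + mdist x y)%R.
  apply: ge_sup; first by have [] := has_sup_inner_radius O x.
  move=> r [/andP[r0 r1] xrO]; rewrite -lerBlDr.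
  have [h|h] := leP 0%R (r - mdist x y)%R; last first.
    by apply: le_trans (ltW h) (inner_radius_ge0 _ _).
  apply: sup_upper_bound (has_sup_inner_radius O y) _ _; split.
    by rewrite h /= (le_trans _ r1)// gerBl mdist_ge0.
  move=> z; rewrite in_ballE => yz; apply: xrO; rewrite in_ballE.
  apply: le_lt_trans (metric_triangle x y z) _; lra.
move=> x y; rewrite mul1r ler_norml; have := key x y; have := key y x.
rewrite (metric_sym y x); lra.
Qed.

(** Membership in the L2 closure of [Lip_c]. It is established in turn for indicators of bounded
    open sets, indicators of bounded Borel sets, simple functions cut off to a ball, and nonnegative
    functions. *)
Definition approximable f := L2on m setT f /\ forall e : R, (0 < e)%R ->
  exists2 g, Lip_c g & sqnorm m setT (fun x => f x - g x)%R < e%:E.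

Lemma approximable_closed f : L2on m setT f ->
  (forall e : R, (0 < e)%R -> exists2 g, approximable g &
    sqnorm m setT (fun x => f x - g x)%R < e%:E) -> approximable f.
Proof.
move=> Lf h; split => // e e0.
have e4 : (0 < e / 4)%R by rewrite divr_gt0.
have [g [Lg /(_ _ e4)[k ck gk]] fg] := h _ e4.
exists k => //; have Lk := Lip_c_L2on ck.
rewrite (_ : (fun x => f x - k x)%R = fun x => ((f x - g x) + (g x - k x))%R); last first.
  by apply/funext => x; rewrite addrA subrK.
apply: le_lt_trans (sqnormD_le m measurableT (L2onB measurableT Lf Lg).1
  (L2onB measurableT Lg Lk).1) _.
have -> : e%:E = 2%:E * ((e / 4)%:E + (e / 4)%:E) by rewrite -EFinD -EFinM; congr EFin; field.
by rewrite lte_pmul2l// lteD.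
Qed.

Lemma approximableZ (a : R) f : approximable f -> approximable (fun x => a * f x)%R.
Proof.
move=> [Lf h]; split; first exact: L2onZ.
move=> e e0; have a1 : (0 < a ^+ 2 + 1)%R by rewrite ltr_wpDl ?sqr_ge0.
have [g cg fg] := h (e / (a ^+ 2 + 1))%R (divr_gt0 e0 a1).
exists (fun x => a * g x)%R; first exact: Lip_cZ.
have LB := L2onB measurableT Lf (Lip_c_L2on cg).
apply: (@le_lt_trans _ _ ((a ^+ 2 + 1)%:E * sqnorm m setT (fun x => f x - g x)%R)).
  rewrite -ge0_integralZl_EFin//; last 3 first.
  - by move=> x _; rewrite lee_fin sqr_ge0.
  - by apply/measurable_EFinP/measurable_funX; exact: LB.1.
  - exact: ltW.
  apply: ge0_le_integralW => x _; first by rewrite lee_fin sqr_ge0.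
  rewrite -EFinM lee_fin -mulrBr exprMn mulrDl mul1r lerDl; exact: sqr_ge0.
by rewrite muleC -lte_pdivlMr.
Qed.

Lemma approximableD f g : approximable f -> approximable g ->
  approximable (fun x => f x + g x)%R.
Proof.
move=> [Lf hf] [Lg hg]; split; first exact: L2onD.
move=> e e0; have e4 : (0 < e / 4)%R by rewrite divr_gt0.
have [f' cf ff] := hf _ e4; have [g' cg gg] := hg _ e4.
exists (fun x => f' x + g' x)%R; first exact: Lip_cD.
rewrite (_ : (fun x => _) = fun x => ((f x - f' x) + (g x - g' x))%R); last first.
  by apply/funext => x; rewrite opprD addrACA.
apply: le_lt_trans (sqnormD_le m measurableT (L2onB measurableT Lf (Lip_c_L2on cf)).1
  (L2onB measurableT Lg (Lip_c_L2on cg)).1) _.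
have -> : e%:E = 2%:E * ((e / 4)%:E + (e / 4)%:E) by rewrite -EFinD -EFinM; congr EFin; field.
by rewrite lte_pmul2l// lteD.
Qed.

Lemma approximable_Lip_c f : Lip_c f -> approximable f.
Proof.
move=> cf; split; first exact: Lip_c_L2on.
move=> e e0; exists f => //; rewrite /sqnorm (eq_integral (cst 0)) ?integral0//.
by move=> x _; rewrite subrr expr0n.
Qed.

Lemma approximable_cvg f (f_ : nat -> M -> R) (h : M -> R) : L2on m setT f ->
  (forall n, approximable (f_ n)) -> L2on m setT h ->
  (forall n x, `|f_ n x - f x| <= h x)%R ->
  (forall x, f_ n x @[n --> \oo] --> f x) -> approximable f.
Proof.
move=> Lf af Lh fh ff; apply: approximable_closed => // e e0.
have := @L2_dominated_cvg _ _ _ m setT f_ f h measurableT (fun n => (af n).1.1) Lf.1 Lh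
  (fun n x _ => fh n x) (fun x _ => ff x).
move=> /cvge_lt_near/(_ _ (_ : 0 < e%:E))[//|n _ hn].
exists (f_ n) => //; have := hn n (leqnn n); congr (_ < _).
by apply: eq_integral => x _; rewrite -sqrrN opprB.
Qed.

(** Multiples of [inner_radius O], capped at 1, increase to the indicator, which also dominates the
    differences. *)
Lemma approximable_open (O : set M) i : open O -> O `<=` ball x0 i%:R ->
  approximable \1_O.
Proof.
move=> oO Oi; have mO := borel_open_measurable oO.
have L1 : L2on m setT (\1_O : M -> R).
  apply: (@L2on_bounded_support _ 1%R i) => [|x|x xi].
  - exact: measurable_indic.
  - by rewrite indicE; case: (_ \in _); rewrite ?normr1 ?normr0.
  - by rewrite indicE memNset// => /Oi.
apply: (@approximable_cvg _ (fun n x => Num.min (n%:R * inner_radius O x) 1)%R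
  (\1_O)) => // [n|n x|x].
- apply: approximable_Lip_c.
  apply: (@Lip_cW _ (`|n%:R| * 1)%R i).
    exact/lipschitz_with_min/lipschitz_withZ/lipschitz_inner_radius.
  move=> x xi; rewrite inner_radius_out ?mulr0; last by move=> /Oi.
  by apply/min_idPl.
- rewrite indicE; have [xO|xO] := boolP (x \in O); rewrite /=.
    rewrite ler_norml.
    have : (0 <= n%:R * inner_radius O x)%R by rewrite mulr_ge0 ?inner_radius_ge0.
    rewrite /Num.min; case: ltP; lra.
  rewrite inner_radius_out ?mulr0; last by move: xO; rewrite notin_setE.
  by rewrite (_ : Num.min 0 1 = 0)%R ?subr0 ?normr0//; apply/min_idPl.
- rewrite indicE; have [xO|xO] := boolP (x \in O); rewrite /=; last first.
    rewrite inner_radius_out; last by move: xO; rewrite notin_setE.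
    under eq_fun do rewrite mulr0 (_ : Num.min 0 1 = 0)%R ?(min_idPl _)//.
    exact: cvg_cst.
  have r0 : (0 < inner_radius O x)%R by apply: inner_radius_gt0 => //; exact: set_mem.
  apply: cvg_near_cst; exists (Num.truncn (inner_radius O x)^-1).+1 => // n /= xn.
  apply/min_idPr; rewrite -ler_pdivrMr// div1r.
  by apply: le_trans (ltW (truncnS_gt _)) _; rewrite ler_nat.
Qed.

(** Outer regularity of the Radon measure; the open set is intersected with the ball to stay
    bounded. *)
Lemma approximable_indic (A : set M) i : measurable A -> A `<=` ball x0 i%:R ->
  approximable \1_A.
Proof.
move=> mA Ai.
have mB := @metric_ball_measurable _ _ _ x0 i%:R.
have Ay : m A < +oo.
  apply: le_lt_trans (measure_ball_lty x0 i%:R); exact: measure_mono.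
have Afin : m A \is a fin_num by rewrite ge0_fin_numE.
have L1 : L2on m setT (\1_A : M -> R).
  apply: (@L2on_bounded_support _ 1%R i) => [|x|x xi].
  - exact: measurable_indic.
  - by rewrite indicE; case: (_ \in _); rewrite ?normr1 ?normr0.
  - by rewrite indicE memNset// => /Ai.
apply: approximable_closed => // e e0.
have [_ outer _] := mms_radon Mmms.
have : m A < m A + e%:E by rewrite lteDl// lte_fin.
rewrite {1}(outer _ mA) => /ereal_inf_lt[_ [W [oO AO] <-] Oe].
pose O' := W `&` ball x0 i%:R.
have oO' : open O' by apply: openI => //; exact: metric_ball_open.
have AO' : A `<=` O' by move=> x Ax; split; [exact: AO|exact: Ai].
have mO' := borel_open_measurable oO'.
exists \1_O'; first by apply: (@approximable_open _ i) => // x [].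
have -> : sqnorm m setT (fun x => \1_A x - \1_O' x)%R = m (O' `\` A).
  rewrite -[X in _ = m X]setIT -integral_indic//; last exact: measurableD.
  apply: eq_integral => x _; rewrite !indicE in_setD.
  have [xA|xA] := boolP (x \in A).
    by rewrite (mem_set (AO' _ (set_mem xA))) subrr expr0n.
  by rewrite sub0r sqrrN; case: (x \in O'); rewrite ?expr1n ?expr0n.
rewrite measureD//; last first.
  apply: le_lt_trans (measure_ball_lty x0 i%:R); apply: measure_mono => //.
  by move=> x [].
rewrite setIidr// lteBlDr// addeC; apply: le_lt_trans Oe.
by apply: measure_mono => //; [exact: borel_open_measurable|move=> x []].
Qed.

Lemma approximable_sum (I : Type) (s : seq I) (F : I -> M -> R) :
  (forall k, approximable (F k)) -> approximable (fun x => \sum_(k <- s) F k x)%R.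
Proof.
move=> aF; elim: s => [|k s IH].
  by under eq_fun do rewrite big_nil; apply: approximable_Lip_c; exact: Lip_c0.
by under eq_fun do rewrite big_cons; exact: approximableD.
Qed.

Import HBNNSimple.

Lemma approximable_nnsfun (s : {nnsfun M >-> R}) i :
  approximable (fun x => s x * \1_(ball x0 i%:R) x)%R.
Proof.
set r := fset_set (range s).
have -> : (fun x => s x * \1_(ball x0 i%:R) x)%R = (fun x => \sum_(k < #|` r|)
    r`_k * \1_(s @^-1` [set r`_k] `&` ball x0 i%:R) x)%R.
  apply/funext => x; rewrite fimfunEord mulr_suml; apply: eq_bigr => k _.
  by rewrite indicI /= mulrA.
apply: approximable_sum => k; apply: approximableZ.
apply: (@approximable_indic _ i); last by move=> x [].
by apply: measurableI => //; exact: metric_ball_measurable.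
Qed.

(** Simple functions increasing to f, cut off outside the ball of radius n, converge pointwise and
    stay between 0 and f. *)
Lemma approximable_ge0 f : L2on m setT f -> (forall x, 0 <= f x)%R -> approximable f.
Proof.
move=> Lf f0; have mf : measurable_fun setT (EFin \o f) by exact/measurable_EFinP/Lf.1.
pose s := nnsfun_approx measurableT mf.
have sf n x : (s n x <= f x)%R.
  by rewrite -lee_fin nnsfun_approxE; apply: le_approx => // y _; rewrite lee_fin.
apply: (@approximable_cvg _ (fun n x => s n x * \1_(ball x0 n%:R) x)%R f) => //.
- by move=> n; exact: approximable_nnsfun.
- move=> n x; have := sf n x; have : (0 <= s n x)%R by [].
  rewrite indicE; case: (_ \in _); rewrite /= ?mulr1 ?mulr0 ler_norml; have := f0 x; lra.
- move=> x; rewrite -[X in _ --> X]mulr1; apply: cvgM.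
    have sE : (EFin \o s^~ x) n @[n --> \oo] --> (EFin \o f) x.
      by apply: cvg_nnsfun_approx => // y _; rewrite lee_fin.
    exact: (fine_cvg sE).
  apply: cvg_near_cst; exists (Num.truncn (mdist x0 x)).+1 => // n /= xn.
  rewrite indicE mem_set// in_ballE; apply: lt_le_trans (truncnS_gt _) _.
  by rewrite ler_nat.
Qed.

Lemma Lip_c_dense_L2 f : L2on m setT f -> forall e : R, (0 < e)%R ->
  exists2 g, Lip_c g & sqnorm m setT (fun x => f x - g x)%R < e%:E.
Proof.
move=> Lf; have mf := Lf.1.
have Lmax (h : M -> R) : L2on m setT h -> approximable (fun x => Num.max (h x) 0)%R.
  move=> Lh; apply: approximable_ge0; last by move=> x; rewrite le_max lexx orbT.
  split; first by apply: measurable_maxr => //; exact: Lh.1.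
  apply: le_lt_trans Lh.2; apply: le_sqnorm => x _.
  by rewrite /Num.max; case: ltP => h0; rewrite ?normr0.
have [_] := approximableD (Lmax _ Lf)
  (approximableZ (-1) (Lmax _ (L2onZ (-1) measurableT Lf))).
move=> h e /h[g cg]; rewrite [X in X < _](_ : _ = sqnorm m setT (fun x => f x - g x)%R).
  by move=> fg; exists g.
apply: eq_integral => x _; congr (_ ^+ 2)%:E; congr (_ - _)%R.
have [h0|h0] := leP 0%R (f x).
  by rewrite !mulN1r max_r ?oppr_le0// subr0.
by rewrite !mulN1r max_l ?oppr_ge0 ?ltW// opprK add0r.
Qed.

End compactly_supported_lipschitz.

(** * Symmetric jump forms at distance above delta *)

Section real_inequalities.
Context (R : realType).
Local Open Scope ring_scope.

(** Last step of [form_energy_lower_bound_L2]: i1 is the pairing of the clipped function, i2 that of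
    the clipping error, and p1, p2 are the two terms of Young's inequality. *)
Lemma linear_form_perturbation (i1 i2 x1 x2 p1 p2 e : R) : - 2 * i1 - x1 <= x2 ->
  - (2^-1 * (p1 + p2)) <= i2 -> i2 <= 2^-1 * (p1 + p2) ->
  p2 <= e / 2 -> p1 <= e / 2 -> - 2 * (i1 - i2) - x1 <= x2 + e.
Proof. lra. Qed.

(** Last step of [form_energy_approx]: X and Y are the energies of f and u, I is the pairing of u -
    f with the generator of f, and P, Q are multiples of the squared distance of f and u. *)
Lemma near_maximizer (t X Y P Q I e : R) : 0 < t -> t <= 4^-1 -> 0 <= X -> 0 <= Y ->
  0 <= P -> 0 <= Q -> Y <= (1 + t) * X + P -> 3 * t * Y <= e / 4 -> P + Q <= e / 4 ->
  - (2^-1 * Q + t * X) <= I <= 2^-1 * Q + t * X -> 0 < e ->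
  Y - e <= - 2 * (- X + I) - X.
Proof.
move=> t0 t4 X0 Y0 P0 Q0 YX tY PQ /andP[lo hi] e0.
have key : 0 <= (1 - 2 * t) * X - (1 - 3 * t) * Y + P.
  have t1 : 0 < 1 + t by rewrite addr_gt0.
  rewrite -(pmulr_rge0 _ t1).
  have h1 : 0 <= (1 - 2 * t) * ((1 + t) * X + P - Y).
    by rewrite mulr_ge0 ?subr_ge0//; lra.
  have h2 : 0 <= t ^+ 2 * Y by rewrite mulr_ge0// sqr_ge0.
  have h3 : 0 <= t * P by rewrite mulr_ge0// ltW.
  have -> : (1 + t) * ((1 - 2 * t) * X - (1 - 3 * t) * Y + P) =
    (1 - 2 * t) * ((1 + t) * X + P - Y) + 3 * (t ^+ 2 * Y) + 3 * (t * P) by ring.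
  by rewrite !addr_ge0// mulr_ge0.
lra.
Qed.

End real_inequalities.

Section jump_form.
Context (R : realType) d (M : borelMetricType R d).
Hypothesis sepM : exists2 A : set M, countable A & dense A.
Variables (m : {measure set M -> \bar R}) (B : set M) (delta : R).
Variables (mu : M -> {measure set M -> \bar R}) (c : M -> M -> R).
Hypothesis mB : measurable B.
Hypothesis c_ge0 : forall x y, (0 <= c x y)%R.
Implicit Types (G H : M -> M -> R) (f g h : M -> R).

Definition jointly_measurable G := measurable_fun setT (fun p : M * M => G p.1 p.2).

Hypothesis mc : jointly_measurable c.
Hypothesis mmu : forall G, jointly_measurable G -> (forall x y, 0 <= G x y)%R ->
  measurable_fun setT (fun x => \int[mu x]_y (G x y)%:E).

(** One form covers both sides: the limit has [mu] a kernel cut out of [j] and density 1, level k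
    has [mu] constantly equal to m and the extended conductances as density. The measurability [mmu]
    comes from the finiteness of the kernel in the first case and from Tonelli's theorem in the
    second. *)
Definition jump_partial G x : \bar R :=
  \int[mu x]_(y in far B delta x) (G x y * c x y)%:E.

Definition jump_total G : \bar R := \int[m]_(x in B) jump_partial G x.

Definition form_energy f : \bar R := (2^-1)%:E * jump_total (fun x y => (f x - f y) ^+ 2)%R.

Definition form_generator f x : R :=
  (\int[mu x]_(y in far B delta x) ((f y - f x) * c x y))%R.

Lemma jointly_measurable_fst f : measurable_fun setT f ->
  jointly_measurable (fun x _ => f x).
Proof. by move=> mf; exact: (measurableT_comp mf). Qed.

Lemma jointly_measurable_snd f : measurable_fun setT f ->
  jointly_measurable (fun _ y => f y).
Proof. by move=> mf; exact: (measurableT_comp mf). Qed.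

Lemma jointly_measurableM G H : jointly_measurable G -> jointly_measurable H ->
  jointly_measurable (fun x y => G x y * H x y)%R.
Proof. by move=> mG mH; exact: measurable_funM. Qed.

Lemma jointly_measurableD G H : jointly_measurable G -> jointly_measurable H ->
  jointly_measurable (fun x y => G x y + H x y)%R.
Proof. by move=> mG mH; exact: measurable_funD. Qed.

Lemma jointly_measurable_cst (a : R) : jointly_measurable (fun _ _ => a).
Proof. exact: measurable_cst. Qed.

Lemma jointly_measurable_sqrB f : measurable_fun setT f ->
  jointly_measurable (fun x y => (f x - f y) ^+ 2)%R.
Proof.
move=> mf; apply: (measurable_funX (f := fun p : M * M => f p.1 - f p.2)%R).
by apply: measurable_funB; exact: (measurableT_comp mf).
Qed.

Lemma measurable_far x : measurable (far B delta x).
Proof.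
apply: measurableI => //; apply: borel_open_measurable.
under eq_set do rewrite metric_sym.
exact: lipschitz_open (lipschitz_mdist x).
Qed.

Lemma measurable_section G x : jointly_measurable G -> measurable_fun setT (G x).
Proof.
move=> mG; rewrite (_ : G x = (fun p : M * M => G p.1 p.2) \o pair x)//.
by apply: (measurableT_comp mG); exact: pair1_measurable.
Qed.

Lemma jump_partial_ge0 G x : (forall x y, 0 <= G x y)%R -> 0 <= jump_partial G x.
Proof. by move=> G0; apply: integral_ge0 => y _; rewrite lee_fin mulr_ge0. Qed.

Lemma jump_total_ge0 G : (forall x y, 0 <= G x y)%R -> 0 <= jump_total G.
Proof. by move=> G0; apply: integral_ge0 => x _; exact: jump_partial_ge0. Qed.

(** The domain [far B delta x] moves with x; it is turned into a jointly measurable indicator so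
    that [mmu] applies. *)
Lemma measurable_jump_partial G : jointly_measurable G -> (forall x y, 0 <= G x y)%R ->
  measurable_fun setT (jump_partial G).
Proof.
move=> mG G0.
have mF : measurable [set p : M * M | far B delta p.1 p.2].
  have -> : [set p : M * M | far B delta p.1 p.2] =
      (setT `*` B) `&` [set p : M * M | (delta < mdist p.1 p.2)%R].
    by apply/seteqP; split=> [p [? ?]|p [[_ ?] ?]].
  by apply: measurableI; [exact: measurableX|exact: measurable_mdist_gt].
pose I x y : R := \1_[set p : M * M | far B delta p.1 p.2] (x, y).
have mI : jointly_measurable I.
  rewrite /jointly_measurable /I; under eq_fun do rewrite -surjective_pairing.
  exact: measurable_indic.
have -> : jump_partial G = fun x => \int[mu x]_y (G x y * c x y * I x y)%:E.
  apply/funext => x; rewrite /jump_partial integral_mkcond.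
  apply: eq_integral => y _; rewrite patchE /I indicE.
  have -> : ((x, y) \in [set p : M * M | far B delta p.1 p.2]) = (y \in far B delta x).
    by apply/idP/idP => /set_mem h; exact: mem_set.
  by case: ifP; rewrite /= ?mulr1 ?mulr0.
apply: mmu; first by do !apply: jointly_measurableM.
by move=> x y; rewrite !mulr_ge0// /I indicE.
Qed.

Lemma measurable_section_weight G x : jointly_measurable G ->
  measurable_fun (far B delta x) (fun y => (G x y * c x y)%:E).
Proof.
move=> mG; apply/measurable_funTS/measurable_EFinP/measurable_funM;
  exact: measurable_section.
Qed.

Lemma jump_partialD G H x : jointly_measurable G -> jointly_measurable H ->
  (forall x y, 0 <= G x y)%R -> (forall x y, 0 <= H x y)%R ->
  jump_partial (fun x y => G x y + H x y)%R x = jump_partial G x + jump_partial H x.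
Proof.
move=> mG mH G0 H0; rewrite /jump_partial -ge0_integralD//.
- by apply: eq_integral => y _; rewrite mulrDl.
- exact: measurable_far.
- by move=> y _; rewrite lee_fin mulr_ge0.
- exact: measurable_section_weight.
- by move=> y _; rewrite lee_fin mulr_ge0.
- exact: measurable_section_weight.
Qed.

Lemma jump_partialZ f G x : jointly_measurable G -> (forall x y, 0 <= G x y)%R ->
  (forall x, 0 <= f x)%R ->
  jump_partial (fun x y => f x * G x y)%R x = (f x)%:E * jump_partial G x.
Proof.
move=> mG G0 f0; rewrite /jump_partial -ge0_integralZl_EFin//.
- by apply: eq_integral => y _; rewrite -EFinM mulrA.
- exact: measurable_far.
- by move=> y _; rewrite lee_fin mulr_ge0.
- exact: measurable_section_weight.
Qed.

Lemma jump_totalD G H : jointly_measurable G -> jointly_measurable H ->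
  (forall x y, 0 <= G x y)%R -> (forall x y, 0 <= H x y)%R ->
  jump_total (fun x y => G x y + H x y)%R = jump_total G + jump_total H.
Proof.
move=> mG mH G0 H0; rewrite /jump_total -ge0_integralD//.
- by apply: eq_integral => x _; exact: jump_partialD.
- by move=> x _; exact: jump_partial_ge0.
- by apply: measurable_funTS; exact: measurable_jump_partial.
- by move=> x _; exact: jump_partial_ge0.
- by apply: measurable_funTS; exact: measurable_jump_partial.
Qed.

Lemma jump_totalZ (a : R) G : jointly_measurable G -> (forall x y, 0 <= G x y)%R ->
  (0 <= a)%R -> jump_total (fun x y => a * G x y)%R = a%:E * jump_total G.
Proof.
move=> mG G0 a0; rewrite /jump_total -ge0_integralZl_EFin//.
- by apply: eq_integral => x _; rewrite (@jump_partialZ (cst a)).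
- by move=> x _; exact: jump_partial_ge0.
- by apply: measurable_funTS; exact: measurable_jump_partial.
Qed.

Lemma jump_total_le G H : (forall x y, 0 <= G x y)%R -> (forall x y, G x y <= H x y)%R ->
  jump_total G <= jump_total H.
Proof.
move=> G0 GH; apply: ge0_le_integralW => x _; first exact: jump_partial_ge0.
apply: ge0_le_integralW => y _; first by rewrite lee_fin mulr_ge0.
by rewrite lee_fin ler_wpM2r.
Qed.

Lemma form_energy_ge0 f : 0 <= form_energy f.
Proof.
by apply: mule_ge0; rewrite ?lee_fin// jump_total_ge0// => x y; rewrite sqr_ge0.
Qed.

Lemma form_energyZ (a : R) f : measurable_fun setT f ->
  form_energy (fun x => a * f x)%R = (a ^+ 2)%:E * form_energy f.
Proof.
move=> mf; rewrite /form_energy muleCA; congr (_ * _).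
rewrite -jump_totalZ; last 3 first.
- exact: jointly_measurable_sqrB.
- by move=> x y; exact: sqr_ge0.
- exact: sqr_ge0.
by congr jump_total; apply/funext => x; apply/funext => y; rewrite -mulrBr exprMn.
Qed.

(** Young's inequality for the increments of f and g at each pair of points. A small t keeps the
    energy of f almost unchanged. *)
Lemma form_energyD_le (t : R) f g : (0 < t)%R ->
  measurable_fun setT f -> measurable_fun setT g ->
  form_energy (fun x => f x + g x)%R <=
  (1 + t)%:E * form_energy f + (1 + t^-1)%:E * form_energy g.
Proof.
move=> t0 mf mg; rewrite /form_energy !(muleCA _ (2^-1)%:E).
have t1 : (0 <= 1 + t)%R by rewrite addr_ge0// ltW.
have t2 : (0 <= 1 + t^-1)%R by rewrite addr_ge0// invr_ge0 ltW.
have sq0 (h : M -> R) x y : (0 <= (h x - h y) ^+ 2)%R by exact: sqr_ge0.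
have mZ a (h : M -> R) : measurable_fun setT h -> jointly_measurable (fun x y => a * (h x - h y) ^+ 2)%R.
  move=> mh; apply: jointly_measurableM; first exact: jointly_measurable_cst.
  exact: jointly_measurable_sqrB.
have aZ a (h : M -> R) : (0 <= a)%R -> measurable_fun setT h ->
    a%:E * jump_total (fun x y => (h x - h y) ^+ 2)%R =
    jump_total (fun x y => a * (h x - h y) ^+ 2)%R.
  by move=> a0 mh; rewrite -jump_totalZ//; exact: jointly_measurable_sqrB.
have a0 a (h : M -> R) x y : (0 <= a)%R -> (0 <= a * (h x - h y) ^+ 2)%R.
  by move=> a0; rewrite mulr_ge0.
rewrite (aZ _ _ t1 mf) (aZ _ _ t2 mg).
have J0 a (h : M -> R) : (0 <= a)%R -> 0 <= jump_total (fun x y => a * (h x - h y) ^+ 2)%R.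
  by move=> a0'; apply: jump_total_ge0 => x y; exact: a0.
rewrite -ge0_muleDr; last 2 first.
- exact: J0.
- exact: J0.
rewrite -jump_totalD; last 4 first.
- exact: mZ.
- exact: mZ.
- by move=> x y; exact: a0.
- by move=> x y; exact: a0.
apply: lee_wpmul2l; first by rewrite lee_fin invr_ge0.
apply: jump_total_le => x y; first exact: sqr_ge0.
have : (0 <= t * (f x - f y - t^-1 * (g x - g y)) ^+ 2)%R.
  by rewrite mulr_ge0 ?sqr_ge0// ltW.
have -> : (t * (f x - f y - t^-1 * (g x - g y)) ^+ 2 =
  t * (f x - f y) ^+ 2 - 2 * (f x - f y) * (g x - g y) + t^-1 * (g x - g y) ^+ 2)%R.
  by field; rewrite gt_eqF.
nra.
Qed.

(** The increments are split into positive and negative parts, since [mmu] concerns nonnegative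
    functions. *)
Lemma measurable_form_generator f : measurable_fun setT f ->
  measurable_fun setT (form_generator f).
Proof.
move=> mf.
pose pos x y := Num.max (f y - f x)%R 0%R; pose neg x y := Num.max (f x - f y)%R 0%R.
have mB' : jointly_measurable (fun x y => f y - f x)%R.
  by apply: measurable_funB; exact: (measurableT_comp mf).
have mB'' : jointly_measurable (fun x y => f x - f y)%R.
  by apply: measurable_funB; exact: (measurableT_comp mf).
have -> : form_generator f = fine \o (fun x => jump_partial pos x - jump_partial neg x).
  apply/funext => x; rewrite /form_generator /Rintegral /= integralE.
  congr (fine (_ - _)); apply: eq_integral => y _.
    rewrite funeposE -[0]/(0%:E) -EFin_max; congr EFin.
    by rewrite /pos maxr_pMl// mul0r.
  rewrite funenegE -[0]/(0%:E) -EFinN -EFin_max; congr EFin.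
  by rewrite /neg maxr_pMl// mul0r -mulNr opprB.
apply: measurableT_comp => //.
apply: emeasurable_funB; apply: measurable_jump_partial.
- exact: measurable_maxr.
- by move=> x y; rewrite /pos le_max lexx orbT.
- exact: measurable_maxr.
- by move=> x y; rewrite /neg le_max lexx orbT.
Qed.

Hypothesis jump_sym : forall f g, measurable_fun setT f -> measurable_fun setT g ->
  (forall x, 0 <= f x)%R -> (forall x, 0 <= g x)%R ->
  jump_total (fun x y => f x * g y)%R = jump_total (fun x y => g x * f y)%R.

Hypothesis jump_fin : jump_total (fun _ _ => 1%R) < +oo.

Lemma jump_total_bounded G (b : R) : (forall x y, 0 <= G x y <= b)%R ->
  jump_total G < +oo.
Proof.
move=> Gb; apply: (@le_lt_trans _ _ (jump_total (fun _ _ => `|b| * 1)%R)).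
  apply: jump_total_le => x y; have /andP[G0 Gb'] := Gb x y => //.
  by rewrite mulr1 (le_trans Gb')// ler_norm.
rewrite jump_totalZ//; last exact: jointly_measurable_cst.
by rewrite lte_mul_pinfty// lee_fin.
Qed.

Lemma form_energy_bounded f (b : R) : (forall x, `|f x| <= b)%R -> form_energy f < +oo.
Proof.
move=> fb; apply: lte_mul_pinfty; [by rewrite lee_fin|by []|].
apply: (@jump_total_bounded _ ((b + b) ^+ 2)%R) => x y; rewrite sqr_ge0 /=.
rewrite -real_normK ?num_real// lerXn2r ?nnegrE ?addr_ge0//.
- exact: le_trans (fb x).
- exact: le_trans (fb x).
- by rewrite (le_trans (ler_normB _ _))// lerD.
Qed.

Lemma form_energy_fin f (b : R) : (forall x, `|f x| <= b)%R -> form_energy f \is a fin_num.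
Proof. by move=> fb; rewrite ge0_fin_numE ?form_energy_ge0// (form_energy_bounded fb). Qed.

(** A finite total mass makes the rates finite almost everywhere only; generators are computed off
    this null set. *)
Let infinite_rate := B `&` [set x | jump_partial (fun _ _ => 1%R) x = +oo].

Lemma measurable_infinite_rate : measurable infinite_rate.
Proof.
have mP : measurable_fun setT (jump_partial (fun _ _ => 1%R)).
  by apply: measurable_jump_partial => //; exact: jointly_measurable_cst.
apply: measurableI => //; rewrite -[X in measurable X]setTI.
exact: mP measurableT _ (emeasurable_set1 +oo).
Qed.

Lemma infinite_rate_null : m infinite_rate = 0.
Proof.
have mP : measurable_fun setT (jump_partial (fun _ _ => 1%R)).
  by apply: measurable_jump_partial => //; exact: jointly_measurable_cst.
apply: measure_negligible; first exact: measurable_infinite_rate.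
have : m.-integrable B (jump_partial (fun _ _ => 1%R)).
  apply/integrableP; split; first exact: measurable_funTS.
  rewrite (eq_integral (jump_partial (fun _ _ => 1%R)))// => x _.
  by rewrite gee0_abs// jump_partial_ge0.
move=> /(integrable_ae mB); apply: negligibleS => x [Bx /= xy] h.
by have := h Bx; rewrite xy.
Qed.

Lemma finite_rate_integrable x : jump_partial (fun _ _ => 1%R) x < +oo ->
  (mu x).-integrable (far B delta x) (fun y => (c x y)%:E).
Proof.
move=> xy; apply/integrableP; split.
  apply/measurable_funTS/measurable_EFinP; exact: measurable_section.
apply: le_lt_trans xy; rewrite le_eqVlt; apply/orP; left; apply/eqP.
by apply: eq_integral => y _; rewrite mul1r gee0_abs ?lee_fin.
Qed.

Lemma finite_rate_integrableM x f (b : R) : jump_partial (fun _ _ => 1%R) x < +oo ->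
  measurable_fun setT f -> (forall y, `|f y| <= b)%R ->
  (mu x).-integrable (far B delta x) (fun y => (f y * c x y)%:E).
Proof.
move=> xy mf fb; have Ic := finite_rate_integrable xy.
have mcx : measurable_fun setT (c x) by exact: measurable_section.
have mF := measurable_far x.
apply: (@le_integrable _ _ _ _ _ mF _ (fun y => b%:E * (c x y)%:E)).
- by apply/measurable_funTS/measurable_EFinP/measurable_funM.
- move=> y _; rewrite -EFinM !abse_EFin lee_fin !normrM ler_wpM2r//.
  by apply: le_trans (fb y) _; exact: ler_norm.
- exact: integrableZl.
Qed.

Lemma form_generatorE f (b : R) x : jump_partial (fun _ _ => 1%R) x < +oo ->
  measurable_fun setT f -> (forall y, `|f y| <= b)%R ->
  form_generator f x = (\int[mu x]_(y in far B delta x) (f y * c x y) -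
    f x * fine (jump_partial (fun _ _ => 1%R) x))%R.
Proof.
move=> xy mf fb; have Ic := finite_rate_integrable xy.
have If := finite_rate_integrableM xy mf fb.
have mF := measurable_far x.
have -> : fine (jump_partial (fun _ _ => 1%R) x) =
    (\int[mu x]_(y in far B delta x) (c x y))%R.
  by congr fine; apply: eq_integral => y _; rewrite mul1r.
rewrite -RintegralZl// -RintegralB//; last first.
  by rewrite /comp; under eq_fun do rewrite EFinM; exact: integrableZl.
by apply: eq_Rintegral => y _; rewrite mulrBl.
Qed.

(** For nonnegative bounded functions the parts g(x) f(y) and g(x) f(x) of the integrand have finite
    totals separately, so the pairing splits at every point with finite rate. *)
Lemma form_pairing_ge0 f g (b : R) :
  measurable_fun setT f -> (forall x, 0 <= f x <= b)%R ->
  measurable_fun setT g -> (forall x, 0 <= g x <= b)%R ->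
  m.-integrable B (fun x => (g x * form_generator f x)%:E) /\
  (\int[m]_(x in B) (g x * form_generator f x))%R =
    (fine (jump_total (fun x y => g x * f y)%R) -
     fine (jump_total (fun x y => g x * f x)%R))%R.
Proof.
move=> mf fb mg gb.
have f0 x : (0 <= f x)%R by have /andP[] := fb x.
have g0 x : (0 <= g x)%R by have /andP[] := gb x.
have b0 : (0 <= b)%R by have /andP[f1 f2] := fb point; exact: le_trans f2.
have fn x : (`|f x| <= b)%R by rewrite ger0_norm//; have /andP[] := fb x.
pose A1 x := jump_partial (fun x y => g x * f y)%R x.
pose A2 x := jump_partial (fun x y => g x * f x)%R x.
have jm1 : jointly_measurable (fun x y => g x * f y)%R.
  by apply: measurable_funM; exact: (measurableT_comp _).
have jm2 : jointly_measurable (fun x y => g x * f x)%R.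
  by apply: measurable_funM; exact: (measurableT_comp _).
have p1 x y : (0 <= g x * f y <= b * b)%R.
  by have /andP[? ?] := fb y; have /andP[? ?] := gb x; rewrite mulr_ge0//= ler_pM.
have p2 (x y : M) : (0 <= g x * f x <= b * b)%R by exact: p1.
have A10 x : 0 <= A1 x by apply: jump_partial_ge0 => ? ?; rewrite mulr_ge0.
have A20 x : 0 <= A2 x by apply: jump_partial_ge0 => ? ?; rewrite mulr_ge0.
have mA1 : measurable_fun B A1.
  by apply/measurable_funTS/measurable_jump_partial => // ? ?; rewrite mulr_ge0.
have mA2 : measurable_fun B A2.
  by apply/measurable_funTS/measurable_jump_partial => // ? ?; rewrite mulr_ge0.
have iA (A : M -> \bar R) : measurable_fun B A -> (forall x, 0 <= A x) ->
    \int[m]_(x in B) A x < +oo -> m.-integrable B A.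
  move=> mA A0 Ay; apply/integrableP; split => //.
  by rewrite (eq_integral A)// => x _; rewrite gee0_abs.
have J1y : \int[m]_(x in B) A1 x < +oo by exact: (jump_total_bounded p1).
have J2y : \int[m]_(x in B) A2 x < +oo by exact: (jump_total_bounded p2).
have I1 := iA _ mA1 A10 J1y; have I2 := iA _ mA2 A20 J2y.
have eqA x : B x -> ~ infinite_rate x ->
    [/\ A1 x \is a fin_num, A2 x \is a fin_num &
      (g x * form_generator f x)%:E = A1 x - A2 x].
  move=> Bx xN.
  have xy : jump_partial (fun _ _ => 1%R) x < +oo.
    by rewrite ltey; apply/eqP => h; apply: xN.
  have xfin : jump_partial (fun _ _ => 1%R) x \is a fin_num.
    by rewrite ge0_fin_numE// jump_partial_ge0.
  have If := finite_rate_integrableM xy mf fn.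
  have mF := measurable_far x.
  have E1 : A1 x = (g x * \int[mu x]_(y in far B delta x) (f y * c x y))%:E.
    rewrite /A1 (@jump_partialZ g (fun _ y => f y))//; last exact: jointly_measurable_snd.
    by rewrite EFinM fineK//; exact: integrable_fin_num.
  have E2 : A2 x = (g x * f x * fine (jump_partial (fun _ _ => 1%R) x))%:E.
    rewrite /A2; have -> : (fun x y => g x * f x)%R = (fun x y => (g x * f x) * 1)%R :> (M -> M -> R).
      by apply/funext => ?; apply/funext => ?; rewrite mulr1.
    rewrite (@jump_partialZ (fun x => g x * f x)%R (fun _ _ => 1%R))//.
    - by rewrite [RHS]EFinM fineK.
    - exact: jointly_measurable_cst.
    - by move=> y; rewrite mulr_ge0.
  split; rewrite ?E1 ?E2//.
  by rewrite -EFinB (form_generatorE xy mf fn) mulrBr mulrA.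
have mgf : measurable_fun B (fun x => (g x * form_generator f x)%:E).
  apply/measurable_funTS/measurable_EFinP/measurable_funM => //.
  exact: measurable_form_generator.
split.
  apply/integrableP; split => //.
  apply: (@le_lt_trans _ _ (\int[m]_(x in B) (A1 x + A2 x))); last first.
    rewrite (ge0_integralD m mB (fun x _ => A10 x) mA1 (fun x _ => A20 x) mA2).
    exact (lte_add_pinfty J1y J2y).
  apply: (ge0_le_integral_negligible measurable_infinite_rate infinite_rate_null) => //.
  - by move=> x _; rewrite adde_ge0.
  - move=> x Bx /(eqA _ Bx)[F1 F2 ->].
    by rewrite (le_trans (lee_abs_sub _ _))// !gee0_abs.
rewrite /Rintegral (eq_integral_negligible measurable_infinite_rate infinite_rate_null
  (g := fun x => A1 x - A2 x)); last by move=> x Bx /(eqA _ Bx)[].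
rewrite (integralB mB I1 I2) fineB.
- by [].
- by rewrite ge0_fin_numE; [exact: J1y|exact: integral_ge0].
- by rewrite ge0_fin_numE; [exact: J2y|exact: integral_ge0].
Qed.

#[local] Opaque jump_total.

Lemma form_generatorD_cst f (a : R) x :
  form_generator (fun x => f x + a)%R x = form_generator f x.
Proof. by apply: eq_Rintegral => y _; congr (_ * _)%R; ring. Qed.

Lemma form_energyD_cst f (a : R) : form_energy (fun x => f x + a)%R = form_energy f.
Proof.
rewrite /form_energy; congr (_ * jump_total _).
by apply/funext => x; apply/funext => y; congr (_ ^+ 2)%R; ring.
Qed.

(** The expansion of the two squares is rearranged so that only nonnegative terms are added, where
    totals in the extended reals are additive. Symmetry identifies g(x) f(y) with f(x) g(y) and,
    taking 1 as one of the factors, g(y) f(y) with g(x) f(x). *)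
Lemma form_polarization f g (b : R) : measurable_fun setT f -> measurable_fun setT g ->
  (forall x, 0 <= f x <= b)%R -> (forall x, 0 <= g x <= b)%R ->
  (fine (jump_total (fun x y => g x * f y)) - fine (jump_total (fun x y => g x * f x)) =
   4^-1 * (fine (form_energy (fun x => f x - g x)) -
           fine (form_energy (fun x => f x + g x))))%R.
Proof.
move=> mf mg fb gb.
have f0 x : (0 <= f x)%R by have /andP[] := fb x.
have g0 x : (0 <= g x)%R by have /andP[] := gb x.
have jf := jointly_measurable_fst mf; have jg := jointly_measurable_fst mg.
have jf' := jointly_measurable_snd mf; have jg' := jointly_measurable_snd mg.
have mfg : measurable_fun setT (fun x => g x * f x)%R by exact: measurable_funM.
pose G1 x y := (((f x + g x) - (f y + g y)) ^+ 2)%R.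
pose G2 x y := (g x * f y)%R; pose G3 x y := (f x * g y)%R.
pose H1 x y := (((f x - g x) - (f y - g y)) ^+ 2)%R.
pose H2 (x y : M) := (g x * f x)%R; pose H3 (x y : M) := (1 * (g y * f y))%R.
have mG1 : jointly_measurable G1 by apply: jointly_measurable_sqrB; exact: measurable_funD.
have mH1 : jointly_measurable H1 by apply: jointly_measurable_sqrB; exact: measurable_funB.
have mG2 : jointly_measurable G2 by exact: jointly_measurableM.
have mG3 : jointly_measurable G3 by exact: jointly_measurableM.
have mH2 : jointly_measurable H2 by exact: jointly_measurableM.
have mH3 : jointly_measurable H3.
  by apply: jointly_measurableM; [exact: jointly_measurable_cst|exact: jointly_measurableM].
have bb x y : (0 <= g x * f y <= b * b)%R.
  by have /andP[? ?] := fb y; have /andP[? ?] := gb x; rewrite mulr_ge0//= ler_pM.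
have G1b x y : (0 <= G1 x y <= (b + b + (b + b)) ^+ 2)%R.
  rewrite sqr_ge0 /= /G1; have := fb x; have := fb y; have := gb x; have := gb y.
  move=> /andP[? ?] /andP[? ?] /andP[? ?] /andP[? ?].
  rewrite -real_normK ?num_real// lerXn2r ?nnegrE; last 3 first.
  - exact: normr_ge0.
  - lra.
  - rewrite ler_norml; lra.
  by [].
have H1b x y : (0 <= H1 x y <= (b + b + (b + b)) ^+ 2)%R.
  rewrite sqr_ge0 /= /H1; have := fb x; have := fb y; have := gb x; have := gb y.
  move=> /andP[? ?] /andP[? ?] /andP[? ?] /andP[? ?].
  rewrite -real_normK ?num_real// lerXn2r ?nnegrE; last 3 first.
  - exact: normr_ge0.
  - lra.
  - rewrite ler_norml; lra.
  by [].
have G2b x y : (0 <= G2 x y <= b * b)%R by exact: bb.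
have G3b x y : (0 <= G3 x y <= b * b)%R by rewrite /G3 mulrC; exact: bb.
have H2b x y : (0 <= H2 x y <= b * b)%R by exact: bb.
have H3b x y : (0 <= H3 x y <= b * b)%R by rewrite /H3 mul1r; exact: bb.
have ge0 (G : M -> M -> R) a : (forall x y, 0 <= G x y <= a)%R -> forall x y, (0 <= G x y)%R.
  by move=> h x y; have /andP[] := h x y.
have fin (G : M -> M -> R) a : (forall x y, 0 <= G x y <= a)%R -> jump_total G \is a fin_num.
  move=> h; rewrite ge0_fin_numE; first exact: jump_total_bounded h.
  by apply: jump_total_ge0; exact: ge0 h.
have s1 : jump_total G3 = jump_total G2 by exact: jump_sym.
have s2 : jump_total H3 = jump_total H2.
  rewrite /H3 (@jump_sym (cst 1%R) (fun x => g x * f x)%R).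
  - by congr jump_total; apply/funext => x; apply/funext => y; rewrite mulr1.
  - exact: measurable_cst.
  - exact: mfg.
  - by move=> x; exact: ler01.
  - by move=> x; rewrite mulr_ge0.
have four (G : M -> M -> R) a : jointly_measurable G -> (forall x y, 0 <= G x y <= a)%R ->
    jump_total (fun x y => 4 * G x y)%R = 4%:E * jump_total G.
  by move=> mG hG; apply: jump_totalZ; [exact: mG|exact: ge0 hG|exact: ler0n].
have m4 (G : M -> M -> R) : jointly_measurable G -> jointly_measurable (fun x y => 4 * G x y)%R.
  by move=> mG; apply: jointly_measurableM; [exact: jointly_measurable_cst|exact: mG].
have ge4 (G : M -> M -> R) a : (forall x y, 0 <= G x y <= a)%R ->
    forall x y, (0 <= 4 * G x y)%R.
  by move=> h x y; apply: mulr_ge0; [exact: ler0n|exact: (ge0 _ _ h)].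
have ge44 (G H : M -> M -> R) a : (forall x y, 0 <= G x y <= a)%R ->
    (forall x y, 0 <= H x y <= a)%R -> forall x y, (0 <= 4 * G x y + 4 * H x y)%R.
  by move=> h h' x y; apply: addr_ge0; [exact: (ge4 _ _ h)|exact: (ge4 _ _ h')].
have ex (G : M -> M -> R) a : (forall x y, 0 <= G x y <= a)%R ->
    exists r : R, jump_total G = r%:E.
  by move=> /fin h; exists (fine (jump_total G)); exact: (esym (fineK h)).
have [a1 E1] := ex _ _ G1b; have [a2 E2] := ex _ _ G2b.
have [a3 E3] := ex _ _ H1b; have [a4 E4] := ex _ _ H2b.
have L : jump_total (fun x y => G1 x y + (4 * G2 x y + 4 * G3 x y))%R =
    (a1 + (4 * a2 + 4 * a2))%:E.
  rewrite (jump_totalD mG1 (jointly_measurableD (m4 _ mG2) (m4 _ mG3)) (ge0 _ _ G1b) (ge44 _ _ _ G2b G3b)).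
  rewrite (jump_totalD (m4 _ mG2) (m4 _ mG3) (ge4 _ _ G2b) (ge4 _ _ G3b)).
  by rewrite (four _ _ mG2 G2b) (four _ _ mG3 G3b) s1 E1 E2.
have L' : jump_total (fun x y => H1 x y + (4 * H2 x y + 4 * H3 x y))%R =
    (a3 + (4 * a4 + 4 * a4))%:E.
  rewrite (jump_totalD mH1 (jointly_measurableD (m4 _ mH2) (m4 _ mH3)) (ge0 _ _ H1b) (ge44 _ _ _ H2b H3b)).
  rewrite (jump_totalD (m4 _ mH2) (m4 _ mH3) (ge4 _ _ H2b) (ge4 _ _ H3b)).
  by rewrite (four _ _ mH2 H2b) (four _ _ mH3 H3b) s2 E3 E4.
have E : (fun x y => G1 x y + (4 * G2 x y + 4 * G3 x y))%R =
    (fun x y => H1 x y + (4 * H2 x y + 4 * H3 x y))%R.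
  by apply/funext => x; apply/funext => y; rewrite /G1 /G2 /G3 /H1 /H2 /H3; ring.
have [h] : (a1 + (4 * a2 + 4 * a2))%:E = (a3 + (4 * a4 + 4 * a4))%:E :> \bar R.
  exact: (etrans (esym L) (etrans (congr1 jump_total E) L')).
have e1 : form_energy (fun x => f x + g x)%R = (2^-1 * a1)%:E.
  by rewrite EFinM -E1.
have e2 : jump_total (fun x y => g x * f y)%R = a2%:E by exact: E2.
have e3 : form_energy (fun x => f x - g x)%R = (2^-1 * a3)%:E.
  by rewrite EFinM -E3.
have e4 : jump_total (fun x y => g x * f x)%R = a4%:E by exact: E4.
rewrite e1 e2 e3 e4 /=; lra.
Qed.

#[local] Opaque form_energy form_generator.

(** Adding b makes both functions nonnegative and changes neither generators nor energies. It adds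
    to the pairing a multiple of the integral of the generator, that is a pairing with a constant,
    which vanishes by polarization. *)
Lemma form_pairing f g (b : R) :
  measurable_fun setT f -> (forall x, `|f x| <= b)%R ->
  measurable_fun setT g -> (forall x, `|g x| <= b)%R ->
  m.-integrable B (fun x => (g x * form_generator f x)%:E) /\
  (\int[m]_(x in B) (g x * form_generator f x))%R =
    (4^-1 * (fine (form_energy (fun x => f x - g x)) -
             fine (form_energy (fun x => f x + g x))))%R.
Proof.
move=> mf fb mg gb.
have b0 : (0 <= b)%R by exact: le_trans (fb point).
pose f' x := (f x + b)%R; pose g' x := (g x + b)%R.
have sh (h : M -> R) : (forall x, `|h x| <= b)%R -> forall x, (0 <= h x + b <= b + b)%R.
  by move=> hb x; have := hb x; rewrite ler_norml => /andP[? ?]; lra.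
have f'b := sh _ fb; have g'b := sh _ gb.
have cb (x : M) : (0 <= cst b x <= b + b)%R by rewrite b0 /= lerDl.
have mf' : measurable_fun setT f' by exact: measurable_funD.
have mg' : measurable_fun setT g' by exact: measurable_funD.
have mb : measurable_fun setT (cst b : M -> R) by exact: measurable_cst.
have [I1 E1] := form_pairing_ge0 mf' f'b mg' g'b.
have [I2 E2] := form_pairing_ge0 mf' f'b mb cb.
have P1 := form_polarization mf' mg' f'b g'b.
have P2 := form_polarization mf' mb f'b cb.
have gE x : (g x * form_generator f x = g' x * form_generator f' x - b * form_generator f' x)%R.
  by rewrite form_generatorD_cst -mulrBl /g' addrK.
have I : m.-integrable B (fun x => (g x * form_generator f x)%:E).
  by under eq_fun do rewrite gE EFinB; exact: integrableB.
split; first exact: I.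
under eq_Rintegral do rewrite gE.
rewrite (RintegralB mB I1 I2) E1 -[X in (_ - X)%R]/(\int[m]_(x in B) (cst b x * form_generator f' x))%R E2.
have s1 : form_energy (fun x => f' x + g' x)%R = form_energy (fun x => f x + g x)%R.
  rewrite -(form_energyD_cst (fun x => f x + g x)%R (b + b)%R); congr form_energy.
  by apply/funext => x; rewrite /f' /g'; ring.
have s2 : form_energy (fun x => f' x - g' x)%R = form_energy (fun x => f x - g x)%R.
  by congr form_energy; apply/funext => x; rewrite /f' /g'; ring.
have s3 : form_energy (fun x => f' x + cst b x)%R = form_energy f'.
  exact: form_energyD_cst.
have s4 : form_energy (fun x => f' x - cst b x)%R = form_energy f'.
  exact: (form_energyD_cst f' (- b)%R).
have P1' := etrans P1 (f_equal2 (fun u v => 4^-1 * (fine u - fine v))%R s2 s1).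
have P2' := etrans P2 (f_equal2 (fun u v => 4^-1 * (fine u - fine v))%R s4 s3).
have cancel (u v : R) : (u - 4^-1 * (v - v) = u)%R by rewrite subrr mulr0 subr0.
exact (etrans (f_equal2 (fun u v : R => (u - v)%R) P1' P2') (cancel _ _)).
Qed.

(** By polarization the first term is half the energy of f + g minus half that of f - g. The latter
    is dropped, and the energy of f + g is at most twice the sum of the energies. *)
Lemma form_energy_lower_bound f g (b : R) :
  measurable_fun setT f -> (forall x, `|f x| <= b)%R ->
  measurable_fun setT g -> (forall x, `|g x| <= b)%R ->
  (- 2 * (\int[m]_(x in B) (g x * form_generator f x)) - fine (form_energy f) <=
   fine (form_energy g))%R.
Proof.
move=> mf fb mg gb; have [_ ->] := form_pairing mf fb mg gb.
have b0 : (0 <= b)%R by exact: le_trans (fb point).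
have ex (h : M -> R) a : (forall x, `|h x| <= a)%R -> exists r : R, form_energy h = r%:E.
  by move=> /form_energy_fin hf; exists (fine (form_energy h)); rewrite fineK.
have [a1 E1] : exists r : R, form_energy (fun x => f x + g x)%R = r%:E.
  by apply: (ex _ (b + b)%R) => x; rewrite (le_trans (ler_normD _ _))// lerD.
have [a2 E2] : exists r : R, form_energy (fun x => f x - g x)%R = r%:E.
  by apply: (ex _ (b + b)%R) => x; rewrite (le_trans (ler_normB _ _))// lerD.
have [a3 E3] := ex _ _ fb; have [a4 E4] := ex _ _ gb.
have := form_energyD_le ltr01 mf mg.
have : 0 <= form_energy (fun x => f x - g x)%R by exact: form_energy_ge0.
rewrite E1 E2 E3 E4 -!EFinM -EFinD !lee_fin invr1 /=.
lra.
Qed.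

Lemma clip_contraction (a x y : R) :
  (`|Num.max (- a) (Num.min a x) - Num.max (- a) (Num.min a y)| <= `|x - y|)%R.
Proof.
rewrite ler_norml; have := ler_norm (x - y)%R; have := ler_norm (y - x)%R.
rewrite (distrC y); move: (`|x - y|)%R => e yx xy.
have : (- e <= Num.min a x - Num.min a y <= e)%R.
  by case: (leP a x); case: (leP a y); lra.
move: (Num.min a x) (Num.min a y) => p q.
by case: (leP (- a)%R p); case: (leP (- a)%R q); lra.
Qed.

(** Clipping h at levels n does not increase its energy, and the clipped functions converge in L2 on
    B, so their pairings with the square-integrable generator converge. The bounded case then passes
    to the limit. *)
Lemma form_energy_lower_bound_L2 f h (b : R) :
  measurable_fun setT f -> (forall x, `|f x| <= b)%R -> L2on m B (form_generator f) ->
  measurable_fun setT h -> L2on m B h ->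
  (- 2 * (\int[m]_(x in B) (h x * form_generator f x)) - fine (form_energy f))%:E <=
  form_energy h.
Proof.
move=> mf fb Lg mh Lh.
have [Ey|] := eqVneq (form_energy h) +oo; first by rewrite Ey leey.
rewrite -ltey => Efin; have Enum : form_energy h \is a fin_num.
  by rewrite ge0_fin_numE// form_energy_ge0.
rewrite -(fineK Enum) lee_fin.
pose T (n : nat) x : R := Num.max (- n%:R)%R (Num.min n%:R (h x)).
have mT n : measurable_fun setT (T n).
  by apply: measurable_maxr => //; apply: measurable_minr.
have Tb n x : (`|T n x| <= n%:R)%R.
  rewrite /T ler_norml; have n0 : (0 <= n%:R :> R)%R by [].
  case: (leP n%:R (h x)) => hn; first by case: (leP (- n%:R)%R n%:R); lra.
  by case: (leP (- n%:R)%R (h x)); lra.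
have ET n : (fine (form_energy (T n)) <= fine (form_energy h))%R.
  have : form_energy (T n) <= form_energy h.
    apply: lee_wpmul2l; first by rewrite lee_fin invr_ge0.
    apply: jump_total_le => x y; first exact: sqr_ge0.
    rewrite -(real_normK (num_real (T n x - T n y))) -(real_normK (num_real (h x - h y))).
    by rewrite ler_sqr ?nnegrE//; exact: clip_contraction.
  by apply: fine_le; [exact: form_energy_fin (Tb n)|exact: Enum].
have Th n x : (`|T n x - h x| <= `|h x|)%R && (`|T n x| <= `|h x|)%R.
  rewrite /T !ler_norml; have n0 : (0 <= n%:R :> R)%R by [].
  have := ler_norm (h x); have := ler_norm (- h x)%R; rewrite normrN.
  move: (`|h x|)%R => e; case: (leP n%:R (h x)) => hn.
    by case: (leP (- n%:R)%R n%:R); lra.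
  by case: (leP (- n%:R)%R (h x)); lra.
have cvT x : T n x @[n --> \oo] --> h x.
  apply: cvg_near_cst; exists (Num.truncn `|h x|).+1 => // n /= hn.
  have : (`|h x| <= n%:R)%R.
    by apply: ltW; apply: lt_le_trans (truncnS_gt _) _; rewrite ler_nat.
  rewrite ler_norml /T => /andP[h1 h2]; apply/eqP.
  by rewrite min_r// max_r.
have LT n : L2on m B (T n).
  split; first exact: measurable_funTS.
  case: Lh => _; apply: le_lt_trans; apply: le_sqnorm => x _.
  by have /andP[] := Th n x.
have L0 : sqnorm m B (fun x => T n x - h x)%R @[n --> \oo] --> 0.
  apply: (L2_dominated_cvg (h := fun x => `|h x|)%R) => //.
  - by move=> n; exact: measurable_funTS.
  - exact: measurable_funTS.
  - split; first by apply: measurableT_comp => //; exact: measurable_funTS.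
    case: Lh => _; apply: le_lt_trans; apply: le_sqnorm => x _.
    by rewrite normr_id.
  - by move=> n x _; have /andP[] := Th n x.
pose c0 := fine (sqnorm m B (form_generator f)).
have c0_ge0 : (0 <= c0)%R by exact: sqnorm_fine_ge0.
(* Young's inequality with this weight costs at most e / 2 for the generator and, n being large, e /
   2 for the clipping error. *)
apply/ler_addgt0Pr => e e0; pose s := (e / (2 * (c0 + 1)))%R.
have s0 : (0 < s)%R by rewrite divr_gt0// mulr_gt0// ltr_wpDl.
have se0 : (0 < s * (e / 2))%R by rewrite mulr_gt0// divr_gt0.
have se0' : 0 < (s * (e / 2))%:E by rewrite lte_fin.
have [n _ /(_ _ (leqnn n)) small] := cvge_lt_near L0 se0'.
have LTh : L2on m B (fun x => T n x - h x)%R by apply: L2onB.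
have IT := L2onM mB (LT n) Lg; have ITh := L2onM mB LTh Lg.
have Eh : (\int[m]_(x in B) (h x * form_generator f x) =
    \int[m]_(x in B) (T n x * form_generator f x) -
    \int[m]_(x in B) ((T n x - h x) * form_generator f x))%R.
  by rewrite -RintegralB//; apply: eq_Rintegral => x _; ring.
have := le_Rintegral_mul mB Lg LTh s0; rewrite -/c0.
under eq_Rintegral do rewrite mulrC.
have dle : (s^-1 * fine (sqnorm m B (fun x => T n x - h x)) <= e / 2)%R.
  rewrite mulrC ler_pdivrMr// mulrC -lee_fin fineK; last exact: L2on_fin_num.
  exact: ltW.
have sc : (s * c0 <= e / 2)%R.
  rewrite /s mulrAC ler_pdivrMr ?mulr_gt0 ?ltr_wpDl//.
  have -> : (e / 2 * (2 * (c0 + 1)) = e * (c0 + 1))%R by field.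
  by apply: ler_wpM2l; [exact: ltW|rewrite lerDl].
rewrite ler_norml => /andP[lo hi].
have bn x : (`|f x| <= Num.max b n%:R)%R by rewrite le_max fb.
have Tbn x : (`|T n x| <= Num.max b n%:R)%R by rewrite le_max Tb orbT.
have lb := le_trans (form_energy_lower_bound mf bn (mT n) Tbn) (ET n).
by rewrite Eh; exact: linear_form_perturbation lb lo hi dle sc.
Qed.

#[local] Transparent form_energy form_generator jump_total.

(** * Forms with bounded jump rates *)

Variable rate : R.
Hypothesis rate_ge0 : (0 <= rate)%R.
Hypothesis rate_bound : forall x, B x -> jump_partial (fun _ _ => 1%R) x <= rate%:E.

Lemma jump_total_fst_le f : measurable_fun setT f -> (forall x, 0 <= f x)%R ->
  jump_total (fun x y => f x * 1)%R <= rate%:E * \int[m]_(x in B) (f x)%:E.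
Proof.
move=> mf f0; rewrite -ge0_integralZl_EFin//; last 2 first.
- by move=> x _; rewrite lee_fin.
- exact/measurable_funTS/measurable_EFinP.
apply: ge0_le_integralW => x Bx; first by apply: jump_partial_ge0 => ? ?; rewrite mulr1.
rewrite (@jump_partialZ f (fun _ _ => 1%R)).
- by rewrite muleC lee_wpmul2r ?lee_fin// rate_bound.
- exact: jointly_measurable_cst.
- by move=> ? ?; exact: ler01.
- exact: f0.
Qed.

(** The squared increment is at most 2 h(x)^2 + 2 h(y)^2; symmetry turns the second term into the
    first, and the integral over y is then at most the rate. *)
Lemma form_energy_sqnorm h : measurable_fun setT h ->
  form_energy h <= (2 * rate)%:E * sqnorm m B h.
Proof.
move=> mh.
have half2 : (2^-1 * 2 = 1 :> R)%R by rewrite mulVf// pnatr_eq0.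
have rate0 : 0 <= rate%:E by rewrite lee_fin.
have rate2 : (rate + rate = 2 * rate)%R by ring.
have mh2 : measurable_fun setT (fun x => h x ^+ 2)%R by exact: measurable_funX.
have h2 x : (0 <= h x ^+ 2)%R by exact: sqr_ge0.
have j1 : jointly_measurable (fun x y => h x ^+ 2 * 1)%R.
  by apply: jointly_measurableM; [exact: jointly_measurable_fst|exact: jointly_measurable_cst].
have j2 : jointly_measurable (fun x y => 1 * h y ^+ 2)%R.
  by apply: jointly_measurableM; [exact: jointly_measurable_cst|exact: jointly_measurable_snd].
have j3 : jointly_measurable (fun x y => h x ^+ 2 * 1 + 1 * h y ^+ 2)%R.
  exact: jointly_measurableD.
have g1 (x y : M) : (0 <= h x ^+ 2 * 1)%R by rewrite mulr1.
have g2 (x y : M) : (0 <= 1 * h y ^+ 2)%R by rewrite mul1r.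
have g3 (x y : M) : (0 <= h x ^+ 2 * 1 + 1 * h y ^+ 2)%R by exact: (addr_ge0 (g1 x y) (g2 x y)).
have sy : jump_total (fun x y => 1 * h y ^+ 2)%R = jump_total (fun x y => h x ^+ 2 * 1)%R.
  apply: (@jump_sym (cst 1%R) (fun x => h x ^+ 2)%R).
  - exact: measurable_cst.
  - exact: mh2.
  - by move=> x; exact: ler01.
  - exact: h2.
have le1 : jump_total (fun x y => (h x - h y) ^+ 2)%R <=
    2%:E * (jump_total (fun x y => h x ^+ 2 * 1)%R + jump_total (fun x y => h x ^+ 2 * 1)%R).
  rewrite -[X in _ + X]sy -(jump_totalD j1 j2 g1 g2) -(jump_totalZ j3 g3 (ler0n R 2)).
  apply: jump_total_le => x y; first exact: sqr_ge0.
  by have := sqr_ge0 (h x + h y)%R; nra.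
have le2 := jump_total_fst_le mh2 h2.
apply: (@le_trans _ _ ((2^-1)%:E * (2%:E * (rate%:E * sqnorm m B h + rate%:E * sqnorm m B h)))).
  apply: lee_wpmul2l; first by rewrite lee_fin invr_ge0.
  apply: le_trans le1 _; apply: lee_wpmul2l; first by rewrite lee_fin.
  exact: leeD.
rewrite muleA -EFinM half2 mul1e -(ge0_muleDl _ rate0 rate0) -EFinD rate2.
exact: lexx.
Qed.

Lemma form_generator_bounded f (b : R) x : B x -> measurable_fun setT f ->
  (forall x, `|f x| <= b)%R -> (`|form_generator f x| <= (b + b) * rate)%R.
Proof.
move=> Bx mf fb; have mF := measurable_far x.
have xy : jump_partial (fun _ _ => 1%R) x < +oo by apply: le_lt_trans (rate_bound Bx) (ltry _).
have mfx : measurable_fun setT (fun y => f y - f x)%R by exact: measurable_funB.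
have fxb y : (`|f y - f x| <= b + b)%R by rewrite (le_trans (ler_normB _ _))// lerD.
have I := finite_rate_integrableM xy mfx fxb.
apply: le_trans (le_normr_Rintegral mF I) _.
have Ic := finite_rate_integrable xy.
have IZ : (mu x).-integrable (far B delta x) (EFin \o (fun y => (b + b) * c x y)%R).
  by rewrite /comp; under eq_fun do rewrite EFinM; exact: integrableZl.
apply: le_trans (le_Rintegral mF _ IZ _) _.
- exact: (integrable_norm I).
- by move=> y _; rewrite normrM (ger0_norm (c_ge0 _ _)) ler_wpM2r.
rewrite RintegralZl//; apply: ler_wpM2l.
  by rewrite addr_ge0// (le_trans _ (fb x)).
have -> : (\int[mu x]_(y in far B delta x) (c x y))%R =
    fine (jump_partial (fun _ _ => 1%R) x).
  by congr fine; apply: eq_integral => y _; rewrite mul1r.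
rewrite -lee_fin fineK; first exact: rate_bound.
by rewrite ge0_fin_numE// jump_partial_ge0.
Qed.

Lemma form_generator_L2on f (b : R) : m B < +oo -> measurable_fun setT f ->
  (forall x, `|f x| <= b)%R -> L2on m B (form_generator f).
Proof.
move=> By mf fb; apply: (@L2on_bounded _ _ _ _ _ _ ((b + b) * rate)%R) => //.
  exact/measurable_funTS/measurable_form_generator.
by move=> x Bx; exact: form_generator_bounded.
Qed.

(** Young's inequality is applied to h(x) and f(y) - f(x) before integrating over y. The bound
    involves the energy of f and not b, so it serves for all f at once. *)
Lemma form_pairing_bound f h (b s : R) : m B < +oo -> measurable_fun setT f ->
  (forall x, `|f x| <= b)%R -> measurable_fun setT h -> L2on m B h -> (0 < s)%R ->
  (`|\int[m]_(x in B) (h x * form_generator f x)| <=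
   2^-1 * (s * rate * fine (sqnorm m B h)) + s^-1 * fine (form_energy f))%R.
Proof.
move=> By mf fb mh Lh s0.
have Lf := form_generator_L2on By mf fb.
have I := L2onM mB Lh Lf.
have Efin := form_energy_fin fb.
pose G1 x (y : M) := (2^-1 * s * h x ^+ 2 * 1)%R.
pose G2 x y := (2^-1 * s^-1 * (f x - f y) ^+ 2)%R.
have k1 : (0 <= 2^-1 * s)%R by rewrite mulr_ge0 ?invr_ge0// ltW.
have k2 : (0 <= 2^-1 * s^-1)%R by rewrite mulr_ge0 ?invr_ge0// ltW.
have mh2 : measurable_fun setT (fun x => 2^-1 * s * h x ^+ 2)%R.
  by apply: measurable_funM => //; exact: measurable_funX.
have h2 x : (0 <= 2^-1 * s * h x ^+ 2)%R by apply: mulr_ge0 => //; exact: sqr_ge0.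
have j1 : jointly_measurable G1.
  apply: jointly_measurableM; last exact: jointly_measurable_cst.
  exact: jointly_measurable_fst mh2.
have j2 : jointly_measurable G2.
  by apply: jointly_measurableM; [exact: jointly_measurable_cst|exact: jointly_measurable_sqrB].
have g1 x y : (0 <= G1 x y)%R by rewrite /G1 mulr1.
have g2 x y : (0 <= G2 x y)%R by apply: mulr_ge0 => //; exact: sqr_ge0.
have key : \int[m]_(x in B) `|(h x * form_generator f x)%:E| <=
    jump_total (fun x y => G1 x y + G2 x y)%R.
  apply: ge0_le_integralW => x Bx; first exact: abse_ge0.
  have mF := measurable_far x.
  have xy : jump_partial (fun _ _ => 1%R) x < +oo by apply: le_lt_trans (rate_bound Bx) (ltry _).
  have mfx : measurable_fun setT (fun y => h x * (f y - f x))%R.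
    by apply: measurable_funM => //; exact: measurable_funB.
  have fxb y : (`|h x * (f y - f x)| <= `|h x| * (b + b))%R.
    by rewrite normrM ler_wpM2l// (le_trans (ler_normB _ _))// lerD.
  have Ix := finite_rate_integrableM xy mfx fxb.
  have -> : (h x * form_generator f x =
      \int[mu x]_(y in far B delta x) (h x * (f y - f x) * c x y))%R.
    have mfx' : measurable_fun setT (fun y => f y - f x)%R by exact: measurable_funB.
    have fxb' y : (`|f y - f x| <= b + b)%R by rewrite (le_trans (ler_normB _ _))// lerD.
    have Ix' := finite_rate_integrableM xy mfx' fxb'.
    rewrite /form_generator -RintegralZl//; apply: eq_Rintegral => y _; exact: mulrA.
  rewrite /Rintegral fineK; last exact: integrable_fin_num.
  apply: le_trans (le_abse_integral _ mF _) _; first exact: measurable_int Ix.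
  apply: ge0_le_integralW => y _; first exact: abse_ge0.
  rewrite abse_EFin lee_fin normrM (ger0_norm (c_ge0 _ _)) ler_wpM2r//.
  rewrite /G1 /G2 mulr1 -(real_normK (num_real (h x))).
  rewrite -(real_normK (num_real (f x - f y))) normrM (distrC (f y)).
  have := sqr_ge0 (s * `|h x| - `|f x - f y|)%R.
  rewrite -(pmulr_rge0 _ (_ : 0 < 2^-1 * s^-1)%R) ?mulr_gt0 ?invr_gt0//.
  have -> : (2^-1 * s^-1 * (s * `|h x| - `|f x - f y|) ^+ 2 =
    2^-1 * s * `|h x| ^+ 2 + 2^-1 * s^-1 * `|f x - f y| ^+ 2 - `|h x| * `|f x - f y|)%R.
    by field; rewrite gt_eqF.
  by rewrite subr_ge0.
apply: le_trans (le_normr_Rintegral mB I) _.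
have IA : m.-integrable B (EFin \o (fun x => `|h x * form_generator f x|)%R).
  exact: (integrable_norm I).
rewrite -lee_fin fineK; last exact: integrable_fin_num.
apply: le_trans key _.
rewrite (jump_totalD j1 j2 g1 g2) EFinD; apply: leeD.
  apply: le_trans (jump_total_fst_le mh2 h2) _.
  rewrite !EFinM fineK; last exact: L2on_fin_num Lh.
  under eq_integral do rewrite EFinM.
  rewrite ge0_integralZl_EFin//; last 2 first.
  - by move=> x _; rewrite lee_fin sqr_ge0.
  - by apply/measurable_funTS/measurable_EFinP/measurable_funX.
  rewrite -/(sqnorm m B h) -(fineK (L2on_fin_num Lh)) -!EFinM lee_fin.
  by rewrite le_eqVlt; apply/orP; left; apply/eqP; ring.
rewrite EFinM fineK//.
rewrite /G2 (jump_totalZ (jointly_measurable_sqrB mf) _ k2); last by move=> x y; exact: sqr_ge0.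
by rewrite /form_energy muleA -EFinM mulrC.
Qed.

(* For bounded f the functional in the conclusion is at most the energy of u, with
   equality for f = u; so it nearly attains it when f is close to u in L2. *)
Lemma form_energy_approx (u : M -> R) (e : R) : m B < +oo ->
  measurable_fun setT u -> L2on m B u -> (0 < e)%R ->
  exists2 eta : R, (0 < eta)%R & forall f (b : R), measurable_fun setT f ->
    (forall x, `|f x| <= b)%R ->
    (fine (sqnorm m B (fun x => u x - f x)) <= eta)%R ->
    (fine (form_energy u) - e <=
     - 2 * (\int[m]_(x in B) (u x * form_generator f x)) - fine (form_energy f))%R.
Proof.
move=> By mu' Lu e0.
have Eufin : form_energy u \is a fin_num.
  rewrite ge0_fin_numE ?form_energy_ge0//.
  apply: le_lt_trans (form_energy_sqnorm mu') _.
  by rewrite lte_mul_pinfty// ?lee_fin ?mulr_ge0//; case: Lu.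
pose Y := fine (form_energy u); have Y0 : (0 <= Y)%R by rewrite fine_ge0// form_energy_ge0.
(* The two entries secure t <= 1/4 and 3 t Y <= e / 4 for [near_maximizer]. *)
pose t : R := Num.min 4^-1%R (e / (12 * (Y + 1)))%R.
have t0 : (0 < t)%R.
  rewrite /t lt_min; apply/andP; split; first by rewrite invr_gt0.
  by apply: divr_gt0 => //; apply: mulr_gt0 => //; rewrite ltr_wpDl.
have t4 : (t <= 4^-1)%R by rewrite /t ge_min lexx.
have tY : (3 * t * Y <= e / 4)%R.
  have : (t * (12 * (Y + 1)) <= e)%R.
    rewrite -ler_pdivlMr; first by rewrite /t ge_min lexx orbT.
    by rewrite mulr_gt0// ltr_wpDl.
  by have := mulr_ge0 (ltW t0) Y0; lra.
(* The total coefficient of the squared distance of f and u in the errors P + Q. *)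
pose K := ((1 + t^-1) * (2 * rate) + t^-1 * rate)%R.
have ti0 : (0 < t^-1)%R by rewrite invr_gt0.
have K0 : (0 <= K)%R by rewrite addr_ge0// !mulr_ge0// ?addr_ge0// ltW.
exists (e / (4 * (K + 1)))%R; first by rewrite divr_gt0// mulr_gt0// ltr_wpDl.
move=> f b mf fb; set q := fine _ => qe.
have q0 : (0 <= q)%R by exact: sqnorm_fine_ge0.
have Kq : (K * q <= e / 4)%R.
  have : (q * (4 * (K + 1)) <= e)%R by rewrite -ler_pdivlMr// mulr_gt0// ltr_wpDl.
  by lra.
have Lf : L2on m B f by apply: (L2on_bounded (b := b)) => //; exact: measurable_funTS.
have muf : measurable_fun setT (fun x => u x - f x)%R by exact: measurable_funB.
have Luf : L2on m B (fun x => u x - f x)%R by exact: L2onB.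
have Effin := form_energy_fin fb; pose X := fine (form_energy f).
have X0 : (0 <= X)%R by rewrite fine_ge0// form_energy_ge0.
have YX : (Y <= (1 + t) * X + (1 + t^-1) * (2 * rate) * q)%R.
  have := form_energyD_le t0 mf muf.
  have -> : (fun x => f x + (u x - f x))%R = u by apply/funext => x; ring.
  have := form_energy_sqnorm muf.
  rewrite -(fineK (L2on_fin_num Luf)) -/q -(fineK Eufin) -/Y -(fineK Effin) -/X.
  move=> h1 h2; rewrite -lee_fin EFinD; apply: le_trans h2 _.
  rewrite -EFinM leeD2l//; apply: le_trans (lee_wpmul2l _ h1) _.
    by rewrite lee_fin addr_ge0// ltW.
  by rewrite -EFinM mulrA.
(* The weight 1 / t leaves t times the energy of f, a small fraction of what is to be bounded
   below. *)
have := form_pairing_bound By mf fb muf Luf ti0; rewrite invrK.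
have [If Ef] := form_pairing mf fb mf fb.
have Iuf := L2onM mB Luf (form_generator_L2on By mf fb).
have -> : (\int[m]_(x in B) (u x * form_generator f x) =
  \int[m]_(x in B) (f x * form_generator f x) +
  \int[m]_(x in B) ((u x - f x) * form_generator f x))%R.
  by rewrite -RintegralD//; apply: eq_Rintegral => x _; ring.
(* Polarization with g = f: a quarter of the energy of 0 minus that of 2 f. *)
have -> : (\int[m]_(x in B) (f x * form_generator f x) = - X)%R.
  apply: etrans Ef _.
  have -> : (fun x => f x - f x)%R = (fun x => 0 * f x)%R.
    by apply/funext => x; rewrite mul0r subrr.
  have -> : (fun x => f x + f x)%R = (fun x => 2 * f x)%R.
    by apply/funext => x; ring.
  have E0 := congr1 fine (form_energyZ 0 mf); have E2 := congr1 fine (form_energyZ 2 mf).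
  rewrite expr0n mul0e in E0; rewrite -(fineK Effin) -EFinM in E2.
  apply: etrans (f_equal2 (fun p q => 4^-1 * (p - q))%R E0 E2) _; rewrite /= -/X.
  by field.
have P0 : (0 <= (1 + t^-1) * (2 * rate) * q)%R by rewrite !mulr_ge0// addr_ge0// ltW.
have Q0 : (0 <= t^-1 * rate * q)%R by rewrite !mulr_ge0// ltW.
have PQ : ((1 + t^-1) * (2 * rate) * q + t^-1 * rate * q <= e / 4)%R.
  by rewrite -mulrDl.
rewrite ler_norml; move=> hI; exact: near_maximizer t0 t4 X0 Y0 P0 Q0 YX tY PQ hI e0.
Qed.


End jump_form.

(** * Cells of an approximating graph *)

Section sigma_finite_tonelli.
Context (R : realType) d (M : borelMetricType R d).
Variable m : {measure set M -> \bar R}.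
Hypothesis sfm : sigma_finite setT m.

(** The proof of sigma-finiteness is a parameter of the copy, so that the sigma-finite structure can
    be attached to it and Tonelli's theorem transferred to m. *)
Definition sigma_finite_copy (s : sigma_finite setT m) : set M -> \bar R := m.

HB.instance Definition _ s := Measure.copy (sigma_finite_copy s) m.

HB.instance Definition _ s :=
  @Measure_isSigmaFinite.Build d M R (sigma_finite_copy s) s.

Let m' : {sigma_finite_measure set M -> \bar R} := sigma_finite_copy sfm.

Lemma sigma_finite_pack : m = m'.
Proof. exact: eq_measure. Qed.

Lemma measurable_partial_integral (G : M -> M -> R) : jointly_measurable G ->
  (forall x y, 0 <= G x y)%R -> measurable_fun setT (fun x => \int[m]_y (G x y)%:E).
Proof.
move=> mG G0; rewrite sigma_finite_pack.
apply: (measurable_fun_fubini_tonelli_F (fun p : M * M => (G p.1 p.2)%:E)).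
- exact/measurable_EFinP.
- by move=> p; rewrite lee_fin.
Qed.

Lemma ge0_tonelli (G : M -> M -> R) : jointly_measurable G ->
  (forall x y, 0 <= G x y)%R ->
  \int[m]_x \int[m]_y (G x y)%:E = \int[m]_y \int[m]_x (G x y)%:E.
Proof.
move=> mG G0; rewrite sigma_finite_pack.
apply: (fubini_tonelli (fun p : M * M => (G p.1 p.2)%:E)).
- exact/measurable_EFinP.
- by move=> p; rewrite lee_fin.
Qed.

End sigma_finite_tonelli.

Section countable_families.
Context (I : pointedType).

Lemma countable_enum (S : set I) : countable S ->
  exists (P : set nat) (e : nat -> I), set_bij P S e.
Proof.
move=> /countable_bijP[P SP]; exists P.
have /pcard_eqP/unsquash e : (P #= S)%card by rewrite card_eq_sym.
by exists e; exact: bij.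
Qed.

Lemma countable_bigcup_measurable d (T : measurableType d) (S : set I) (F : I -> set T) :
  countable S -> (forall i, S i -> measurable (F i)) ->
  measurable (\bigcup_(i in S) F i).
Proof.
move=> /countable_enum[P [e [eS _ Se]]] mF.
have -> : \bigcup_(i in S) F i = \bigcup_(n in P) F (e n).
  apply/seteqP; split=> [x [i /Se[n Pn <-] Fx]|x [n Pn Fx]]; first by exists n.
  by exists (e n) => //; exact: eS.
by apply: bigcup_measurable => n Pn; apply/mF/eS.
Qed.

Lemma countable_bigcup_negligible d (T : measurableType d) (R : realType)
    (m : {measure set T -> \bar R}) (S : set I) (F : I -> set T) :
  countable S -> (forall i, S i -> m.-negligible (F i)) ->
  m.-negligible (\bigcup_(i in S) F i).
Proof.
move=> /countable_enum[P [e [eS _ Se]]] mF.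
have -> : \bigcup_(i in S) F i = \bigcup_n (if n \in P then F (e n) else set0).
  apply/seteqP; split=> [x [i /Se[n Pn <-] Fx]|x [n _]].
    by exists n => //; rewrite mem_set.
  by case: ifPn => // /set_mem Pn Fx; exists (e n) => //; exact: eS.
apply: negligible_bigcup => n; case: ifPn => [/set_mem Pn|_]; first exact/mF/eS.
exact: negligible_set0.
Qed.

End countable_families.

Lemma countable_esumZr (I : pointedType) (R : realType) (S : set I) (a : I -> \bar R)
    (k : R) : countable S -> (forall i, S i -> 0 <= a i) -> (0 <= k)%R ->
  \esum_(i in S) (a i * k%:E) = (\esum_(i in S) a i) * k%:E.
Proof.
move=> /countable_enum[P [e bij_e]] a0 k0; have [eS _ _] := bij_e.
have sumE (b : I -> \bar R) : (forall i, S i -> 0 <= b i) ->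
    \esum_(i in S) b i = \sum_(0 <= n <oo) (if n \in P then b (e n) else 0).
  move=> b0; rewrite nneseries_esumT -?esum_mkcond; first exact: reindex_esum.
  by move=> n; case: ifPn => // /set_mem/eS; exact: b0.
rewrite (sumE _ a0) sumE; last by move=> i Si; rewrite mule_ge0 ?a0// lee_fin.
rewrite muleC -nneseriesZl; last first.
  by move=> n _; case: ifPn => // /set_mem/eS; exact: a0.
by apply: eq_eseriesr => n _; case: ifPn; rewrite ?mule0// muleC.
Qed.

Lemma ge0_integral_countable_bigcup (I : pointedType) d (T : measurableType d)
    (R : realType) (m : {measure set T -> \bar R}) (S : set I) (F : I -> set T)
    (H : T -> \bar R) : countable S -> (forall i, S i -> measurable (F i)) ->
  (forall i j, S i -> S j -> F i `&` F j !=set0 -> i = j) ->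
  measurable_fun setT H -> (forall x, 0 <= H x) ->
  \int[m]_(x in \bigcup_(i in S) F i) H x = \esum_(i in S) \int[m]_(x in F i) H x.
Proof.
move=> cS mF dF mH H0; have [P [e [eS einj Se]]] := countable_enum cS.
pose F' n := if n \in P then F (e n) else set0.
have -> : \bigcup_(i in S) F i = \bigcup_n F' n.
  apply/seteqP; split=> [x [i /Se[n Pn <-] Fx]|x [n _]].
    by exists n => //; rewrite /F' mem_set.
  by rewrite /F'; case: ifPn => // /set_mem Pn Fx; exists (e n) => //; exact: eS.
rewrite ge0_integral_bigcup; last 4 first.
- by move=> n; rewrite /F'; case: ifPn => // /set_mem Pn; apply/mF/eS.
- exact: measurable_funTS.
- by [].
- move=> i j _ _ [x []]; rewrite /F'.
  case: ifPn => // iP Fi; case: ifPn => // jP Fj.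
  by apply: einj => //; apply: dF; [exact/eS/set_mem|exact/eS/set_mem|exists x].
rewrite nneseries_esumT; last by move=> n; exact: integral_ge0.
rewrite (reindex_esum P S e)//.
rewrite [RHS]esum_mkcond; apply: eq_esum => n _; rewrite /F'.
by case: ifPn => // _; rewrite integral_set0.
Qed.

Section cells_of_one_level.
Context (R : realType) d (M : borelMetricType R d).
Hypothesis sepM : exists2 A : set M, countable A & dense A.
Variables (m : {measure set M -> \bar R}) (Vk : set M) (Uk : M -> set M).
Hypothesis open_pos : forall x r, (0 < r)%R -> 0 < m (ball x r).
Hypothesis mU : forall x, Vk x -> measurable (Uk x).
Hypothesis coverU : \bigcup_(x in Vk) Uk x = setT.
Hypothesis disjU : forall x y, Vk x -> Vk y -> x <> y -> m (Uk x `&` Uk y) = 0.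
Hypothesis centerU : forall x, Vk x -> Vk `&` interior (Uk x) = [set x].
Implicit Types (x y z w : M) (g : M -> R).

(** The interior of each cell contains its vertex, hence a point of the dense sequence. Two vertices
    with the same point would have cells sharing a ball, which has positive mass, while overlaps are
    null. *)
Lemma countable_vertices : countable Vk.
Proof.
have [a adense] := dense_sequence sepM.
have center x : Vk x -> interior (Uk x) x.
  by move=> Vx; have : [set x] x by []; rewrite -(centerU Vx) => -[].
have /choice[n nP] x : exists n, Vk x -> interior (Uk x) (a n).
  have [Vx|] := pselect (Vk x); last by exists 0%N.
  have /metric_openP oi := open_interior (Uk x).
  have [r r0 xr] := oi _ (center _ Vx).
  have [n an] := adense x r r0; exists n => _; apply: xr.
  by rewrite in_ballE.
apply/countable_injP; exists n => x y /set_mem Vx /set_mem Vy nxy.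
apply: contrapT => xy.
have /metric_openP oi : open (interior (Uk x) `&` interior (Uk y)).
  by apply: openI; exact: open_interior.
have [|r r0 rU] := oi (a (n x)).
  by split; [exact: nP|rewrite nxy; exact: nP].
have := open_pos (a (n x)) r0; rewrite ltNge => /negP; apply.
rewrite -(disjU Vx Vy xy); apply: measure_mono.
- exact: metric_ball_measurable.
- by apply: measurableI; exact: mU.
- by move=> z /rU[zx zy]; split; exact: interior_subset.
Qed.

(** The points of [Uk x] in no other cell. These sets are disjoint, not just up to null sets, and
    have the mass of [Uk x]; on them [extend] takes the value at x. *)
Definition cell x : set M := [set z | cells Vk Uk z = [set x]].

Lemma cell_sub x : Vk x -> cell x `<=` Uk x.
Proof.
move=> Vx z zx; have : cells Vk Uk z x by rewrite zx.
by case.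
Qed.

Lemma cell_vertex x z : cell x z -> Vk x.
Proof. by move=> zx; have [] : cells Vk Uk z x by rewrite zx. Qed.

Lemma cell_inj x y z : cell x z -> cell y z -> x = y.
Proof. by move=> zx; rewrite /cell /= zx => /seteqP[+ _] => /(_ x); apply. Qed.

Lemma cellE x : Vk x -> cell x = Uk x `\` \bigcup_(y in Vk `\ x) Uk y.
Proof.
move=> Vx; apply/seteqP; split=> [z zx|z [zU zN]].
  split; first exact: cell_sub zx.
  move=> [y [Vy yx] Uy]; apply: yx; apply/esym.
  have : cells Vk Uk z y by split.
  by rewrite zx => ->.
apply/seteqP; split=> [y [Vy Uy]|y ->]; last by split.
by apply: contrapT => yx; apply: zN; exists y.
Qed.

Lemma measurable_cell x : Vk x -> measurable (cell x).
Proof.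
move=> Vx; rewrite cellE//; apply: measurableD; first exact: mU.
apply: countable_bigcup_measurable => [|y [Vy _]]; last exact: mU.
by apply: sub_countable countable_vertices; apply: subset_card_le => y [].
Qed.

Lemma negligible_overlap x : Vk x ->
  m.-negligible (Uk x `&` \bigcup_(y in Vk `\ x) Uk y).
Proof.
move=> Vx; rewrite setI_bigcupr; apply: countable_bigcup_negligible.
  by apply: sub_countable countable_vertices; apply: subset_card_le => y [].
move=> y [Vy yx]; apply/negligibleP; first by apply: measurableI; exact: mU.
by apply: disjU => // xy; apply: yx.
Qed.

Lemma measure_cell x : Vk x -> m (cell x) = m (Uk x).
Proof.
move=> Vx; have mN : measurable (\bigcup_(y in Vk `\ x) Uk y).
  apply: countable_bigcup_measurable => [|y [Vy _]]; last exact: mU.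
  by apply: sub_countable countable_vertices; apply: subset_card_le => y [].
rewrite cellE// [RHS](measureDI _ (mU Vx) mN).
rewrite [X in _ = _ + X]measure_negligible ?adde0//; last exact: negligible_overlap.
by apply: measurableI => //; exact: mU.
Qed.

Definition shared : set M := ~` \bigcup_(x in Vk) cell x.

Lemma measurable_cells (S : set M) : S `<=` Vk -> measurable (\bigcup_(x in S) cell x).
Proof.
move=> SV; apply: countable_bigcup_measurable => [|y /SV]; last exact: measurable_cell.
by apply: sub_countable countable_vertices; exact: subset_card_le.
Qed.

Lemma measurable_shared : measurable shared.
Proof. by apply: measurableC; exact: measurable_cells. Qed.

(** The sets [Uk x] cover M, so a point in no [cell] lies in two of them; there are countably many
    overlaps and each is null. *)
Lemma shared_null : m shared = 0.
Proof.
apply: measure_negligible; first exact: measurable_shared.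
apply: (@negligibleS _ _ _ _ (\bigcup_(x in Vk) (Uk x `&` \bigcup_(y in Vk `\ x) Uk y))).
  move=> z zN; have : [set: M] z by []; rewrite -coverU => -[x Vx Ux].
  exists x => //; split => //; apply: contrapT => h; apply: zN; exists x => //.
  by rewrite cellE.
by apply: countable_bigcup_negligible;
  [exact: countable_vertices|exact: negligible_overlap].
Qed.

Lemma extend_cell g x z : cell x z -> extend Vk Uk g z = g x.
Proof.
move=> zx; rewrite /extend; case: ifPn => [_|/asboolPn[]]; last by exists x.
rewrite zx; congr g; have : [set x] (get [set x]) by apply: getPex; exists x.
by [].
Qed.

Lemma extend_shared g z : shared z -> extend Vk Uk g z = 0%R.
Proof.
move=> zs; rewrite /extend; case: ifPn => // /asboolP[x zx].
by exfalso; apply: zs; exists x => //; exact: cell_vertex zx.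
Qed.

Lemma cell_or_shared z : (exists2 x, Vk x & cell x z) \/ shared z.
Proof. by have [[x Vx zx]|] := pselect ((\bigcup_(x in Vk) cell x) z); [left; exists x|right]. Qed.

Lemma measurable_extend g : measurable_fun setT (extend Vk Uk g).
Proof.
move=> _ A mA; rewrite setTI.
have -> : extend Vk Uk g @^-1` A =
    (\bigcup_(x in Vk `&` (g @^-1` A)) cell x) `|` (if (0%R : R) \in A then shared else set0).
  apply/seteqP; split=> z /=.
    have [[x Vx zx]|zs] := cell_or_shared z.
      by rewrite (extend_cell _ zx) => gx; left; exists x.
    by rewrite (extend_shared _ zs) => A0; right; rewrite mem_set.
  move=> [[x [Vx gx] zx]|]; first by rewrite /preimage /= (extend_cell _ zx).
  by case: ifPn => // /set_mem A0 zs; rewrite /preimage /= (extend_shared _ zs).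
apply: measurableU; first by apply: measurable_cells => x [].
by case: ifPn => // _; exact: measurable_shared.
Qed.

Lemma extend2_cell (C : M -> M -> R) x y z w : cell x z -> cell y w ->
  extend2 Vk Uk C z w = C x y.
Proof. by move=> zx wy; rewrite /extend2 (extend_cell _ zx) (extend_cell _ wy). Qed.

Lemma extend2_sharedl (C : M -> M -> R) z w : shared z -> extend2 Vk Uk C z w = 0%R.
Proof. by move=> zs; rewrite /extend2 extend_shared. Qed.

Lemma extend2_sharedr (C : M -> M -> R) z w : shared w -> extend2 Vk Uk C z w = 0%R.
Proof.
move=> ws; have [[x Vx zx]|zs] := cell_or_shared z; last exact: extend2_sharedl.
by rewrite /extend2 (extend_cell _ zx) extend_shared.
Qed.

(** Preimages are countable unions of products of cells, up to the strips over [shared], where the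
    value is 0. *)
Lemma measurable_extend2 (C : M -> M -> R) :
  measurable_fun setT (fun p : M * M => extend2 Vk Uk C p.1 p.2).
Proof.
move=> _ A mA; rewrite setTI.
pose S := (Vk `*` Vk) `&` [set p | A (C p.1 p.2)].
pose Z := (shared `*` setT) `|` (setT `*` shared) : set (M * M).
have -> : (fun p : M * M => extend2 Vk Uk C p.1 p.2) @^-1` A =
    (\bigcup_(p in S) (cell p.1 `*` cell p.2)) `|` (if (0%R : R) \in A then Z else set0).
  apply/seteqP; split=> -[z w] /=.
    have [[x Vx zx]|zs] := cell_or_shared z; last first.
      by rewrite extend2_sharedl// => A0; right; rewrite mem_set//; left.
    have [[y Vy wy]|ws] := cell_or_shared w; last first.
      by rewrite extend2_sharedr// => A0; right; rewrite mem_set//; right.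
    by rewrite (extend2_cell _ zx wy) => Axy; left; exists (x, y).
  move=> [[[x y] [[Vx Vy] Axy] [zx wy]]|]; first by rewrite /preimage /= (extend2_cell _ zx wy).
  case: ifPn => // /set_mem A0 [[zs _]|[_ ws]]; rewrite /preimage /=.
    by rewrite extend2_sharedl.
  by rewrite extend2_sharedr.
apply: measurableU; last first.
  case: ifPn => // _; apply: measurableU; apply: measurableX => //; exact: measurable_shared.
apply: countable_bigcup_measurable => [|p [[V1 V2] _]].
  apply: sub_countable (countableX countable_vertices countable_vertices).
  by apply: subset_card_le => p [].
by apply: measurableX; exact: measurable_cell.
Qed.

Lemma integral_cells (H : M -> \bar R) : measurable_fun setT H -> (forall z, 0 <= H z) ->
  \int[m]_z H z = \esum_(x in Vk) \int[m]_(z in cell x) H z.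
Proof.
move=> mH H0; rewrite -(ge0_integral_countable_bigcup _ countable_vertices)//; last 2 first.
- by move=> x Vx; exact: measurable_cell.
- by move=> x y _ _ [z [zx zy]]; exact: cell_inj zx zy.
rewrite (ge0_negligible_integral measurable_shared measurableT)//; last exact: shared_null.
by congr (integral _ _ _); rewrite setTD /shared setCK.
Qed.

Lemma integral_cellwise_constant (H : M -> \bar R) (h : M -> \bar R) :
  measurable_fun setT H -> (forall z, 0 <= H z) ->
  (forall x z, cell x z -> H z = h x) ->
  \int[m]_z H z = \esum_(x in Vk) (h x * m (Uk x)).
Proof.
move=> mH H0 Hh; rewrite integral_cells//; apply: eq_esum => x Vx.
rewrite -measure_cell// -integral_cst; last exact: measurable_cell.
by apply: eq_integral => z /set_mem zx; exact: Hh.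
Qed.

Hypothesis sfm : sigma_finite setT m.
Hypothesis finU : forall x, Vk x -> 0 < m (Uk x) < +oo.

Lemma discrete_L2_extend g : discrete_L2 m Vk Uk g -> L2on m setT (extend Vk Uk g).
Proof.
move=> gy; have mg := measurable_extend g; split => //; apply: le_lt_trans gy.
rewrite /sqnorm (integral_cellwise_constant (h := fun x => (g x ^+ 2)%:E))//.
- exact/measurable_EFinP/measurable_funX.
- by move=> z; rewrite lee_fin sqr_ge0.
- by move=> x z zx; rewrite (extend_cell _ zx).
Qed.

Lemma discrete_L2E g : \esum_(x in Vk) (((g x) ^+ 2)%:E * m (Uk x)) =
  sqnorm m setT (extend Vk Uk g).
Proof.
have mg := measurable_extend g.
rewrite /sqnorm (integral_cellwise_constant (h := fun x => (g x ^+ 2)%:E))//.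
- exact/measurable_EFinP/measurable_funX.
- by move=> z; rewrite lee_fin sqr_ge0.
- by move=> x z zx; rewrite (extend_cell _ zx).
Qed.

Variable C : M -> M -> R.
Hypothesis C_ge0 : forall x y, Vk x -> Vk y -> (0 <= C x y)%R.

Lemma extend2_ge0 z w : (0 <= extend2 Vk Uk C z w)%R.
Proof.
have [[x Vx zx]|zs] := cell_or_shared z; last by rewrite extend2_sharedl.
have [[y Vy wy]|ws] := cell_or_shared w; last by rewrite extend2_sharedr.
by rewrite (extend2_cell _ zx wy) C_ge0.
Qed.

Lemma extend2_sym z w : (forall x y, Vk x -> Vk y -> C x y = C y x) ->
  extend2 Vk Uk C z w = extend2 Vk Uk C w z.
Proof.
move=> Csym.
have [[x Vx zx]|zs] := cell_or_shared z; last by rewrite extend2_sharedl// extend2_sharedr.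
have [[y Vy wy]|ws] := cell_or_shared w; last by rewrite extend2_sharedr// extend2_sharedl.
by rewrite (extend2_cell _ zx wy) (extend2_cell _ wy zx) Csym.
Qed.

(** The integrand is constant on each product of two cells, and its two integrations become the two
    summations. All further estimates are made on M, where levels can be compared with the limit. *)
Lemma discrete_sumE g : discrete_sum m Vk Uk C g =
  \int[m]_z \int[m]_w (((extend Vk Uk g z - extend Vk Uk g w) ^+ 2 *
                        extend2 Vk Uk C z w)%:E).
Proof.
pose G z w := ((extend Vk Uk g z - extend Vk Uk g w) ^+ 2 * extend2 Vk Uk C z w)%R.
have mg := measurable_extend g.
have mG : jointly_measurable G.
  by apply: jointly_measurableM; [exact: jointly_measurable_sqrB|exact: measurable_extend2].
have G0 z w : (0 <= G z w)%R by apply: mulr_ge0; [exact: sqr_ge0|exact: extend2_ge0].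
pose a x y := ((g x - g y) ^+ 2 * C x y)%:E * m (Uk y).
have a0 x y : Vk x -> Vk y -> 0 <= a x y.
  move=> Vx Vy; apply: mule_ge0 => //; rewrite lee_fin.
  by apply: mulr_ge0; [exact: sqr_ge0|exact: C_ge0].
rewrite (@integral_cellwise_constant _ (fun x => \esum_(y in Vk) a x y)); last 3 first.
- exact: (measurable_partial_integral sfm mG G0).
- by move=> z; apply: integral_ge0 => w _; rewrite lee_fin; exact: G0.
- move=> x z zx; rewrite (@integral_cellwise_constant _ (fun y => ((g x - g y) ^+ 2 * C x y)%:E))//.
  + by apply/measurable_EFinP; exact: (measurable_section z mG).
  + by move=> w; rewrite lee_fin; exact: G0.
  + by move=> y w wy; rewrite (extend2_cell _ zx wy) (extend_cell _ zx) (extend_cell _ wy).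
have -> : \esum_(x in Vk) ((\esum_(y in Vk) a x y) * m (Uk x)) =
    \esum_(x in Vk) \esum_(y in Vk) (a x y * m (Uk x)).
  apply: eq_esum => x Vx; have /andP[U0 Uy] := finU Vx.
  have Ufin : m (Uk x) \is a fin_num by rewrite ge0_fin_numE.
  rewrite -(fineK Ufin) countable_esumZr ?fine_ge0//; first exact: countable_vertices.
  by move=> y Vy; exact: a0.
rewrite esum_esum; last by move=> x y Vx Vy; rewrite mule_ge0// a0.
by apply: eq_esum => -[x y] /= [Vx Vy]; rewrite /a -!muleA (muleC (m (Uk x))).
Qed.

Definition cell_mean (f : M -> R) x : R := mean m (cell x) f.

Lemma mass_cell x : Vk x -> 0 < m (cell x) < +oo.
Proof. by move=> Vx; rewrite measure_cell// finU. Qed.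

(** Jensen's inequality cell by cell, for a weight that is constant on cells; t will be the value at
    the other point of a pair. *)
Lemma cell_mean_jensen (f c : M -> R) (t : R) :
  (forall x, Vk x -> L2on m (cell x) f) -> measurable_fun setT f ->
  measurable_fun setT c -> (forall z, 0 <= c z)%R ->
  (forall x z w, cell x z -> cell x w -> c z = c w) ->
  \int[m]_z ((t - extend Vk Uk (cell_mean f) z) ^+ 2 * c z)%:E <=
  \int[m]_z ((t - f z) ^+ 2 * c z)%:E.
Proof.
move=> Lf mf mc c0 cc; have mg := measurable_extend (cell_mean f).
have mH (h : M -> R) : measurable_fun setT h ->
    measurable_fun setT (fun z => ((t - h z) ^+ 2 * c z)%:E).
  move=> mh; apply/measurable_EFinP/measurable_funM => //.
  by apply: measurable_funX; exact: measurable_funB.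
have H0 (h : M -> R) z : 0 <= ((t - h z) ^+ 2 * c z)%:E.
  by rewrite lee_fin; apply: mulr_ge0 => //; exact: sqr_ge0.
rewrite !integral_cells//; try exact: mH.
apply: le_esum => x Vx; have mcx := measurable_cell Vx.
have [z0 xz0] : cell x !=set0.
  apply/set0P/eqP => h; have := mass_cell Vx; rewrite h measure0 ltxx.
  by [].
have cE z : cell x z -> c z = c z0 by move=> zx; exact: cc zx xz0.
rewrite [leRHS](eq_integral (fun z => (c z0)%:E * ((t - f z) ^+ 2)%:E)); last first.
  by move=> z /set_mem/cE ->; rewrite EFinM muleC.
rewrite [leLHS](eq_integral (cst ((c z0)%:E * ((t - cell_mean f x) ^+ 2)%:E))); last first.
  by move=> z /set_mem xz; rewrite (cE _ xz) (extend_cell _ xz) EFinM muleC.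
rewrite integral_cst// ge0_integralZl_EFin//; last 2 first.
- by move=> z _; rewrite lee_fin sqr_ge0.
- apply/measurable_funTS/measurable_EFinP/measurable_funX.
  exact: measurable_funB.
rewrite -muleA; apply: lee_wpmul2l; first by rewrite lee_fin.
exact: sqr_mean_le mcx (mass_cell Vx) (Lf _ Vx).
Qed.

(** Jensen's inequality, with the integral of the square bounded by e^2 times the mass. *)
Lemma mean_near (A : set M) (f : M -> R) (t e : R) : measurable A -> 0 < m A < +oo ->
  measurable_fun A f -> (0 <= e)%R -> (forall z, A z -> `|t - f z| <= e)%R ->
  (`|t - mean m A f| <= e)%R.
Proof.
move=> mA mpos mf e0 h; have /andP[A0 Ay] := mpos.
have Afin : m A \is a fin_num by rewrite ge0_fin_numE.
have Lf : L2on m A f.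
  apply: (@L2on_bounded _ _ _ _ _ _ (`|t| + e)%R) => // z Az.
  rewrite -lerBlDl; apply: le_trans (lerB_dist _ _) _; rewrite distrC; exact: h.
have := sqr_mean_le t mA mpos Lf.
have le2 : sqnorm m A (fun x => t - f x)%R <= (e ^+ 2)%:E * m A.
  rewrite -integral_cst//; apply: ge0_le_integralW => z Az; first by rewrite lee_fin sqr_ge0.
  by rewrite lee_fin -real_normK ?num_real// lerXn2r ?nnegrE// h.
move=> /le_trans/(_ le2); rewrite lee_pmul2r// lee_fin.
by rewrite -[X in (X <= _)%R]real_normK ?num_real// ler_sqr ?nnegrE.
Qed.

(** The two points of a pair are averaged one after the other, through the mixed integrand [K] with
    f at one point and the mean at the other; Tonelli's theorem brings each variable inside in
    turn. *)
Lemma discrete_sum_cell_mean (f : M -> R) : measurable_fun setT f ->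
  (forall x, Vk x -> L2on m (cell x) f) ->
  discrete_sum m Vk Uk C (cell_mean f) <=
  \int[m]_z \int[m]_w ((f z - f w) ^+ 2 * extend2 Vk Uk C z w)%:E.
Proof.
move=> mf Lf; rewrite discrete_sumE.
set g := extend Vk Uk (cell_mean f).
have mg : measurable_fun setT g by exact: measurable_extend.
have mC := measurable_extend2 C.
pose K z w := ((f z - g w) ^+ 2 * extend2 Vk Uk C z w)%R.
have mK : jointly_measurable K.
  apply: measurable_funM => //; apply: (measurable_funX (f := fun p : M * M => f p.1 - g p.2)%R).
  by apply: measurable_funB; exact: (measurableT_comp _).
have K0 z w : (0 <= K z w)%R by apply: mulr_ge0; [exact: sqr_ge0|exact: extend2_ge0].
have step1 : \int[m]_z \int[m]_w (K z w)%:E <=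
    \int[m]_z \int[m]_w ((f z - f w) ^+ 2 * extend2 Vk Uk C z w)%:E.
  apply: ge0_le_integralW => z _; first by apply: integral_ge0 => w _; rewrite lee_fin.
  apply: cell_mean_jensen => //.
  - exact: (measurable_section z mC).
  - by move=> w; exact: extend2_ge0.
  - move=> y w w' yw yw'; have [[x Vx zx]|zs] := cell_or_shared z.
      by rewrite (extend2_cell _ zx yw) (extend2_cell _ zx yw').
    by rewrite !extend2_sharedl.
apply: le_trans step1; rewrite (ge0_tonelli sfm mK K0).
rewrite (ge0_tonelli sfm (G := fun z w => ((g z - g w) ^+ 2 * extend2 Vk Uk C z w)%R)); last 2 first.
- by apply: jointly_measurableM; [exact: jointly_measurable_sqrB|exact: measurable_extend2].
- by move=> z w; apply: mulr_ge0; [exact: sqr_ge0|exact: extend2_ge0].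
apply: ge0_le_integralW => w _.
  apply: integral_ge0 => z _; rewrite lee_fin.
  by apply: mulr_ge0; [exact: sqr_ge0|exact: extend2_ge0].
have sqC (a b : R) : ((a - b) ^+ 2 = (b - a) ^+ 2)%R by rewrite -sqrrN opprB.
rewrite (eq_integral (fun z => ((g w - g z) ^+ 2 * extend2 Vk Uk C z w)%:E)); last first.
  by move=> z _; rewrite sqC.
rewrite [leRHS](eq_integral (fun z => ((g w - f z) ^+ 2 * extend2 Vk Uk C z w)%:E)); last first.
  by move=> z _; rewrite /K sqC.
apply: (cell_mean_jensen (c := fun z => extend2 Vk Uk C z w)) => //.
- apply: (measurableT_comp mC (_ : measurable_fun setT (fun z => (z, w)))).
  exact: pair2_measurable.
- by move=> z; exact: extend2_ge0.
- move=> x z z' xz xz'; have [[y Vy wy]|ws] := cell_or_shared w.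
    by rewrite (extend2_cell _ xz wy) (extend2_cell _ xz' wy).
  by rewrite !extend2_sharedr.
Qed.

End cells_of_one_level.

(** * Symmetry of the jump kernel at distance above delta *)

Section limsup.
Context (R : realType).
Implicit Types (u : nat -> \bar R) (a : \bar R).

Lemma limn_esup_le_near u a : (\forall n \near \oo, u n <= a) -> limn_esup u <= a.
Proof.
move=> ua; apply: le_trans (_ : ereal_sup (u @` [set n | u n <= a]) <= a).
  by apply: ereal_inf_lbound; exists [set n | u n <= a].
by apply: ge_ereal_sup => _ [n /= na <-].
Qed.

Lemma limn_esup_lt_near u a : limn_esup u < a -> \forall n \near \oo, u n < a.
Proof.
move=> /ereal_inf_lt[_ [W Woo <-] ua]; apply: filterS Woo => n Wn.
by apply: le_lt_trans ua; apply: ereal_sup_ubound; exists n.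
Qed.

Lemma limn_einf_ge_near u a : (\forall n \near \oo, a <= u n) -> a <= limn_einf u.
Proof.
move=> ua; rewrite /limn_einf leeNr; apply: limn_esup_le_near.
by apply: filterS ua => n; rewrite leeN2.
Qed.

Lemma limn_einf_le_near u a : (\forall n \near \oo, u n <= a) -> limn_einf u <= a.
Proof. by move=> ua; apply: le_trans (limn_einf_sup _) _; exact: limn_esup_le_near. Qed.

End limsup.

Section dense_grid.
Context (R : realType) d (M : borelMetricType R d).
Variable a : nat -> M.
Hypothesis adense : forall x r, (0 < r)%R -> exists n, (mdist x (a n) < r)%R.

Lemma grid_exists n x : exists l, (mdist x (a l) < n.+1%:R^-1)%R.
Proof. by apply: adense; rewrite invr_gt0. Qed.

(** Taking the least index splits M into countably many disjoint Borel classes of small diameter. *)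
Definition grid_index n x : nat := ex_minn (grid_exists n x).

Lemma mdist_grid n x : (mdist x (a (grid_index n x)) < n.+1%:R^-1)%R.
Proof. by rewrite /grid_index; case: ex_minnP. Qed.

Lemma measurable_grid n l : measurable [set x | grid_index n x = l].
Proof.
pose S k := [set x : M | (mdist x (a k) < n.+1%:R^-1)%R].
have mS k : measurable (S k).
  rewrite (_ : S k = ball (a k) n.+1%:R^-1); first exact: metric_ball_measurable.
  by apply/seteqP; split=> x; rewrite in_ballE metric_sym.
have -> : [set x | grid_index n x = l] = S l `\` \bigcup_(k in [set k | (k < l)%N]) S k.
  apply/seteqP; split=> [x <-|x [xl xN]].
    split; first exact: mdist_grid.
    move=> [k /= kl xk]; move: kl; rewrite /grid_index; case: ex_minnP => i _ /(_ k xk).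
    by rewrite leqNgt => /negP.
  rewrite /= /grid_index; case: ex_minnP => i xi imin.
  apply/eqP; rewrite eqn_leq (imin _ xl) /= leqNgt; apply/negP => il.
  by apply: xN; exists i.
by apply: measurableD => //; apply: bigcup_measurable.
Qed.

Lemma measurable_grid_fun n (psi : nat -> M -> \bar R) :
  (forall l, measurable_fun setT (psi l)) ->
  measurable_fun setT (fun x => psi (grid_index n x) x).
Proof.
move=> mpsi _ A mA; rewrite setTI.
have -> : (fun x => psi (grid_index n x) x) @^-1` A =
    \bigcup_l ([set x | grid_index n x = l] `&` psi l @^-1` A).
  by apply/seteqP; split=> [x xA|x [l _ [<-]]]; [exists (grid_index n x)|].
apply: bigcup_measurable => l _; apply: measurableI; first exact: measurable_grid.
by rewrite -[X in measurable X]setTI; exact: mpsi.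
Qed.

Variable delta : R.

(* Symmetry of j is only assumed against products u(x) v(y), so the set of pairs at
   distance above delta is exhausted by countable unions of rectangles: the pairs whose
   grid points are at distance above delta + 2 / (n + 1). *)
Definition grid_far n l l' : bool := (delta + 2 * n.+1%:R^-1 < mdist (a l) (a l'))%R.

Lemma grid_far_sym n l l' : grid_far n l l' = grid_far n l' l.
Proof. by rewrite /grid_far metric_sym. Qed.

Lemma grid_far_mdist n x y : grid_far n (grid_index n x) (grid_index n y) ->
  (delta < mdist x y)%R.
Proof.
rewrite /grid_far => h; have := mdist_grid n x; have := mdist_grid n y.
have := metric_triangle (a (grid_index n x)) x (a (grid_index n y)).
have := metric_triangle x y (a (grid_index n y)).
rewrite (metric_sym (a (grid_index n x)) x); move: h; move: (n.+1%:R^-1)%R => q; lra.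
Qed.

Lemma grid_far_eventually x y : (delta < mdist x y)%R ->
  \forall n \near \oo, grid_far n (grid_index n x) (grid_index n y).
Proof.
move=> xy; pose e : R := ((mdist x y - delta) / 4)%R.
have e0 : (0 < e)%R by rewrite divr_gt0// subr_gt0.
exists (Num.truncn e^-1).+1 => // n /= en.
have ne : (n.+1%:R^-1 < e)%R.
  rewrite -[X in (_ < X)%R]invrK ltf_pV2 ?posrE ?invr_gt0//.
  by rewrite (lt_le_trans (truncnS_gt _))// ler_nat leqW.
have := mdist_grid n x; have := mdist_grid n y.
have := metric_triangle x (a (grid_index n x)) y.
have := metric_triangle (a (grid_index n x)) (a (grid_index n y)) y.
rewrite (metric_sym (a (grid_index n y)) y) /grid_far.
move: ne; rewrite /e; move: (n.+1%:R^-1)%R => q; lra.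
Qed.

End dense_grid.

Section jump_kernel_truncation.
Context (R : realType) d (M : borelMetricType R d).
Variables (m : {measure set M -> \bar R}) (j : R.-ker M ~> M).
Variable a : nat -> M.
Hypothesis adense : forall x r, (0 < r)%R -> exists n, (mdist x (a n) < r)%R.
Variables (B : set M) (delta : R).
Hypothesis mB : measurable B.
Hypothesis delta_ge0 : (0 <= delta)%R.
Hypothesis j_sym : forall u v : M -> R,
  measurable_fun setT u -> measurable_fun setT v ->
  (forall x, (0 <= u x)%R) -> (forall x, (0 <= v x)%R) ->
  \int[m]_x ((u x)%:E * jump_op j v x) = \int[m]_x (jump_op j u x * (v x)%:E).
Implicit Types (u v : M -> R).

Let idx n x := grid_index adense n x.

Definition grid_part n l v y : R := (v y * \1_(B `&` [set z | idx n z = l]) y)%R.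

Lemma grid_part_ge0 n l v y : (forall z, 0 <= v z)%R -> (0 <= grid_part n l v y)%R.
Proof. by move=> v0; rewrite mulr_ge0// indicE. Qed.

Lemma measurable_grid_part n l v : measurable_fun setT v ->
  measurable_fun setT (grid_part n l v).
Proof.
move=> mv; apply: measurable_funM => //; apply: measurable_indic.
by apply: measurableI => //; exact: measurable_grid.
Qed.

Definition grid_partial n v x : \bar R :=
  \int[j x]_y (\sum_(0 <= l <oo) (if grid_far a delta n (idx n x) l
                                  then (grid_part n l v y)%:E else 0)).

Lemma measurable_grid_summand n l l' v : measurable_fun setT v ->
  measurable_fun setT (fun y => if grid_far a delta n l l' then (grid_part n l' v y)%:E else 0).
Proof.
move=> mv; case: (grid_far a delta n l l'); last exact: measurable_cst.
exact/measurable_EFinP/measurable_grid_part.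
Qed.

Lemma grid_sumE n l v y : (forall z, 0 <= v z)%R ->
  \sum_(0 <= l' <oo) (if grid_far a delta n l l' then (grid_part n l' v y)%:E else 0) =
  if `[< B y >] && grid_far a delta n l (idx n y) then (v y)%:E else 0.
Proof.
move=> v0; rewrite (@nneseriesD1 _ _ (idx n y))//; last first.
  by move=> k _; case: ifP => // _; rewrite lee_fin grid_part_ge0.
rewrite eseries0 ?adde0; last first.
  move=> k _ kn; case: ifP => // _; rewrite /grid_part indicE memNset ?mulr0//.
  by move=> [_ /= h]; move: kn; rewrite -h eqxx.
rewrite /grid_part indicE; have [By|By] := asboolP (B y).
  by rewrite mem_set ?mulr1.
by rewrite memNset ?mulr0 => [|[]//]; case: ifP.
Qed.

(** The point x enters through its class l only. Hence measurability in x reduces to integrals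
    against [j x] of functions of y alone, for which any kernel will do. *)
Let grid_kernel n l v y : \bar R :=
  if `[< B y >] && grid_far a delta n l (idx n y) then (v y)%:E else 0.

Let grid_kernel_ge0 n l v y : (forall z, 0 <= v z)%R -> 0 <= grid_kernel n l v y.
Proof. by move=> v0; rewrite /grid_kernel; case: ifP => _; rewrite ?lee_fin. Qed.

Let measurable_grid_kernel n l v : measurable_fun setT v -> (forall z, 0 <= v z)%R ->
  measurable_fun setT (grid_kernel n l v).
Proof.
move=> mv v0; have -> : grid_kernel n l v = fun y => \sum_(0 <= l' <oo)
    (if grid_far a delta n l l' then (grid_part n l' v y)%:E else 0).
  by apply/funext => y; rewrite grid_sumE.
apply: ge0_emeasurable_sum => [k y _ _|k _]; last exact: measurable_grid_summand.
by case: ifP => // _; rewrite lee_fin grid_part_ge0.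
Qed.

Let grid_partialE n v x : (forall z, 0 <= v z)%R ->
  grid_partial n v x = \int[j x]_y grid_kernel n (idx n x) v y.
Proof. by move=> v0; apply: eq_integral => y _; rewrite grid_sumE. Qed.

Lemma grid_partial_ge0 n v x : (forall z, 0 <= v z)%R -> 0 <= grid_partial n v x.
Proof. by move=> v0; rewrite grid_partialE//; apply: integral_ge0 => y _; exact: grid_kernel_ge0. Qed.

Lemma grid_partial_le n v x : (forall z, 0 <= v z)%R ->
  grid_partial n v x <= \int[j x]_(y in far B delta x) (v y)%:E.
Proof.
move=> v0; rewrite grid_partialE// [leRHS]integral_mkcond.
apply: ge0_le_integralW => y _; first exact: grid_kernel_ge0.
rewrite patchE /grid_kernel; case: ifPn => [/andP[/asboolP By /grid_far_mdist xy]|_].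
  by rewrite mem_set.
by case: ifP; rewrite ?lee_fin.
Qed.

Lemma measurable_grid_partial n v : measurable_fun setT v -> (forall z, 0 <= v z)%R ->
  measurable_fun setT (grid_partial n v).
Proof.
move=> mv v0; have -> : grid_partial n v =
    fun x => (fun l x => \int[j x]_y grid_kernel n l v y) (idx n x) x.
  by apply/funext => x; rewrite grid_partialE.
apply: (@measurable_grid_fun _ _ _ a adense n
  (fun l x => \int[j x]_y grid_kernel n l v y)) => l.
apply: measurable_fun_integral_kernel; first exact: measurable_kernel.
- by move=> y; exact: grid_kernel_ge0.
- exact: measurable_grid_kernel.
Qed.

(** The grid approximations need not increase with n, so Fatou's lemma gives one inequality, and the
    other holds because each of them is at most the integral. *)
Lemma integral_far_liminf v x : measurable_fun setT v -> (forall y, 0 <= v y)%R ->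
  \int[j x]_(y in far B delta x) (v y)%:E = limn_einf (fun n => grid_partial n v x).
Proof.
move=> mv v0; apply/eqP; rewrite eq_le; apply/andP; split; last first.
  by apply: limn_einf_le_near; near=> n; exact: grid_partial_le.
pose F n := grid_kernel n (idx n x) v.
apply: (@le_trans _ _ (\int[j x]_y limn_einf (F ^~ y))).
  rewrite integral_mkcond; apply: ge0_le_integralW => y _.
    by rewrite patchE; case: ifP => _; rewrite ?lee_fin.
  rewrite patchE; case: ifPn => [/set_mem[By xy]|_]; last first.
    by apply: limn_einf_ge_near; near=> n; exact: grid_kernel_ge0.
  apply: limn_einf_ge_near.
  apply: filterS (grid_far_eventually adense xy) => n nxy.
  by rewrite /F /grid_kernel asboolT// nxy.
have -> : (fun n => grid_partial n v x) = (fun n => \int[j x]_y F n y).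
  by apply/funext => n; rewrite grid_partialE.
apply: fatou => // n; first exact: measurable_grid_kernel.
by move=> y _; exact: grid_kernel_ge0.
Unshelve. all: by end_near.
Qed.

Lemma measurable_integral_far v : measurable_fun setT v -> (forall y, 0 <= v y)%R ->
  measurable_fun setT (fun x => \int[j x]_(y in far B delta x) (v y)%:E).
Proof.
move=> mv v0; have -> : (fun x => \int[j x]_(y in far B delta x) (v y)%:E) =
    (fun x => - limn_esup (\- (fun n => grid_partial n v x))).
  by apply/funext => x; rewrite integral_far_liminf.
apply: measurableT_comp => //.
apply: (measurable_fun_limn_esup (f := fun n x => - grid_partial n v x)) => n.
by apply: measurableT_comp => //; exact: measurable_grid_partial.
Qed.

(** Splitting x and y by classes expresses the integral by products of a function of x and a
    function of y, the only integrands for which symmetry of [j] is assumed. *)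
Lemma grid_double_sum n u v : measurable_fun setT u -> measurable_fun setT v ->
  (forall x, 0 <= u x)%R -> (forall x, 0 <= v x)%R ->
  \int[m]_(x in B) ((u x)%:E * grid_partial n v x) =
  \sum_(0 <= l <oo) \sum_(0 <= l' <oo) (if grid_far a delta n l l' then
    \int[m]_x ((grid_part n l u x)%:E * jump_op j (grid_part n l' v) x) else 0).
Proof.
move=> mu mv u0 v0.
pose T l l' x := if grid_far a delta n l l' then
  (grid_part n l u x)%:E * \int[j x]_y (grid_part n l' v y)%:E else 0.
have T0 l l' x : 0 <= T l l' x.
  rewrite /T; case: ifP => // _; apply: mule_ge0; first by rewrite lee_fin grid_part_ge0.
  by apply: integral_ge0 => y _; rewrite lee_fin grid_part_ge0.
have mT l l' : measurable_fun setT (T l l').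
  rewrite /T; case: (grid_far a delta n l l'); last exact: measurable_cst.
  apply: emeasurable_funM; first exact/measurable_EFinP/measurable_grid_part.
  apply: measurable_fun_integral_kernel; first exact: measurable_kernel.
  - by move=> y; rewrite lee_fin grid_part_ge0.
  - exact/measurable_EFinP/measurable_grid_part.
transitivity (\int[m]_x \sum_(0 <= l <oo) \sum_(0 <= l' <oo) T l l' x).
  rewrite integral_mkcond; apply: eq_integral => x _.
  rewrite (@nneseriesD1 _ _ (idx n x))//; last by move=> *; exact: nneseries_ge0.
  rewrite [X in _ + X]eseries0 ?adde0; last first.
    move=> k _ kn; apply: eseries0 => l' _ _; rewrite /T; case: ifP => // _.
    rewrite /grid_part indicE memNset ?mulr0 ?mul0e//.
    by move=> [_ /= h]; move: kn; rewrite -h eqxx.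
  rewrite patchE; case: ifPn => [/set_mem Bx|xB]; last first.
    rewrite eseries0// => l' _ _; rewrite /T; case: ifP => // _.
    by rewrite /grid_part indicE memNset ?mulr0 ?mul0e// => -[/mem_set]; rewrite (negPf xB).
  rewrite /grid_partial integral_nneseries//; last 2 first.
    - by move=> l'; exact: measurable_grid_summand.
    - by move=> l' y _; case: ifP => // _; rewrite lee_fin grid_part_ge0.
  rewrite -nneseriesZl; last first.
    by move=> l' _; apply: integral_ge0 => y _; case: ifP => // _; rewrite lee_fin grid_part_ge0.
  apply: eq_eseriesr => l' _; rewrite /T.
  case: (grid_far a delta n (idx n x) l'); last by rewrite integral0 mule0.
  by rewrite /grid_part indicE mem_set ?mulr1.
rewrite integral_nneseries//; last 2 first.
  - by move=> l; apply: ge0_emeasurable_sum => // l' x _ _; exact: T0.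
  - by move=> l x _; apply: nneseries_ge0 => l' _ _; exact: T0.
apply: eq_eseriesr => l _; rewrite integral_nneseries//.
apply: eq_eseriesr => l' _; rewrite /T.
have [ll|] := boolP (grid_far a delta n l l'); last by rewrite integral0.
apply: eq_integral => x _; rewrite /grid_part indicE.
have [/set_mem[_ /= xl]|_] := boolP (x \in _); last by rewrite mulr0 !mul0e.
congr (_ * _); rewrite /jump_op [RHS]integral_mkcond; apply: eq_integral => y _.
(* [jump_op] leaves out y = x. Nothing is lost: x lying in both classes would make the distance of a
   grid point to itself exceed delta, which is nonnegative. *)
rewrite patchE; case: ifPn => // /negP yx.
have -> : y = x by apply: contrapT => h; apply: yx; apply: mem_set.
rewrite indicE memNset ?mulr0// => -[_ /= xl'].
move: ll; rewrite /grid_far -xl -xl' mdistxx ltNge; move/negP; apply.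
by rewrite addr_ge0// mulr_ge0// invr_ge0.
Qed.

Lemma grid_sym n u v : measurable_fun setT u -> measurable_fun setT v ->
  (forall x, 0 <= u x)%R -> (forall x, 0 <= v x)%R ->
  \int[m]_(x in B) ((u x)%:E * grid_partial n v x) =
  \int[m]_(x in B) ((v x)%:E * grid_partial n u x).
Proof.
move=> mu mv u0 v0; rewrite (grid_double_sum n mu mv u0 v0) (grid_double_sum n mv mu v0 u0).
pose T l l' := if grid_far a delta n l l' then
  \int[m]_x ((grid_part n l u x)%:E * jump_op j (grid_part n l' v) x) else 0.
have T0 l l' : 0 <= T l l'.
  rewrite /T; case: ifP => // _; apply: integral_ge0 => x _.
  apply: mule_ge0; first by rewrite lee_fin grid_part_ge0.
  by apply: integral_ge0 => y _; rewrite lee_fin grid_part_ge0.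
rewrite [LHS](@nneseries_interchange _ T xpredT xpredT T0).
apply: eq_eseriesr => l _; apply: eq_eseriesr => l' _; rewrite /T.
rewrite grid_far_sym; case: (grid_far a delta n l l'); last exact: erefl.
rewrite j_sym; [|exact: measurable_grid_part|exact: measurable_grid_part|
  by move=> x; exact: grid_part_ge0|by move=> x; exact: grid_part_ge0].
by apply: eq_integral => x _; rewrite muleC.
Qed.

(** Fatou's lemma bounds the left side by the lower limit of the grid integrals; these are
    symmetric, and after the exchange each is at most the right side. Exchanging u and v then gives
    equality. *)
Lemma integral_far_sym_le u v : measurable_fun setT u -> measurable_fun setT v ->
  (forall x, 0 <= u x)%R -> (forall x, 0 <= v x)%R ->
  \int[m]_(x in B) ((u x)%:E * \int[j x]_(y in far B delta x) (v y)%:E) <=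
  \int[m]_(x in B) ((v x)%:E * \int[j x]_(y in far B delta x) (u y)%:E).
Proof.
move=> mu mv u0 v0.
have pt x : (u x)%:E * \int[j x]_(y in far B delta x) (v y)%:E =
    limn_einf (fun n => (u x)%:E * grid_partial n v x).
  have mf : measurable (far B delta x) by exact: measurable_far.
  have mvf : measurable_fun (far B delta x) (EFin \o v).
    by apply/measurable_EFinP; exact: measurable_funTS.
  rewrite -ge0_integralZl_EFin//; last by move=> y _; rewrite lee_fin.
  rewrite (integral_far_liminf (v := fun y => u x * v y)%R)//; last 2 first.
  - exact: measurable_funM.
  - by move=> y; rewrite mulr_ge0.
  congr limn_einf; apply/funext => n; rewrite !grid_partialE//; last first.
    by move=> y; rewrite mulr_ge0.
  rewrite -ge0_integralZl_EFin//; last 2 first.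
  - by move=> y _; exact: grid_kernel_ge0.
  - exact: measurable_grid_kernel.
  by apply: eq_integral => y _; rewrite /grid_kernel; case: ifP; rewrite ?mule0// EFinM.
rewrite (eq_integral (fun x => limn_einf (fun n => (u x)%:E * grid_partial n v x)));
  last by move=> x _; exact: pt.
apply: le_trans (fatou _ _ _ _) _ => //.
- move=> n; apply: emeasurable_funM.
    by apply/measurable_EFinP; exact: measurable_funTS.
  by apply: measurable_funTS; exact: measurable_grid_partial.
- by move=> n x _; rewrite mule_ge0// ?lee_fin// grid_partial_ge0.
apply: limn_einf_le_near; near=> n; rewrite grid_sym//.
apply: ge0_le_integralW => x _.
  by rewrite mule_ge0// ?lee_fin// grid_partial_ge0.
by apply: lee_wpmul2l; rewrite ?lee_fin//; exact: grid_partial_le.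
Unshelve. all: by end_near.
Qed.

Lemma integral_far_sym u v : measurable_fun setT u -> measurable_fun setT v ->
  (forall x, 0 <= u x)%R -> (forall x, 0 <= v x)%R ->
  \int[m]_(x in B) ((u x)%:E * \int[j x]_(y in far B delta x) (v y)%:E) =
  \int[m]_(x in B) ((v x)%:E * \int[j x]_(y in far B delta x) (u y)%:E).
Proof. by move=> *; apply/eqP; rewrite eq_le !integral_far_sym_le. Qed.

End jump_kernel_truncation.

Section jump_kernel_form.
Context (R : realType) d (M : borelMetricType R d).
Hypothesis sepM : exists2 A : set M, countable A & dense A.
Variables (m : {measure set M -> \bar R}) (j : R.-ker M ~> M).
Variables (B : set M) (delta : R).
Hypothesis mB : measurable B.
Hypothesis delta_ge0 : (0 <= delta)%R.
Hypothesis j_sym : forall u v : M -> R,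
  measurable_fun setT u -> measurable_fun setT v ->
  (forall x, (0 <= u x)%R) -> (forall x, (0 <= v x)%R) ->
  \int[m]_x ((u x)%:E * jump_op j v x) = \int[m]_x (jump_op j u x * (v x)%:E).
Variable N : set M.
Hypothesis mN : measurable N.
Hypothesis N0 : m N = 0.
Variable rate : R.
Hypothesis rate_bound_off : forall x, B x -> ~ N x -> j x (far B delta x) <= rate%:E.
Hypothesis rate_ge0 : (0 <= rate)%R.
Implicit Types (f u v : M -> R).

Let mfar x : measurable (far B delta x) := measurable_far delta mB x.

(* j need not be s-finite; cutting it down to B off N and to distances above delta
   gives a finite kernel, for which integrals of joint functions are measurable. *)
Definition cut_kernel x : {measure set M -> \bar R} :=
  if `[< B x /\ ~ N x >] then [the {measure set M -> \bar R} of mrestr (j x) (mfar x)]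
  else [the {measure set M -> \bar R} of mzero].

Lemma cut_kernelE x A : cut_kernel x A =
  if `[< B x /\ ~ N x >] then j x (A `&` far B delta x) else 0.
Proof. by rewrite /cut_kernel; case: ifP. Qed.

Lemma cut_kernel_on x A : B x -> ~ N x -> A `<=` far B delta x ->
  j x A = cut_kernel x A.
Proof. by move=> Bx Nx Af; rewrite cut_kernelE asboolT// setIidl. Qed.

(** The mass of A is the integral of its indicator over [far B delta x], and the grid has shown such
    integrals to be measurable in x. *)
Lemma measurable_cut_kernel A : measurable A -> measurable_fun setT (cut_kernel ^~ A).
Proof.
move=> mA; have [a adense] := dense_sequence sepM.
have -> : cut_kernel ^~ A = fun x => if x \in B `\` N then
    \int[j x]_(y in far B delta x) (\1_A y)%:E else 0.
  apply/funext => x; rewrite cut_kernelE; case: asboolP => h.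
    by rewrite mem_set// integral_indic.
  by rewrite memNset.
apply: measurable_fun_ifT.
- by apply: (measurable_fun_bool true); rewrite setTI preimage_mem_true; exact: measurableD.
- by apply: (measurable_integral_far j adense delta mB (v := \1_A)) => // y; rewrite indicE.
- exact: measurable_cst.
Qed.

HB.instance Definition _ := isKernel.Build _ _ _ _ R cut_kernel measurable_cut_kernel.

Lemma cut_kernel_uub : measure_fam_uub cut_kernel.
Proof.
exists (rate + 1)%R => x; rewrite cut_kernelE setTI; case: asboolP => [[Bx Nx]|_].
  by apply: le_lt_trans (rate_bound_off Bx Nx) _; rewrite lte_fin ltrDl.
by rewrite lte_fin ltr_wpDl.
Qed.

HB.instance Definition _ := Kernel_isFinite.Build _ _ _ _ R cut_kernel cut_kernel_uub.

Lemma measurable_cut_kernel_integral (G : M -> M -> R) : jointly_measurable G ->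
  (forall x y, 0 <= G x y)%R ->
  measurable_fun setT (fun x => \int[cut_kernel x]_y (G x y)%:E).
Proof.
move=> mG G0; apply: (measurable_fun_integral_finite_kernel
  (fun p : M * M => (G p.1 p.2)%:E) cut_kernel).
- by move=> p; rewrite lee_fin.
- exact/measurable_EFinP.
Qed.

Lemma cut_kernel_integral x (h : M -> \bar R) : B x -> ~ N x ->
  \int[cut_kernel x]_(y in far B delta x) h y = \int[j x]_(y in far B delta x) h y.
Proof.
by move=> Bx Nx; apply: eq_measure_integral => A mA Af; rewrite (cut_kernel_on Bx Nx).
Qed.

Lemma truncated_jump_energyE f : truncated_jump_energy m j B delta f =
  form_energy m B delta cut_kernel (fun _ _ => 1%R) f.
Proof.
congr (_ * _); apply: (ge0_eq_integral_negligible mN N0) => x Bx.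
- by apply: integral_ge0 => y _; rewrite lee_fin sqr_ge0.
- by apply: integral_ge0 => y _; rewrite mulr1 lee_fin sqr_ge0.
- move=> Nx; rewrite /jump_partial cut_kernel_integral//.
  by apply: eq_integral => y _; rewrite mulr1 -sqrrN opprB.
Qed.

Lemma truncated_jump_generatorE f x : B x -> ~ N x ->
  truncated_jump_generator j B delta f x =
  form_generator B delta cut_kernel (fun _ _ => 1%R) f x.
Proof.
move=> Bx Nx; rewrite /truncated_jump_generator /form_generator /Rintegral.
rewrite cut_kernel_integral//; congr fine.
by apply: eq_integral => y _; rewrite mulr1.
Qed.

Lemma cut_kernel_rate x : B x ->
  jump_partial B delta cut_kernel (fun _ _ => 1%R) (fun _ _ => 1%R) x <= rate%:E.
Proof.
move=> Bx; rewrite /jump_partial.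
rewrite (eq_integral (cst 1)) => [|y _]; last by rewrite mulr1.
rewrite integral_cst// mul1e cut_kernelE setIid; case: asboolP => [[_ Nx]|_].
  exact: rate_bound_off.
by rewrite lee_fin.
Qed.

Lemma cut_kernel_fin : m B < +oo ->
  jump_total m B delta cut_kernel (fun _ _ => 1%R) (fun _ _ => 1%R) < +oo.
Proof.
move=> By; apply: (@le_lt_trans _ _ (\int[m]_(x in B) (cst rate%:E) x)).
  apply: ge0_le_integralW => x Bx; last exact: cut_kernel_rate.
  by apply: integral_ge0 => y _; rewrite mulr1 lee_fin.
by rewrite integral_cst// lte_mul_pinfty// lee_fin.
Qed.

Lemma cut_kernel_sym u v : measurable_fun setT u -> measurable_fun setT v ->
  (forall x, 0 <= u x)%R -> (forall x, 0 <= v x)%R ->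
  jump_total m B delta cut_kernel (fun _ _ => 1%R) (fun x y => u x * v y)%R =
  jump_total m B delta cut_kernel (fun _ _ => 1%R) (fun x y => v x * u y)%R.
Proof.
have totalE (f g : M -> R) : measurable_fun setT f -> measurable_fun setT g ->
    (forall x, 0 <= f x)%R -> (forall x, 0 <= g x)%R ->
    jump_total m B delta cut_kernel (fun _ _ => 1%R) (fun x y => f x * g y)%R =
    \int[m]_(x in B) ((f x)%:E * \int[j x]_(y in far B delta x) (g y)%:E).
  move=> mf mg f0 g0; apply: (ge0_eq_integral_negligible mN N0) => x Bx.
  - by apply: integral_ge0 => y _; rewrite mulr1 lee_fin mulr_ge0.
  - by rewrite mule_ge0 ?lee_fin//; apply: integral_ge0 => y _; rewrite lee_fin.
  - move=> Nx; rewrite /jump_partial cut_kernel_integral// -ge0_integralZl_EFin//.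
    + by apply: eq_integral => y _; rewrite mulr1.
    + by move=> y _; rewrite lee_fin.
    + by apply/measurable_EFinP; exact: measurable_funTS.
move=> mu mv u0 v0; rewrite (totalE u v mu mv u0 v0) (totalE v u mv mu v0 u0); have [a adense] := dense_sequence sepM.
exact: (integral_far_sym adense).
Qed.

End jump_kernel_form.

Lemma half_lty (R : realType) (x : \bar R) : (2^-1)%:E * x < +oo -> x < +oo.
Proof. by case: x => [r| |]; rewrite ?ltry ?ltNyr// gt0_muley// lte_fin invr_gt0. Qed.

(** * Conductances as a symmetric density *)

Section symmetric_density.
Context (R : realType) d (M : borelMetricType R d).
Hypothesis sepM : exists2 A : set M, countable A & dense A.
Variables (m : {measure set M -> \bar R}) (B : set M) (delta : R) (c : M -> M -> R).
Hypothesis sfm : sigma_finite setT m.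
Hypothesis mB : measurable B.
Hypothesis c_ge0 : forall x y, (0 <= c x y)%R.
Hypothesis c_sym : forall x y, c x y = c y x.
Hypothesis mc : jointly_measurable c.
Implicit Types (f u v : M -> R).

Let total := jump_total m B delta (fun=> m) c.
Let energy := form_energy m B delta (fun=> m) c.

(** With both restrictions absorbed into the symmetric weight of [W], this is Tonelli's theorem. *)
Lemma density_sym u v : measurable_fun setT u -> measurable_fun setT v ->
  (forall x, 0 <= u x)%R -> (forall x, 0 <= v x)%R ->
  total (fun x y => u x * v y)%R = total (fun x y => v x * u y)%R.
Proof.
pose W (f g : M -> R) x y := (f x * g y * c x y *
  (\1_B x * (\1_B y * \1_[set p : M * M | (delta < mdist p.1 p.2)%R] (x, y))))%R.
have W0 (f g : M -> R) x y : (0 <= f x)%R -> (0 <= g y)%R -> (0 <= W f g x y)%R.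
  move=> f0 g0; apply: mulr_ge0; first by rewrite !mulr_ge0.
  by rewrite !indicE !mulr_ge0.
have mW (f g : M -> R) : measurable_fun setT f -> measurable_fun setT g ->
    jointly_measurable (W f g).
  move=> mf mg; apply: jointly_measurableM.
    apply: jointly_measurableM => //; apply: jointly_measurableM.
      exact: jointly_measurable_fst.
    exact: jointly_measurable_snd.
  apply: jointly_measurableM.
    by apply: jointly_measurable_fst; exact: measurable_indic.
  apply: jointly_measurableM.
    by apply: jointly_measurable_snd; exact: measurable_indic.
  apply: (measurable_indic (D := setT)); exact: measurable_mdist_gt.
have totalE (f g : M -> R) :
    total (fun x y => f x * g y)%R = \int[m]_x \int[m]_y (W f g x y)%:E.
  rewrite /total /jump_total integral_mkcond; apply: eq_integral => x _.
  rewrite patchE /jump_partial; case: ifPn => xB; last first.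
    rewrite integral0_eq// => y _.
    by rewrite /W indicE (negPf xB) mul0r mulr0.
  rewrite integral_mkcond; apply: eq_integral => y _; rewrite patchE /W !indicE xB mul1r.
  case: ifPn => [/set_mem[By xy]|yf]; first by rewrite !mem_set ?mulr1.
  have [/set_mem By|_] := boolP (y \in B); last by rewrite mul0r mulr0.
  by rewrite memNset ?mulr0// => xy; move/negP: yf; apply; apply: mem_set.
move=> mu mv u0 v0; rewrite !totalE (ge0_tonelli sfm (mW _ _ mu mv)); last first.
  by move=> x y; exact: W0.
apply: eq_integral => x _; apply: eq_integral => y _; congr EFin.
rewrite /W !indicE (c_sym y x) (mulrC (u y)) (mulrCA (y \in B)%:R); congr (_ * (_ * (_ * _)))%R.
congr ((_ : bool)%:R); apply/idP/idP => /set_mem h; apply: mem_set; move: h;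
  by rewrite /= metric_sym.
Qed.

Lemma truncated_conductance_energyE f :
  truncated_conductance_energy m c B delta f = energy f.
Proof.
congr (_ * _); apply: eq_integral => x _; apply: eq_integral => y _.
by rewrite c_sym -sqrrN opprB.
Qed.

(* At distance more than delta, one of the functions min (mdist _ p) (3 delta / 4)
   separates the two points by at least delta / 2. *)
Lemma density_fin (s : seq M) : (0 < delta)%R ->
  (forall x, B x -> exists2 p, p \in s & (mdist x p < delta / 4)%R) ->
  (forall p, p \in s -> energy (fun x => Num.min (mdist x p) (3 * delta / 4)%R) < +oo) ->
  total (fun _ _ => 1%R) < +oo.
Proof.
move=> delta0 net efin; pose F (p x : M) : R := Num.min (mdist x p) (3 * delta / 4)%R.
have mF p : measurable_fun setT (F p).
  by apply: (lipschitz_measurable (L := 1%R)); apply: lipschitz_with_min; exact: lipschitz_mdist.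
pose S (r : seq M) x y : R := (\sum_(p <- r) (F p x - F p y) ^+ 2)%R.
have S0 r x y : (0 <= S r x y)%R by apply: sumr_ge0 => p _; exact: sqr_ge0.
have Snil : S [::] = fun _ _ => 0%R.
  by apply/funext => x; apply/funext => y; rewrite /S big_nil.
have Scons p r : S (p :: r) = fun x y => ((F p x - F p y) ^+ 2 + S r x y)%R.
  by apply/funext => x; apply/funext => y; rewrite /S big_cons.
have mS r : jointly_measurable (S r).
  elim: r => [|p r IH]; first by rewrite Snil; exact: jointly_measurable_cst.
  by rewrite Scons; apply: jointly_measurableD => //; exact: jointly_measurable_sqrB.
have mmu := measurable_partial_integral sfm.
have fin r : {subset r <= s} -> total (S r) < +oo.
  elim: r => [|p r IH] rs.
    rewrite Snil /total /jump_total integral0_eq// => x _; apply: integral0_eq => y _.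
    by rewrite mul0r.
  rewrite Scons.
  rewrite /total jump_totalD//.
  - apply: lte_add_pinfty; last by apply: IH => q qr; apply: rs; rewrite in_cons qr orbT.
    have := efin p (rs p (mem_head _ _)); rewrite /energy /form_energy.
    exact: half_lty.
  - exact: jointly_measurable_sqrB.
  - by move=> x y; exact: sqr_ge0.
apply: (@le_lt_trans _ _ (((2 / delta) ^+ 2)%:E * total (S s))); last first.
  by rewrite lte_mul_pinfty// ?lee_fin ?sqr_ge0// fin.
rewrite /total -jump_totalZ//; last by exact: sqr_ge0.
apply: ge0_le_integralW => x Bx.
  by apply: integral_ge0 => y _; rewrite mul1r lee_fin.
apply: ge0_le_integralW => y [By xy]; first by rewrite mul1r lee_fin.
rewrite lee_fin ler_wpM2r//; have [p ps xp] := net x Bx.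
have pS : ((F p x - F p y) ^+ 2 <= S s x y)%R.
  rewrite /S (big_rem p)//= lerDl; apply: sumr_ge0 => q _; exact: sqr_ge0.
have Fx : (F p x <= delta / 4)%R by rewrite /F ge_min (ltW xp).
have Fy : F p y = (3 * delta / 4)%R.
  rewrite /F; apply: min_r; have := metric_triangle x p y; rewrite (metric_sym p y).
  move: xy xp => /=; lra.
have d2 : (delta / 2 <= F p y - F p x)%R by rewrite Fy; lra.
have : ((delta / 2) ^+ 2 <= (F p x - F p y) ^+ 2)%R.
  rewrite -[leRHS]sqrrN opprB ler_sqr ?nnegrE//; first by rewrite divr_ge0// ltW.
  by apply: le_trans d2; rewrite divr_ge0// ltW.
move=> /le_trans/(_ pS) h.
have e1 : ((2 / delta) ^+ 2 * (delta / 2) ^+ 2)%R = 1%R.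
  by rewrite -exprMn mulf_div (mulrC 2%R) divff ?expr1n// mulf_neq0// gt_eqF.
by rewrite -[leLHS]e1 ler_wpM2l// sqr_ge0.
Qed.

End symmetric_density.

(** * Lower bound for truncated forms *)

Section restriction.
Context d (T : measurableType d) (R : realType) (m : {measure set T -> \bar R}).
Variable D : set T.
Hypothesis mD : measurable D.

Lemma sqnorm_subset (f : T -> R) : sqnorm m D f <= sqnorm m setT f.
Proof.
rewrite {1}/sqnorm integral_mkcond; apply: ge0_le_integralW => x _.
  by rewrite patchE; case: ifP => _; rewrite ?lee_fin ?sqr_ge0.
by rewrite patchE; case: ifP => _; rewrite ?lee_fin ?sqr_ge0.
Qed.

Lemma L2on_zero_extension (f : T -> R) : measurable_fun setT f -> L2on m D f ->
  L2on m setT (fun x => f x * \1_D x)%R.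
Proof.
move=> mf [_ fy]; split; first by apply: measurable_funM => //; exact: measurable_indic.
apply: le_lt_trans fy; rewrite [leRHS]integral_mkcond; apply: ge0_le_integralW => x _.
  by rewrite lee_fin sqr_ge0.
by rewrite patchE indicE; case: ifP => _; rewrite ?mulr1// mulr0 expr0n.
Qed.

Lemma Rintegral_zero_extension (f g : T -> R) :
  (\int[m]_x (f x * (g x * \1_D x)))%R = (\int[m]_(x in D) (f x * g x))%R.
Proof.
rewrite [RHS]Rintegral_mkcond; apply: eq_Rintegral => x _.
by rewrite patchE indicE; case: ifP => _; rewrite ?mulr1// !mulr0.
Qed.

End restriction.

(** Last step of [truncated_liminf]: E1, E2, E3 are the energies of u, of f, and of f at level k; I3
    and I1 pair u with L f and w_k with L_k f, while I4 and I2 pair u and w_k with g. The errors add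
    up to 7 e / 16, less than the remaining e / 2. *)
Lemma perturbed_lower_bound (R : realType) (E1 E2 E3 I1 I2 I3 I4 e : R) :
  (E1 - e / 2 <= - 2 * I3 - E2 -> `|I3 - I4| <= e / 16 -> `|I1 - I2| <= e / 16 ->
  `|I4 - I2| < e / 16 -> `|E2 - E3| < e / 16 -> 0 < e ->
  E1 - e <= - 2 * I1 - E3)%R.
Proof.
rewrite !ltr_norml !ler_norml.
by move=> a /andP[? ?] /andP[? ?] /andP[? ?] /andP[? ?]; lra.
Qed.

Section truncated_lower_bound.
Context (R : realType) d (M : borelMetricType R d).
Variables (m : {measure set M -> \bar R}) (x0 : M).
Hypothesis Mmms : metric_measure_space m.
Hypothesis sfm : sigma_finite setT m.
Variables (r delta : R).
Hypothesis r_gt0 : (0 < r)%R.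
Hypothesis delta_gt0 : (0 < delta)%R.
Variables (c : nat -> M -> M -> R).
Hypothesis c_ge0 : forall k, (0 < k)%N -> forall x y, (0 <= c k x y)%R.
Hypothesis c_sym : forall k, (0 < k)%N -> forall x y, c k x y = c k y x.
Hypothesis mc : forall k, (0 < k)%N -> jointly_measurable (c k).
Variable kappa : M -> {measure set M -> \bar R}.
Hypothesis mkappa : forall G, jointly_measurable G -> (forall x y, 0 <= G x y)%R ->
  measurable_fun setT (fun x => \int[kappa x]_y (G x y)%:E).
Let B := ball x0 r.
Let one : M -> M -> R := fun _ _ => 1%R.
Hypothesis kappa_sym : forall f g : M -> R, measurable_fun setT f -> measurable_fun setT g ->
  (forall x, 0 <= f x)%R -> (forall x, 0 <= g x)%R ->
  jump_total m B delta kappa one (fun x y => f x * g y)%R =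
  jump_total m B delta kappa one (fun x y => g x * f y)%R.
Variable rate : R.
Hypothesis rate_ge0 : (0 <= rate)%R.
Hypothesis kappa_rate : forall x, B x -> jump_partial B delta kappa one one x <= rate%:E.
Hypothesis kappa_fin : jump_total m B delta kappa one one < +oo.

Implicit Types (f g h u : M -> R).

Let energy_k k f := form_energy m B delta (fun=> m) (c k) f.
Let energy f := form_energy m B delta kappa one f.
Let gen_k k f := form_generator B delta (fun=> m) (c k) f.
Let gen f := form_generator B delta kappa one f.

Hypothesis cvg_gen : forall f, Lip_c f ->
  sqnorm m B (gen_k k f) @[k --> \oo] --> sqnorm m B (gen f).
Hypothesis cvg_energy : forall f, bounded_continuous_on B f ->
  energy_k k f @[k --> \oo] --> energy f.

Let sepM := mms_separable Mmms.
Let mB : measurable B. Proof. exact: metric_ball_measurable. Qed.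
Let By : m B < +oo. Proof. exact: measure_ball_lty. Qed.
Let one_ge0 (x y : M) : (0 <= one x y)%R. Proof. exact: ler01. Qed.
Let m1 : jointly_measurable one. Proof. exact: jointly_measurable_cst. Qed.
Let mmu := measurable_partial_integral sfm.

(** The test functions of [density_fin] are bounded and continuous, so their energies at level k
    converge to finite limits and are finite from some k on. Finitely many of them suffice, by the
    net. *)
Lemma density_fin_near :
  \forall k \near \oo, jump_total m B delta (fun=> m) (c k) one < +oo.
Proof.
have d4 : (0 < delta / 4)%R by rewrite divr_gt0.
have [s net] := closure_ball_net x0 Mmms r_gt0 d4.
pose F (p x : M) : R := Num.min (mdist x p) (3 * delta / 4)%R.
have near_fin (t : seq M) : \forall k \near \oo, forall p : M, p \in t -> energy_k k (F p) < +oo.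
  elim: t => [|p t IH]; first by apply: nearW => k p.
  have lF : lipschitz_with 1 (F p) by apply: lipschitz_with_min; exact: lipschitz_mdist.
  have Fb x : (`|F p x| <= 3 * delta / 4)%R.
    have d34 : (0 <= 3 * delta / 4)%R by rewrite divr_ge0// mulr_ge0// ltW.
    by rewrite ger0_norm ?le_min ?mdist_ge0// ge_min lexx orbT.
  have bF : bounded_continuous_on B (F p).
    split; last by exists (3 * delta / 4)%R.
    by apply: continuous_subspaceT; exact: lipschitz_continuous lF.
  have efin : energy (F p) < +oo by exact: form_energy_bounded Fb.
  near=> k.
  have h1 : energy_k k (F p) < +oo by near: k; exact: (cvge_lt_near (cvg_energy bF)).
  have h2 : forall q : M, q \in t -> energy_k k (F q) < +oo by near: k; exact: IH.
  by move=> q; rewrite in_cons => /orP[/eqP ->//|]; exact: h2.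
near=> k; have k0 : (0 < k)%N by near: k; exact: nbhs_infty_gt.
have fs : forall p : M, p \in s -> energy_k k (F p) < +oo by near: k; exact: near_fin.
exact: (density_fin sepM sfm mB (c_ge0 k0) (mc k0) delta_gt0 net fs).
Unshelve. all: by end_near.
Qed.

Let good k := (0 < k)%N /\ jump_total m B delta (fun=> m) (c k) one < +oo.

Let near_good : \forall k \near \oo, good k.
Proof.
near=> k; split; near: k; [exact: nbhs_infty_gt|exact: density_fin_near].
Unshelve. all: by end_near.
Qed.

Let energy_fin f : Lip_c f -> energy f \is a fin_num.
Proof. by move=> /(Lip_c_bounded x0)[b b0 fb]; exact: form_energy_fin fb. Qed.

Let Lip_c_bc f : Lip_c f -> bounded_continuous_on B f.
Proof.
move=> cf; have [L L0 lf] := Lip_c_lipschitz cf; have [b b0 fb] := Lip_c_bounded x0 cf.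
split; last by exists b.
by apply: continuous_subspaceT; exact: lipschitz_continuous lf.
Qed.

Let cvg_fine_energy f : Lip_c f -> fine (energy_k k f) @[k --> \oo] --> fine (energy f).
Proof.
move=> cf; apply: (@fine_cvg _ _ _ _ (fun k => energy_k k f)).
by rewrite fineK; [exact: cvg_energy (Lip_c_bc cf)|exact: energy_fin].
Qed.

(** Convergence of energies is used for f - g and f + g. At level k polarization rests on the finite
    mass of far pairs, hence the restriction to large k. *)
Lemma cvg_pairing f g : Lip_c f -> Lip_c g ->
  (\int[m]_(x in B) (g x * gen_k k f x))%R @[k --> \oo] -->
  (\int[m]_(x in B) (g x * gen f x))%R.
Proof.
move=> cf cg.
have [b1 _ fb] := Lip_c_bounded x0 cf; have [b2 _ gb] := Lip_c_bounded x0 cg.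
have fb' x : (`|f x| <= Num.max b1 b2)%R by rewrite le_max fb.
have gb' x : (`|g x| <= Num.max b1 b2)%R by rewrite le_max gb orbT.
have mf := Lip_c_measurable cf; have mg := Lip_c_measurable cg.
have cfBg : Lip_c (fun x => f x - g x)%R by exact: (Lip_cB x0 Mmms cf cg).
have cfDg : Lip_c (fun x => f x + g x)%R by exact: (Lip_cD x0 Mmms cf cg).
have [_ E] := form_pairing sepM mB one_ge0 m1 mkappa kappa_sym kappa_fin mf fb' mg gb'.
have -> : (\int[m]_(x in B) (g x * gen f x))%R = (4^-1 *
  (fine (energy (fun x => f x - g x)) - fine (energy (fun x => f x + g x))))%R by exact: E.
have cv : (4^-1 * (fine (energy_k k (fun x => f x - g x)) -
    fine (energy_k k (fun x => f x + g x))))%R @[k --> \oo] --> (4^-1 *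
  (fine (energy (fun x => f x - g x)) - fine (energy (fun x => f x + g x))))%R.
  apply: cvgM; first exact: cvg_cst.
  exact: cvgB (cvg_fine_energy cfBg) (cvg_fine_energy cfDg).
apply: cvg_trans cv; apply: near_eq_cvg; apply: filterS near_good => k [k0 kfin].
have [_ ->//] := form_pairing sepM mB (c_ge0 k0) (mc k0) mmu
  (density_sym sepM delta sfm mB (c_ge0 k0) (c_sym k0) (mc k0)) kfin mf fb' mg gb'.
Qed.

Let gen_L2on f : Lip_c f -> L2on m B (gen f).
Proof.
move=> cf; have [b _ fb] := Lip_c_bounded x0 cf; have mf := Lip_c_measurable cf.
exact: (form_generator_L2on sepM mB one_ge0 m1 mkappa kappa_rate By mf fb).
Qed.

Let gen_k_L2on f : Lip_c f -> \forall k \near \oo, L2on m B (gen_k k f).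
Proof.
move=> cf; have mf := Lip_c_measurable cf; near=> k.
have k0 : (0 < k)%N by near: k; exact: nbhs_infty_gt.
split.
  apply: measurable_funTS.
  exact: (measurable_form_generator sepM delta mB (c_ge0 k0) (mc k0) mmu mf).
near: k; apply: (cvge_lt_near (cvg_gen cf)); exact: (gen_L2on cf).2.
Unshelve. all: by end_near.
Qed.

(** The expanded square of L_k f - g has convergent terms, and the limit is the squared distance of
    L f and g, strictly below e. *)
Lemma generator_approx f (e : R) : Lip_c f -> (0 < e)%R ->
  exists g, [/\ Lip_c g, (fine (sqnorm m B (fun x => gen f x - g x)) < e)%R &
    \forall k \near \oo, L2on m B (gen_k k f) /\
      (fine (sqnorm m B (fun x => gen_k k f x - g x)) < e)%R].
Proof.
move=> cf e0; have mf := Lip_c_measurable cf; have Lg := gen_L2on cf.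
have mg : measurable_fun setT (gen f).
  exact: (measurable_form_generator sepM delta mB one_ge0 m1 mkappa mf).
have [g cg gfar] := Lip_c_dense_L2 x0 Mmms (L2on_zero_extension mB mg Lg) e0.
have LgB : L2on m B g.
  exact: (L2onS mB measurableT (@subsetT _ _) (Lip_c_L2on x0 Mmms cg)).
have Lgg : L2on m B (fun x => gen f x - g x)%R by exact: L2onB.
have close : (fine (sqnorm m B (fun x => gen f x - g x)) < e)%R.
  rewrite -lte_fin fineK; last exact: L2on_fin_num.
  apply: le_lt_trans gfar; apply: le_trans (sqnorm_subset _ B _).
  apply: ge0_le_integralW => x Bx; first by rewrite lee_fin sqr_ge0.
  by rewrite indicE mem_set ?mulr1.
exists g; split => //.
pose S k := (fine (sqnorm m B (gen_k k f)) - 2 * (\int[m]_(x in B) (g x * gen_k k f x)) +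
  fine (sqnorm m B g))%R.
have cvS : S k @[k --> \oo] --> (fine (sqnorm m B (gen f)) -
    2 * (\int[m]_(x in B) (g x * gen f x)) + fine (sqnorm m B g))%R.
  apply: cvgD; last exact: cvg_cst.
  apply: cvgB; last by apply: cvgM; [exact: cvg_cst|exact: cvg_pairing].
  apply: (@fine_cvg _ _ _ _ (fun k => sqnorm m B (gen_k k f))).
  by rewrite fineK; [exact: cvg_gen|exact: L2on_fin_num Lg].
have comm (h : M -> R) : (\int[m]_(x in B) (g x * h x) = \int[m]_(x in B) (h x * g x))%R.
  by apply: eq_Rintegral => x _; rewrite mulrC.
rewrite comm -(fine_sqnormB mB Lg LgB) in cvS.
near=> k; have Lk : L2on m B (gen_k k f) by near: k; exact: gen_k_L2on.
split => //; rewrite (fine_sqnormB mB Lk LgB) -comm -/(S k).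
by near: k; exact: (cvgr_lt _ cvS).
Unshelve. all: by end_near.
Qed.

Lemma truncated_liminf (w : nat -> M -> R) u (bnd e : R) :
  (forall k, (0 < k)%N -> L2on m setT (w k)) ->
  (forall k, (0 < k)%N -> (fine (sqnorm m setT (w k)) <= bnd)%R) ->
  L2on m setT u ->
  (forall h, L2on m setT h ->
    (\int[m]_x (w k x * h x))%R @[k --> \oo] --> (\int[m]_x (u x * h x))%R) ->
  (0 < e)%R ->
  \forall k \near \oo, (fine (energy u) - e)%:E <= energy_k k (w k).
Proof.
move=> Lw wb Lu wu e0.
have LB (h : M -> R) : L2on m setT h -> L2on m B h.
  by apply: L2onS => //; exact: subsetT.
have e2 : (0 < e / 2)%R by rewrite divr_gt0.
have [eta eta0 approx] := form_energy_approx sepM mB one_ge0 m1 mkappa kappa_sym kappa_fin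
  rate_ge0 kappa_rate By Lu.1 (LB _ Lu) e2.
have [f cf fu] := Lip_c_dense_L2 x0 Mmms Lu eta0.
have [b _ fb] := Lip_c_bounded x0 cf; have mf := Lip_c_measurable cf.
have Lf := LB _ (Lip_c_L2on x0 Mmms cf).
have {approx} : (fine (energy u) - e / 2 <=
    - 2 * (\int[m]_(x in B) (u x * gen f x)) - fine (energy f))%R.
  apply: (approx f b mf fb); rewrite -lee_fin fineK.
    exact: le_trans (sqnorm_subset _ _ _) (ltW fu).
  by apply: L2on_fin_num; apply: L2onB => //; exact: LB.
pose bnd' := Num.max bnd (fine (sqnorm m setT u)).
have bnd0 : (0 <= bnd')%R by rewrite le_max sqnorm_fine_ge0 orbT.
have leB (h : M -> R) : L2on m setT h -> (fine (sqnorm m setT h) <= bnd')%R ->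
    (fine (sqnorm m B h) <= bnd')%R.
  move=> Lh; apply: le_trans; apply: fine_le; last exact: sqnorm_subset.
    exact: L2on_fin_num (LB _ Lh).
  exact: L2on_fin_num Lh.
(* With this weight Young's inequality costs e / 16 for a function of squared norm at most [bnd'],
   and e / 16 for a generator within s e / 16 of g. *)
pose s := (e / (16 * (bnd' + 1)))%R.
have s0 : (0 < s)%R by rewrite divr_gt0// mulr_gt0// ltr_wpDl.
have sb : (s * bnd' <= e / 16)%R.
  have : (s * (16 * (bnd' + 1)) = e)%R by rewrite /s mulfVK// gt_eqF// mulr_gt0// ltr_wpDl.
  by move: s0; lra.
have se : (0 < s * (e / 16))%R by rewrite mulr_gt0// divr_gt0.
have [g [cg Lgg gk]] := generator_approx cf se.
have small (h G : M -> R) : L2on m setT h -> (fine (sqnorm m setT h) <= bnd')%R ->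
    L2on m B G -> (fine (sqnorm m B (fun x => G x - g x)) < s * (e / 16))%R ->
    (`|\int[m]_(x in B) (h x * G x) - \int[m]_(x in B) (h x * g x)| <= e / 16)%R.
  move=> Lh hb LG Gg.
  have LgB := LB _ (Lip_c_L2on x0 Mmms cg).
  have LGg : L2on m B (fun x => G x - g x)%R by exact: L2onB.
  rewrite -RintegralB//; [|exact: (L2onM mB (LB _ Lh))|exact: (L2onM mB (LB _ Lh))].
  under eq_Rintegral do rewrite -mulrBr.
  apply: le_trans (le_Rintegral_mul mB (LB _ Lh) LGg s0) _.
  have h1 : (s * fine (sqnorm m B h) <= e / 16)%R.
    by apply: le_trans sb; apply: ler_wpM2l; [exact: ltW|exact: leB].
  have h2 : (s^-1 * fine (sqnorm m B (fun x => G x - g x)) <= e / 16)%R.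
    by rewrite mulrC ler_pdivrMr// mulrC ltW.
  by move: h1 h2; lra.
(* Weak convergence is tested on M, so g is first multiplied by the indicator of B. *)
have wg : (\int[m]_(x in B) (w k x * g x))%R @[k --> \oo] --> (\int[m]_(x in B) (u x * g x))%R.
  have mg := Lip_c_measurable cg.
  have := wu _ (L2on_zero_extension mB mg (LB _ (Lip_c_L2on x0 Mmms cg))).
  rewrite Rintegral_zero_extension; under eq_fun do rewrite Rintegral_zero_extension.
  by [].
have ub : (fine (sqnorm m setT u) <= bnd')%R by rewrite le_max lexx orbT.
have e16 : (0 < e / 16)%R by rewrite divr_gt0.
have hu := small _ _ Lu ub (gen_L2on cf) Lgg.
move/cvgrPdist_lt: wg => /(_ _ e16) ng.
have /cvgrPdist_lt/(_ _ e16) nE := cvg_fine_energy cf.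
move=> approx; near=> k.
have k0 : (0 < k)%N by near: k; exact: nbhs_infty_gt.
have [_ kfin] : good k by near: k; exact: near_good.
have [Lk Gk] : L2on m B (gen_k k f) /\
   (fine (sqnorm m B (fun x => gen_k k f x - g x)) < s * (e / 16))%R by near: k; exact: gk.
have wkb : (fine (sqnorm m setT (w k)) <= bnd')%R by rewrite le_max wb.
have hw := small _ _ (Lw k k0) wkb Lk Gk.
have hg : (`|\int[m]_(x in B) (u x * g x) - \int[m]_(x in B) (w k x * g x)| < e / 16)%R.
  by near: k; exact: ng.
have hE : (`|fine (energy f) - fine (energy_k k f)| < e / 16)%R.
  by near: k; exact: nE.
have lb := form_energy_lower_bound_L2 sepM mB (c_ge0 k0) (mc k0) mmu
  (density_sym sepM delta sfm mB (c_ge0 k0) (c_sym k0) (mc k0)) kfin mf fb Lk (Lw k k0).1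
  (LB _ (Lw k k0)).
apply: le_trans lb; rewrite lee_fin -/(gen_k k f) -/(energy_k k f).
exact: perturbed_lower_bound approx hu hw hg hE e0.
Unshelve. all: by end_near.
Qed.

End truncated_lower_bound.

(** * Jump rates and removal of the truncation *)

Section jump_rates.
Context (R : realType) d (M : borelMetricType R d).
Variables (m : {measure set M -> \bar R}) (x0 : M) (j : R.-ker M ~> M) (N : set M).
Hypothesis Mmms : metric_measure_space m.
Hypothesis A2 : assumption_A2 m j N.

Lemma sigma_finite_balls : sigma_finite setT m.
Proof.
exists (fun n : nat => ball x0 n%:R) => [|n]; last first.
  by split; [exact: metric_ball_measurable|exact: measure_ball_lty].
apply/esym; rewrite -subTset => x _; exists (Num.truncn (mdist x0 x)).+1 => //.
by rewrite in_ballE truncnS_gt.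
Qed.

(** Chebyshev's inequality: on far pairs the integrand of the last part of [assumption_A2] is at
    least q^2. *)
Lemma jump_rate (i : nat) (delta : R) : (0 < delta)%R ->
  exists2 rate : R, (0 <= rate)%R & forall x, ball x0 i%:R x -> ~ N x ->
    j x (far (ball x0 i%:R) delta x) <= rate%:E.
Proof.
(* The successor gives a positive radius also for i = 0. *)
move=> delta0; pose K := closure (ball x0 i.+1%:R).
have cK : compact K by apply: (mms_compact Mmms).
have [_ _ /(_ K cK)] := A2; set S := ereal_sup _ => Sy.
pose q := Num.min delta 1%R; have q0 : (0 < q)%R by rewrite lt_min delta0 ltr01.
pose a := fine S; exists (Num.max 0 (a / q ^+ 2))%R; first by rewrite le_max lexx.
move=> x xi Nx.
have xK : K x.
  apply: subset_closure; move: xi; rewrite !in_ballE => /lt_le_trans; apply.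
  by rewrite ler_nat.
have le1 : \int[j x]_y ((Num.min (mdist x y) 1) ^+ 2)%:E <= S.
  by apply: ereal_sup_ubound; exists x.
have le2 : (q ^+ 2)%:E * j x (far (ball x0 i%:R) delta x) <=
    \int[j x]_y ((Num.min (mdist x y) 1) ^+ 2)%:E.
  have mf : measurable (far (ball x0 i%:R) delta x).
    by apply: measurable_far; exact: metric_ball_measurable.
  rewrite -integral_cst// integral_mkcond; apply: ge0_le_integralW => y _.
    by rewrite patchE; case: ifP => _; rewrite ?lee_fin ?sqr_ge0.
  rewrite patchE; case: ifPn => [/set_mem[_ /= xy]|_]; last by rewrite lee_fin sqr_ge0.
  rewrite lee_fin ler_sqr ?nnegrE//; last 2 first.
  - exact: ltW.
  - by rewrite le_min mdist_ge0 ler01.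
  by rewrite /q le_min !ge_min (ltW xy) lexx !orbT.
have Sfin : S \is a fin_num.
  rewrite ge0_fin_numE//; apply: le_trans le1.
  by apply: integral_ge0 => y _; rewrite lee_fin sqr_ge0.
have := le_trans le2 le1; rewrite -(fineK Sfin) -/a muleC -lee_pdivlMr ?exprn_gt0//.
move=> h; apply: le_trans h _.
by rewrite -EFinM lee_fin le_max lexx orbT.
Qed.

End jump_rates.

Section exhaustion.
Context (R : realType) d (M : borelMetricType R d).
Variables (m : {measure set M -> \bar R}) (x0 : M) (j : R.-ker M ~> M) (N : set M).
Hypothesis sepM : exists2 A : set M, countable A & dense A.
Hypothesis mN : measurable N.
Hypothesis N0 : m N = 0.
Hypothesis rates : forall (i : nat) (delta : R), (0 < delta)%R ->
  exists2 rate : R, (0 <= rate)%R & forall x, ball x0 i%:R x -> ~ N x ->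
    j x (far (ball x0 i%:R) delta x) <= rate%:E.

(** Fatou's lemma is used twice as radii tend to infinity and distances to 0: in y for fixed x, and
    then in x. The second use is for integrals against cut kernels, which are measurable in x and
    agree with those against [j] off N. *)
Lemma jump_integral_exhaustion (i0 : nat) (delta0 : R) (u : M -> R) (l : \bar R) :
  measurable_fun setT u -> (0 < delta0)%R ->
  (forall (i : nat) (delta : R), (i0 <= i)%N -> (0 < delta < delta0)%R ->
    truncated_jump_energy m j (ball x0 i%:R) delta u <= l) ->
  (2^-1)%:E * jump_integral m j u <= l.
Proof.
move=> mu d0 tl.
(* Dividing by at least 2 keeps the distance strictly below [delta0]. *)
pose idx n := (n + i0)%N; pose del n := (delta0 / n.+2%:R)%R.
have del_gt0 n : (0 < del n)%R by rewrite divr_gt0.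
have del_lt n : (0 < del n < delta0)%R.
  by rewrite del_gt0 /= ltr_pdivrMr// ltr_pMr// ltr1n.
pose B n := ball x0 (idx n)%:R.
have mB n : measurable (B n) by exact: metric_ball_measurable.
pose g x y : \bar R := ((u x - u y) ^+ 2)%:E.
have g0 x y : 0 <= g x y by rewrite lee_fin sqr_ge0.
pose G n x y : \bar R := if `[< B n x /\ far (B n) (del n) x y >] then g x y else 0.
have G0 n x y : 0 <= G n x y by rewrite /G; case: ifP.
have mg x : measurable_fun setT (g x).
  apply/measurable_EFinP; apply: measurable_funX.
  by apply: measurable_funB => //; exact: measurable_cst.
have mG n x : measurable_fun setT (G n x).
  have -> : G n x = if `[< B n x >] then (g x \_ (far (B n) (del n) x)) else cst 0.
    apply/funext => y; rewrite /G; case: (asboolP (B n x)) => Bx.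
      rewrite patchE; case: (asboolP (B n x /\ _)) => [[_ h]|h].
        by rewrite mem_set.
      by rewrite memNset// => h'; apply: h.
    by case: (asboolP (B n x /\ _)) => // -[].
  case: ifP => _; last exact: measurable_cst.
  apply/(measurable_restrictT _ _).1; first exact: measurable_far.
  exact: measurable_funTS.
pose F n x := \int[j x]_y G n x y.
have F0 n x : 0 <= F n x by apply: integral_ge0.
have inner x : \int[j x]_(y in [set~ x]) g x y <= limn_einf (F ^~ x).
  apply: (@le_trans _ _ (\int[j x]_y limn_einf (fun n => G n x y))); last first.
    exact: fatou.
  rewrite integral_mkcond; apply: ge0_le_integralW => y _.
    by rewrite patchE; case: ifP.
  rewrite patchE; case: ifPn => [/set_mem yx|_]; last first.
    by apply: limn_einf_ge_near; near=> n; exact: G0.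
  have xy0 : (0 < mdist x y)%R.
    rewrite lt_neqAle mdist_ge0 andbT eq_sym; apply/eqP => /mdist_positivity xy.
    exact: yx (esym xy).
  apply: limn_einf_ge_near; near=> n; rewrite /G asboolT//.
  have in_B (z : M) : (Num.truncn (mdist x0 z) < n)%N -> B n z.
    rewrite /B in_ballE => zn; apply: lt_le_trans (truncnS_gt _) _.
    by rewrite ler_nat (leq_trans zn)// leq_addr.
  split; [|split].
  - by apply: in_B; near: n; exact: nbhs_infty_gt.
  - by apply: in_B; near: n; exact: nbhs_infty_gt.
  - rewrite /= /del ltr_pdivrMr// -ltr_pdivrMl//.
    apply: lt_le_trans (truncnS_gt _) _; rewrite ler_nat ltnW// ltnS.
    by near: n; exact: nbhs_infty_ge.
have FE n x : ~ N x -> F n x =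
   ((jump_partial (B n) (del n) (cut_kernel j (del n) (mB n) N) (fun _ _ => 1%R)
      (fun x y => (u x - u y) ^+ 2)%R) \_ (B n)) x.
  move=> Nx; rewrite patchE; case: ifPn => [/set_mem Bx|Bx]; last first.
    apply: integral0_eq => y _; rewrite /G.
    by case: asboolP => // -[/mem_set]; rewrite (negPf Bx).
  rewrite /jump_partial (cut_kernel_integral _ _ _ _ Bx Nx) [RHS]integral_mkcond.
  apply: eq_integral => y _; rewrite patchE /G; case: asboolP => [[_ h]|h].
    by rewrite mem_set// mulr1.
  by rewrite memNset// => h'; apply: h.
pose kap n := cut_kernel j (del n) (mB n) N.
pose F' n := jump_partial (B n) (del n) (kap n) (fun _ _ => 1%R)
  (fun x y => (u x - u y) ^+ 2)%R \_ (B n).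
have F'0 n x : 0 <= F' n x.
  rewrite /F' patchE; case: ifP => // _; apply: integral_ge0 => y _.
  by rewrite mulr1 lee_fin sqr_ge0.
have mF n : measurable_fun setT (F' n).
  apply/(measurable_restrictT _ _).1; first exact: mB.
  apply: measurable_funTS; have [rate r0 hr] := rates (idx n) (del_gt0 n).
  apply: measurable_jump_partial => //.
  - exact: jointly_measurable_cst.
  - exact: (@measurable_cut_kernel_integral _ _ _ sepM j _ _ (mB n) N mN rate hr r0).
  - exact: jointly_measurable_sqrB.
have intF n : \int[m]_x F' n x <= 2%:E * l.
  rewrite /F' -integral_mkcond.
  have := tl (idx n) (del n) (leq_addl _ _) (del_lt n).
  rewrite (truncated_jump_energyE _ _ (mB n) mN N0) /form_energy lee_pdivrMl//.
rewrite lee_pdivrMl//; apply: (@le_trans _ _ (\int[m]_x limn_einf (F' ^~ x))).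
  apply: (ge0_le_integral_negligible mN N0) => x _.
  - by apply: integral_ge0 => y _; exact: g0.
  - by apply: limn_einf_ge_near; near=> n; exact: F'0.
  - move=> Nx; apply: le_trans (inner x) _.
    rewrite le_eqVlt; apply/orP; left; apply/eqP; congr limn_einf.
    by apply/funext => n; rewrite FE.
apply: le_trans (fatou _ _ _ _) _ => //.
by apply: limn_einf_le_near; near=> n; exact: intF.
Unshelve. all: by end_near.
Qed.

End exhaustion.

(** * Mosco convergence *)

(** The index s k tends to infinity so slowly that the threshold beyond which [P (s k)] holds has
    already been passed at k. *)
Lemma diagonal_extraction (P : nat -> nat -> Prop) :
  (forall n, \forall k \near \oo, P n k) -> exists s : nat -> nat,
  (forall n, \forall k \near \oo, (n <= s k)%N) /\ \forall k \near \oo, P (s k) k.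
Proof.
move=> nearP.
have [K hK] : {K : nat -> nat & forall n k, (K n <= k)%N -> P n k}.
  apply: (@choice _ _ (fun n K => forall k, (K <= k)%N -> P n k)) => n.
  by have [K _ hK] := nearP n; exists K.
(* The first index whose threshold k has not reached, or k if there is none; its predecessor is
   therefore a valid choice, once [q k] is positive. *)
pose q k := find (fun l => (k < K l)%N) (iota 0 k).
have q_gt n k : (n < k)%N -> (forall l, (l <= n)%N -> (K l <= k)%N) -> (n < q k)%N.
  move=> nk hl; rewrite ltnNge; apply/negP => qn.
  have qk : (q k < size (iota 0 k))%N by rewrite size_iota (leq_ltn_trans qn).
  have hs : has (fun l => (k < K l)%N) (iota 0 k) by rewrite has_find.
  have := nth_find 0%N hs; rewrite nth_iota -/(q k); last first.
    by rewrite size_iota in qk.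
  by rewrite add0n ltnNge hl.
exists (fun k => (q k).-1); split.
  move=> n; exists (maxn n.+1 (\max_(l < n.+1) K l)) => // k /=.
  rewrite geq_max => /andP[nk hk]; have : (n < q k)%N.
    apply: q_gt => // l ln; apply: leq_trans hk.
    by have := @leq_bigmax _ (fun l : 'I_n.+1 => K l) (Ordinal (ln : (l < n.+1)%N)).
  by case: (q k).
exists (maxn 1 (K 0%N)) => // k /=; rewrite geq_max => /andP[k0 Kk].
have q0 : (0 < q k)%N by apply: q_gt => // l; rewrite leqn0 => /eqP ->.
apply: hK; have sq : ((q k).-1 < q k)%N by rewrite prednK.
have qk : (q k <= k)%N by rewrite -[leqRHS](size_iota 0 k) find_size.
have := before_find 0%N sq; rewrite nth_iota; last exact: leq_trans sq qk.
by rewrite add0n ltnNge => /negbFE.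
Qed.

Section double_integrals.
Context (R : realType) d (M : borelMetricType R d).
Variable m : {measure set M -> \bar R}.
Hypothesis sfm : sigma_finite setT m.
Implicit Types G H T : M -> M -> R.

Definition double_integral G := \int[m]_z \int[m]_w (G z w)%:E.

Lemma double_integral_le G H : (forall z w, 0 <= G z w)%R ->
  (forall z w, G z w <= H z w)%R -> double_integral G <= double_integral H.
Proof.
move=> G0 GH; apply: ge0_le_integralW => z _.
  by apply: integral_ge0 => w _; rewrite lee_fin.
by apply: ge0_le_integralW => w _; rewrite lee_fin.
Qed.

Lemma double_integralD G H : jointly_measurable G -> jointly_measurable H ->
  (forall z w, 0 <= G z w)%R -> (forall z w, 0 <= H z w)%R ->
  double_integral (fun z w => G z w + H z w)%R = double_integral G + double_integral H.
Proof.
move=> mG mH G0 H0; rewrite /double_integral -ge0_integralD//.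
- apply: eq_integral => z _; rewrite -ge0_integralD//.
  + by move=> w _; rewrite lee_fin.
  + by apply/measurable_EFinP; exact: measurable_section.
  + by move=> w _; rewrite lee_fin.
  + by apply/measurable_EFinP; exact: measurable_section.
- by move=> z _; apply: integral_ge0 => w _; rewrite lee_fin.
- exact: measurable_partial_integral.
- by move=> z _; apply: integral_ge0 => w _; rewrite lee_fin.
- exact: measurable_partial_integral.
Qed.

Lemma double_integralZ (a : R) G : jointly_measurable G -> (forall z w, 0 <= G z w)%R ->
  (0 <= a)%R -> double_integral (fun z w => a * G z w)%R = a%:E * double_integral G.
Proof.
move=> mG G0 a0; rewrite /double_integral -ge0_integralZl_EFin//.
- apply: eq_integral => z _; rewrite -ge0_integralZl_EFin//.
  + by move=> w _; rewrite lee_fin.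
  + by apply/measurable_EFinP; exact: measurable_section.
- by move=> z _; apply: integral_ge0 => w _; rewrite lee_fin.
- exact: measurable_partial_integral.
Qed.

Lemma double_integral_restrict (D : set M) (F : M -> set M) T G :
  (forall z w, 0 <= T z w)%R -> (forall z w, D z -> F z w -> T z w <= G z w)%R ->
  (forall z w, ~ (D z /\ F z w) -> T z w = 0%R) ->
  double_integral T <= \int[m]_(z in D) \int[m]_(w in F z) (G z w)%:E.
Proof.
move=> T0 TG Tz; rewrite /double_integral [leRHS]integral_mkcond.
apply: ge0_le_integralW => z _; first by apply: integral_ge0 => w _; rewrite lee_fin.
rewrite patchE; case: ifPn => [/set_mem Dz|/negP zD]; last first.
  rewrite integral0_eq// => w _; rewrite Tz// => -[Dz _].
  by apply: zD; apply: mem_set.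
rewrite [leRHS]integral_mkcond; apply: ge0_le_integralW => w _; first by rewrite lee_fin.
rewrite patchE; case: ifPn => [/set_mem Fw|/negP wF]; first by rewrite lee_fin; exact: TG.
by rewrite Tz// => -[_ Fw]; apply: wF; apply: mem_set.
Qed.

End double_integrals.

Section mosco.
Context (R : realType) (d : measure_display) (M : borelMetricType R d).
Variables (m : {measure set M -> \bar R}) (x0 : M).
Variables (V : nat -> set M) (E : nat -> rel M) (U : nat -> M -> set M).
Variables (C : nat -> M -> M -> R) (j : R.-ker M ~> M) (N : set M).
Hypothesis Mmms : metric_measure_space m.
Hypothesis VEU : approximating_graphs m V E U.
Hypothesis C_sym : forall k, (0 < k)%N -> forall x y, V k x -> V k y -> C k x y = C k y x.
Hypothesis C_ge0 : forall k, (0 < k)%N -> forall x y, V k x -> V k y -> (0 <= C k x y)%R.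
Hypothesis mN : measurable N.
Hypothesis N0 : m N = 0.
Hypothesis j_sym : forall u v : M -> R,
  measurable_fun setT u -> measurable_fun setT v ->
  (forall x, (0 <= u x)%R) -> (forall x, (0 <= v x)%R) ->
  \int[m]_x ((u x)%:E * jump_op j v x) = \int[m]_x (jump_op j u x * (v x)%:E).
Hypothesis rates : forall (i : nat) (delta : R), (0 < delta)%R ->
  exists2 rate : R, (0 <= rate)%R & forall x, ball x0 i%:R x -> ~ N x ->
    j x (far (ball x0 i%:R) delta x) <= rate%:E.
Let c k := extend2 (V k) (U k) (C k).
Hypothesis A4 : assumption_A4star m j x0 c.
Implicit Types (f g u : M -> R).

Let sepM := mms_separable Mmms.
Let sfm := sigma_finite_balls x0 Mmms.
Let open_pos (x : M) (r : R) : (0 < r)%R -> 0 < m (ball x r).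
Proof. by move=> r0; have /andP[] := mms_volume Mmms x r0. Qed.

Let mU k (k0 : (0 < k)%N) x : V k x -> measurable (U k x).
Proof. exact: ag_cell_measurable VEU k k0 x. Qed.
Let coverU k (k0 : (0 < k)%N) : \bigcup_(x in V k) U k x = setT.
Proof. exact: ag_cover VEU k k0. Qed.
Let disjU k (k0 : (0 < k)%N) x y : V k x -> V k y -> x <> y -> m (U k x `&` U k y) = 0.
Proof. exact: ag_disjoint VEU k k0 x y. Qed.
Let centerU k (k0 : (0 < k)%N) x : V k x -> V k `&` interior (U k x) = [set x].
Proof. exact: ag_center VEU k k0 x. Qed.

Let finU k (k0 : (0 < k)%N) x : V k x -> 0 < m (U k x) < +oo.
Proof.
move=> Vx; have [C4 [C5 [C40 C50 vol]]] := ag_volume VEU.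
have /andP[lo hi] := vol k k0 x Vx.
have ki : (0 < k%:R^-1 :> R)%R by rewrite invr_gt0 ltr0n.
have /andP[b0 by_] := mms_volume Mmms x ki.
apply/andP; split.
  rewrite lt_neqAle measure_ge0 andbT; apply/eqP => U0.
  by move: (lt_le_trans b0 hi); rewrite -U0 mule0 ltxx.
rewrite ltey; apply/eqP => Uy; move: (le_lt_trans lo by_).
by rewrite Uy gt0_muley ?ltxx// lte_fin.
Qed.

Let c_ge0 k : (0 < k)%N -> forall x y, (0 <= c k x y)%R.
Proof. by move=> k0 x y; apply: extend2_ge0; exact: C_ge0. Qed.
Let c_sym k : (0 < k)%N -> forall x y, c k x y = c k y x.
Proof. by move=> k0 x y; apply: extend2_sym; exact: C_sym. Qed.
Let mc k : (0 < k)%N -> jointly_measurable (c k).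
Proof.
move=> k0; exact: (measurable_extend2 sepM open_pos (mU k0) (disjU k0) (centerU k0)).
Qed.

Let w (v : nat -> M -> R) k := extend (V k) (U k) (v k).

(** For g in L2 the case distinction of [discrete_energy] makes no difference: off the domain the
    sum is itself infinite. *)
Lemma discrete_energyE k g : (0 < k)%N -> discrete_L2 m (V k) (U k) g ->
  discrete_energy m (V k) (U k) (C k) g =
  (2^-1)%:E * \int[m]_z \int[m]_w
    ((extend (V k) (U k) g z - extend (V k) (U k) g w) ^+ 2 * c k z w)%:E.
Proof.
move=> k0 Lg; rewrite -(discrete_sumE sepM open_pos (mU k0) (coverU k0) (disjU k0) (centerU k0)
  sfm (finU k0) (C_ge0 k0)) /discrete_energy.
case: asboolP => // nd; have -> : discrete_sum m (V k) (U k) (C k) g = +oo.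
  apply/eqP; rewrite eq_le leey /= leNgt; apply/negP => lt; exact: nd.
by rewrite gt0_muley// lte_fin.
Qed.

Lemma truncated_le_discrete k g (B : set M) (delta : R) : (0 < k)%N ->
  discrete_L2 m (V k) (U k) g ->
  form_energy m B delta (fun=> m) (c k) (extend (V k) (U k) g) <=
  discrete_energy m (V k) (U k) (C k) g.
Proof.
move=> k0 Lg; rewrite (discrete_energyE k0 Lg); apply: lee_wpmul2l; first by rewrite lee_fin.
have nn z y : 0 <= ((extend (V k) (U k) g z - extend (V k) (U k) g y) ^+ 2 * c k z y)%:E.
  by rewrite lee_fin; apply: mulr_ge0; [exact: sqr_ge0|exact: c_ge0].
rewrite /jump_total integral_mkcond; apply: ge0_le_integralW => z _.
  by rewrite patchE; case: ifP => // _; exact: integral_ge0.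
have nn2 : 0 <= \int[m]_w0
    ((extend (V k) (U k) g z - extend (V k) (U k) g w0) ^+ 2 * c k z w0)%:E.
  exact: integral_ge0.
rewrite patchE; case: ifP => // _; rewrite /jump_partial integral_mkcond.
apply: ge0_le_integralW => y _; first by rewrite patchE; case: ifP.
by rewrite patchE; case: ifP.
Qed.

(** Replacing [j] by its cut kernel affects points of the null set N only, so the assumptions on [j]
    become those of [truncated_liminf]. The energy of u is finite because the rates are bounded. *)
Lemma truncated_energy_liminf (i : nat) (delta : R) (v : nat -> M -> R) u (bnd e : R) :
  (0 < i)%N -> (0 < delta)%R ->
  (forall f, Lip_c f ->
    \int[m]_(x in ball x0 i%:R)
      ((truncated_conductance_generator m (c k) (ball x0 i%:R) delta f x) ^+ 2)%:E
      @[k --> \oo] -->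
    \int[m]_(x in ball x0 i%:R)
      ((truncated_jump_generator j (ball x0 i%:R) delta f x) ^+ 2)%:E) ->
  (forall f, bounded_continuous_on (ball x0 i%:R) f ->
    truncated_conductance_energy m (c k) (ball x0 i%:R) delta f @[k --> \oo] -->
    truncated_jump_energy m j (ball x0 i%:R) delta f) ->
  (forall k, (0 < k)%N -> L2on m setT (w v k)) ->
  (forall k, (0 < k)%N -> (fine (sqnorm m setT (w v k)) <= bnd)%R) ->
  L2on m setT u ->
  (forall h, L2on m setT h ->
    (\int[m]_x (w v k x * h x))%R @[k --> \oo] --> (\int[m]_x (u x * h x))%R) ->
  (0 < e)%R ->
  truncated_jump_energy m j (ball x0 i%:R) delta u \is a fin_num /\
  \forall k \near \oo,
    (fine (truncated_jump_energy m j (ball x0 i%:R) delta u) - e)%:E <=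
    form_energy m (ball x0 i%:R) delta (fun=> m) (c k) (w v k).
Proof.
move=> i0 delta0 cg ce Lw wb Lu wu e0; set B := ball x0 i%:R.
have mB : measurable B by exact: metric_ball_measurable.
have By : m B < +oo by exact: measure_ball_lty.
have [rate r0 hr] := rates i delta0.
pose kap := cut_kernel j delta mB N.
have enE f : truncated_jump_energy m j B delta f =
    form_energy m B delta kap (fun _ _ => 1%R) f.
  exact: (truncated_jump_energyE j delta mB mN N0 f).
have mkap := @measurable_cut_kernel_integral _ _ _ sepM j _ delta mB N mN rate hr r0.
have LuB : L2on m B u by apply: L2onS Lu => //; exact: subsetT.
have r_gt0 : (0 < i%:R :> R)%R by rewrite ltr0n.
have hs := cut_kernel_sym sepM mB (ltW delta0) j_sym mN N0.
have hrate := cut_kernel_rate mB hr r0.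
have hfin := cut_kernel_fin mB hr r0 By.
have hgen f : Lip_c f -> sqnorm m B (form_generator B delta (fun=> m) (c k) f)
    @[k --> \oo] --> sqnorm m B (form_generator B delta kap (fun _ _ => 1%R) f).
  move=> cf; have := cg f cf; rewrite -/B.
  have -> : \int[m]_(x in B) ((truncated_jump_generator j B delta f x) ^+ 2)%:E =
      sqnorm m B (form_generator B delta kap (fun _ _ => 1%R) f).
    apply: (ge0_eq_integral_negligible mN N0) => x Bx; rewrite ?lee_fin ?sqr_ge0//.
    by move=> Nx; rewrite (truncated_jump_generatorE j delta mB f Bx Nx).
  exact.
have hen f : bounded_continuous_on B f ->
    form_energy m B delta (fun=> m) (c k) f @[k --> \oo] -->
    form_energy m B delta kap (fun _ _ => 1%R) f.
  move=> bf; rewrite -enE; apply: cvg_trans (ce f bf); apply: near_eq_cvg; near=> k.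
  have k0 : (0 < k)%N by near: k; exact: nbhs_infty_gt.
  exact: (truncated_conductance_energyE m B delta (c_sym k0) f).
rewrite enE; split.
  rewrite ge0_fin_numE; last by apply: form_energy_ge0 => *; exact: ler01.
  have m1 : jointly_measurable (fun _ _ : M => 1%R : R) by exact: jointly_measurable_cst.
  have le1 := form_energy_sqnorm sepM mB (fun _ _ : M => @ler01 R) m1 mkap hs r0 hrate Lu.1.
  apply: le_lt_trans le1 _; rewrite lte_mul_pinfty ?lee_fin ?mulr_ge0//.
  exact: LuB.2.
exact: (truncated_liminf Mmms sfm r_gt0 delta0 c_ge0 c_sym mc mkap hs r0 hrate hfin hgen hen
  Lw wb Lu wu e0).
Unshelve. all: by end_near.
Qed.

Lemma mosco_liminf (v : nat -> M -> R) u :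
  (forall k, (0 < k)%N -> discrete_L2 m (V k) (U k) (v k)) ->
  u \in Lfun m 2%:E ->
  weakly_cvg_L2 m (fun k => extend (V k) (U k) (v k)) u ->
  jump_energy m j u <= limn_einf (fun k => discrete_energy m (V k) (U k) (C k) (v k)).
Proof.
move=> Lv Lu wvu; set l := limn_einf _; have L2u := (Lfun2P m u).1 Lu.
have Lw k : (0 < k)%N -> L2on m setT (w v k).
  move=> k0; exact: (discrete_L2_extend sepM open_pos (mU k0) (coverU k0) (disjU k0)
    (centerU k0) (Lv k k0)).
have wu h : L2on m setT h ->
    (\int[m]_x (w v k x * h x))%R @[k --> \oo] --> (\int[m]_x (u x * h x))%R.
  by move=> /(Lfun2P m h).2; exact: wvu.
(* Level 0 is unconstrained, so the sequence is shifted by one. *)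
have [bnd wb] : exists bnd : R, forall k, (fine (sqnorm m setT (w v k.+1)) <= bnd)%R.
  apply: L2_uniform_boundedness => [k|h Lh]; first exact: Lw.
  have cv : (\int[m]_x (w v k.+1 x * h x))%R @[k --> \oo] --> (\int[m]_x (u x * h x))%R.
    by rewrite (cvg_shiftS (fun k => (\int[m]_x (w v k x * h x))%R)); exact: wu.
  have /cvg_seq_bounded/pinfty_ex_gt0[b b0 hb] := cvgP _ cv.
  by exists b => k; exact: hb.
have wb' k : (0 < k)%N -> (fine (sqnorm m setT (w v k)) <= bnd)%R.
  by case: k => // k _; exact: wb.
have [_ [delta0 [i0 [delta0_gt0 A4']]]] := A4.
have main : (2^-1)%:E * jump_integral m j u <= l.
  (* The maximum with 1 makes the radius positive, as the finite net of the ball requires. *)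
  apply: (jump_integral_exhaustion sepM mN N0 rates (i0 := maxn i0 1) L2u.1 delta0_gt0).
  move=> i delta; rewrite geq_max => /andP[i0i i1] hd.
  have [cg ce] := A4' delta i hd i0i; have /andP[delta_gt0 _] := hd.
  have lim e : (0 < e)%R -> _ := truncated_energy_liminf i1 delta_gt0 cg ce Lw wb' L2u wu.
  have [fin _] := lim 1%R ltr01.
  apply/lee_addgt0Pr => e e0; have [_ h] := lim e e0.
  rewrite -leeBlDr// -(fineK fin) -EFinB; apply: limn_einf_ge_near; near=> k.
  have k0 : (0 < k)%N by near: k; exact: nbhs_infty_gt.
  apply: le_trans (truncated_le_discrete (ball x0 i%:R) delta k0 (Lv k k0)).
  by near: k.
rewrite /jump_energy; case: asboolP => // nd.
have -> : +oo = (2^-1)%:E * jump_integral m j u; last by [].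
have -> : jump_integral m j u = +oo.
  apply/eqP; rewrite eq_le leey /= leNgt; apply/negP => lt; exact: nd.
by rewrite gt0_muley// lte_fin.
Unshelve. all: by end_near.
Qed.

(** * The recovery sequence *)

Let avg f k := cell_mean m (V k) (U k) f.

(** Cells have diameter at most C3 / k, so on a cell the mean differs from f by at most L C3 / k.
    Off the ball of radius i + C3 both vanish, since cells with a point there miss the support; b is
    the mass of that ball. *)
Lemma recovery_distance f : Lip_c f -> exists a b : R, [/\ (0 <= a)%R, (0 <= b)%R &
  forall k, (0 < k)%N -> sqnorm m setT (fun z => w (avg f) k z - f z)%R <=
    ((a / k%:R) ^+ 2 * b)%:E].
Proof.
move=> cf; have [C3 C30 diam] := ag_diameter VEU.
have [L L0 lf] := Lip_c_lipschitz cf; have [i _ f0] := Lip_c_support x0 cf.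
have mf := Lip_c_measurable cf.
pose A := ball x0 (i%:R + C3)%R; have mA : measurable A by exact: metric_ball_measurable.
have Ay : m A < +oo by exact: measure_ball_lty.
exists (L * C3)%R, (fine (m A)); split; first by rewrite mulr_ge0// ltW.
  by rewrite fine_ge0.
move=> k k0; have kR : (0 < k%:R :> R)%R by rewrite ltr0n.
have e0 : (0 <= L * C3 / k%:R)%R by rewrite !mulr_ge0// ?invr_ge0// ltW.
have sh0 := shared_null sepM open_pos (mU k0) (coverU k0) (disjU k0) (centerU k0).
have msh := measurable_shared sepM open_pos (mU k0) (disjU k0) (centerU k0).
rewrite EFinM fineK ?ge0_fin_numE// -integral_cst// [leRHS]integral_mkcond.
apply: (ge0_le_integral_negligible msh sh0) => z _.
- by rewrite lee_fin sqr_ge0.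
- by rewrite patchE; case: ifP => _; rewrite ?lee_fin ?sqr_ge0.
- move=> zs; have [[x Vx zx]|//] := cell_or_shared (V k) (U k) z.
  rewrite /w (extend_cell _ zx) /avg /cell_mean.
  have mcell := measurable_cell sepM open_pos (mU k0) (disjU k0) (centerU k0) Vx.
  have cmass := mass_cell sepM open_pos (mU k0) (disjU k0) (centerU k0) (finU k0) Vx.
  have near (z' : M) : cell (V k) (U k) x z' -> (mdist z z' <= C3 / k%:R)%R.
    by move=> z'x; apply: (diam k k0 x Vx); [exact: (cell_sub Vx zx)|exact: (cell_sub Vx z'x)].
  rewrite patchE; case: ifPn => [_|/negP zA].
    rewrite lee_fin -(real_normK (num_real (_ - _))) ler_sqr ?nnegrE// distrC.
    apply: (mean_near mcell cmass) => //; first exact: measurable_funTS.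
    move=> z' z'x; apply: le_trans (lf z z') _; rewrite -mulrA ler_wpM2l//.
    exact: near.
  have zfar : ~ A z by move=> h; apply: zA; apply: mem_set.
  have off (z' : M) : cell (V k) (U k) x z' -> f z' = 0%R.
    move=> z'x; apply: f0 => z'i; apply: zfar; move: z'i; rewrite /A !in_ballE => z'i.
    apply: le_lt_trans (metric_triangle x0 z' z) _; rewrite (metric_sym z' z).
    apply: ltr_leD; first exact: z'i.
    apply: le_trans (near _ z'x) _; rewrite ler_pdivrMr//.
    by apply: ler_peMr; [exact: ltW|rewrite ler1n].
  have -> : mean m (cell (V k) (U k) x) f = 0%R.
    apply/eqP; rewrite -normr_eq0 -normrN -sub0r eq_le normr_ge0 andbT.
    apply: (mean_near mcell cmass) => //; first exact: measurable_funTS.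
    by move=> z' z'x; rewrite (off _ z'x) subr0 normr0.
  by rewrite (off _ zx) subrr expr0n.
Qed.

Lemma avg_discrete_L2 f k : Lip_c f -> (0 < k)%N -> discrete_L2 m (V k) (U k) (avg f k).
Proof.
move=> cf k0; rewrite /discrete_L2.
rewrite (discrete_L2E sepM open_pos (mU k0) (coverU k0) (disjU k0) (centerU k0)).
have [a [b [a0 b0 /(_ k k0) hab]]] := recovery_distance cf.
have mf := Lip_c_measurable cf.
have mw : measurable_fun setT (w (avg f) k).
  exact: (measurable_extend sepM open_pos (mU k0) (disjU k0) (centerU k0)).
have -> : extend (V k) (U k) (avg f k) = (fun z => (w (avg f) k z - f z) + f z)%R.
  by apply/funext => z; rewrite subrK.
have mwf : measurable_fun setT (fun z => w (avg f) k z - f z)%R by exact: measurable_funB.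
apply: le_lt_trans (sqnormD_le m measurableT mwf mf) _.
rewrite lte_mul_pinfty// lte_add_pinfty//; first by apply: le_lt_trans hab _; exact: ltry.
exact: (Lip_c_L2on x0 Mmms cf).2.
Qed.

Lemma recovery_strong f (e : R) : Lip_c f -> (0 < e)%R ->
  \forall k \near \oo, sqnorm m setT (fun z => w (avg f) k z - f z)%R <= e%:E.
Proof.
move=> cf e0; have [a [b [a0 b0 hab]]] := recovery_distance cf.
near=> k; have k0 : (0 < k)%N by near: k; exact: nbhs_infty_gt.
apply: le_trans (hab k k0) _; rewrite lee_fin.
have kR : (0 < k%:R :> R)%R by rewrite ltr0n.
(* A linear condition on k is enough, as k <= k^2. *)
have ak : (a ^+ 2 * b / e <= k%:R)%R.
  apply: ltW; apply: lt_le_trans (truncnS_gt _) _; rewrite ler_nat.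
  by near: k; exact: nbhs_infty_ge.
rewrite expr_div_n mulrAC ler_pdivrMr ?exprn_gt0//.
apply: (@le_trans _ _ (e * k%:R)%R); first by rewrite (mulrC e) -ler_pdivrMr.
apply: ler_wpM2l; first exact: ltW.
by rewrite expr2; apply: ler_peMr; [exact: ltW|rewrite ler1n].
Unshelve. all: by end_near.
Qed.

Lemma truncated_le_jump (B : set M) (delta : R) u : (0 <= delta)%R ->
  truncated_jump_energy m j B delta u <= (2^-1)%:E * jump_integral m j u.
Proof.
move=> d0; apply: lee_wpmul2l; first by rewrite lee_fin.
have nn x y : 0 <= ((u x - u y) ^+ 2)%:E by rewrite lee_fin sqr_ge0.
rewrite integral_mkcond; apply: ge0_le_integralW => x _.
  rewrite patchE; case: ifP => // _.
  by apply: integral_ge0 => y _; rewrite lee_fin sqr_ge0.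
have nn2 : 0 <= \int[j x]_(y in [set~ x]) ((u x - u y) ^+ 2)%:E by exact: integral_ge0.
rewrite patchE; case: ifP => // _; rewrite integral_mkcond [leRHS]integral_mkcond.
apply: ge0_le_integralW => y _.
  by rewrite patchE; case: ifP; rewrite ?lee_fin ?sqr_ge0.
rewrite patchE; case: ifPn => [/set_mem[_ /= xy]|_]; last first.
  by rewrite patchE; case: ifP.
rewrite patchE mem_set ?lexx//= => yx; move: xy.
by rewrite yx mdistxx ltNge d0.
Qed.

Lemma cell_mean_energy_le f k : Lip_c f -> (0 < k)%N ->
  discrete_energy m (V k) (U k) (C k) (avg f k) <=
  (2^-1)%:E * double_integral m (fun z w => (f z - f w) ^+ 2 * c k z w)%R.
Proof.
move=> cf k0; have Lf := Lip_c_L2on x0 Mmms cf; have mf := Lip_c_measurable cf.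
rewrite (discrete_energyE k0 (avg_discrete_L2 cf k0)).
apply: lee_wpmul2l; first by rewrite lee_fin.
rewrite -(discrete_sumE sepM open_pos (mU k0) (coverU k0) (disjU k0) (centerU k0)
  sfm (finU k0) (C_ge0 k0)).
apply: (discrete_sum_cell_mean sepM open_pos (mU k0) (coverU k0) (disjU k0) (centerU k0)
  sfm (finU k0) (C_ge0 k0) mf) => x Vx.
apply: L2onS Lf => //.
exact: (measurable_cell sepM open_pos (mU k0) (disjU k0) (centerU k0) Vx).
Qed.

Let near_part (K : set M) (eta : R) k :=
  \int[m]_(x in K) \int[m]_(y in K `&` [set y | (mdist x y <= eta)%R])
    ((mdist x y) ^+ 2 * c k x y)%:E.

Let far_part (K : set M) (i : nat) k :=
  \int[m]_(x in K) \int[m]_(y in ~` ball x0 i%:R) (c k x y)%:E.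

(** Off B the function vanishes, so a pair with different values lies in B or has one point in [Kf]
    and the other off B. The last case occurs in both orders, [T3] and its mirror image [T4], which
    have the same integral by Tonelli's theorem; hence the factor 2 of b^2. *)
Lemma double_integral_split f (L b : R) (Kf : set M) (i : nat) (delta : R) k :
  (0 < k)%N -> (0 <= L)%R -> lipschitz_with L f -> measurable Kf ->
  (forall x, f x != 0%R -> Kf x /\ ball x0 i%:R x) -> (forall x, `|f x| <= b)%R ->
  double_integral m (fun z y => (f z - f y) ^+ 2 * c k z y)%R <=
  2%:E * form_energy m (ball x0 i%:R) delta (fun=> m) (c k) f +
  ((L ^+ 2)%:E * near_part (closure (ball x0 i%:R)) delta k +
   (2 * b ^+ 2)%:E * far_part Kf i k).
Proof.
move=> k0 L0 lf mKf f0 fb.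
set B := ball x0 i%:R; pose K := closure B.
have mf := lipschitz_measurable lf.
have mB : measurable B by exact: metric_ball_measurable.
have mK : measurable K.
  rewrite -(setCK K); apply: measurableC; apply: borel_open_measurable.
  by apply: closed_openC; exact: closed_closure.
have mD : jointly_measurable (fun z y : M => mdist z y) by exact: measurable_mdist.
have mgt := measurable_mdist_gt sepM delta.
pose P1 := (B `*` B) `&` [set p : M * M | (delta < mdist p.1 p.2)%R].
(* The closure K replaces B because near pairs are controlled on compact sets. *)
pose P2 := (K `*` K) `\` [set p : M * M | (delta < mdist p.1 p.2)%R].
pose P3 := Kf `*` ~` B.
have mP1 : measurable P1 by apply: measurableI => //; exact: measurableX.
have mP2 : measurable P2 by apply: measurableD => //; exact: measurableX.
have mP3 : measurable P3 by apply: measurableX => //; exact: measurableC.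
have jind (P : set (M * M)) : measurable P -> jointly_measurable (fun z y => \1_P (z, y) : R).
  move=> mP; rewrite /jointly_measurable.
  have -> : (fun p : M * M => \1_P (p.1, p.2) : R) = \1_P by apply/funext => -[].
  exact: measurable_indic.
pose T1 z y : R := ((f z - f y) ^+ 2 * c k z y * \1_P1 (z, y))%R.
pose T2 z y : R := (mdist z y ^+ 2 * c k z y * \1_P2 (z, y))%R.
pose T3 z y : R := (c k z y * \1_P3 (z, y))%R.
pose T4 z y : R := T3 y z.
have ind0 (P : set (M * M)) p : (0 <= \1_P p :> R)%R by rewrite indicE.
have ind1 (P : set (M * M)) p : (\1_P p <= 1 :> R)%R by rewrite indicE lern1 leq_b1.
have c0 := c_ge0 k0.
have T10 z y : (0 <= T1 z y)%R.
  by apply: mulr_ge0 => //; apply: mulr_ge0 => //; exact: sqr_ge0.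
have T20 z y : (0 <= T2 z y)%R.
  by apply: mulr_ge0 => //; apply: mulr_ge0 => //; exact: sqr_ge0.
have T30 z y : (0 <= T3 z y)%R by apply: mulr_ge0.
have T40 z y : (0 <= T4 z y)%R by exact: T30.
have mT1 : jointly_measurable T1.
  apply: jointly_measurableM; last exact: jind.
  by apply: jointly_measurableM; [exact: jointly_measurable_sqrB|exact: mc].
have mT2 : jointly_measurable T2.
  apply: jointly_measurableM; last exact: jind.
  apply: jointly_measurableM; last exact: mc.
  by rewrite /jointly_measurable; apply: measurable_funX.
have mT3 : jointly_measurable T3 by apply: jointly_measurableM; [exact: mc|exact: jind].
have mT4 : jointly_measurable T4.
  rewrite /jointly_measurable.
  apply: (measurableT_comp mT3 (_ : measurable_fun setT (fun p : M * M => (p.2, p.1)))).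
  exact: measurable_swap.
have b20 : (0 <= b ^+ 2)%R by exact: sqr_ge0.
have L20 : (0 <= L ^+ 2)%R by exact: sqr_ge0.
pose S z y := (T1 z y + (L ^+ 2 * T2 z y + (b ^+ 2 * T3 z y + b ^+ 2 * T4 z y)))%R.
have n2 z y : (0 <= L ^+ 2 * T2 z y)%R by exact: mulr_ge0.
have n3 z y : (0 <= b ^+ 2 * T3 z y)%R by exact: mulr_ge0.
have n4 z y : (0 <= b ^+ 2 * T4 z y)%R by exact: mulr_ge0.
have GS z y : ((f z - f y) ^+ 2 * c k z y <= S z y)%R.
  have [[S1 S2] [S3 S4]] : ((T1 z y <= S z y)%R /\ (L ^+ 2 * T2 z y <= S z y)%R) /\
      ((b ^+ 2 * T3 z y <= S z y)%R /\ (b ^+ 2 * T4 z y <= S z y)%R).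
    rewrite /S; move: (T10 z y) (n2 z y) (n3 z y) (n4 z y).
    move: (T1 z y) (L ^+ 2 * T2 z y)%R (b ^+ 2 * T3 z y)%R (b ^+ 2 * T4 z y)%R.
    by move=> t1 t2 t3 t4 *; split; split; lra.
  have S0 : (0 <= S z y)%R by exact: le_trans (T10 z y) S1.
  have off x : ~ B x -> f x = 0%R.
    by move=> xB; apply/eqP; apply: contrapT => /negP/f0[_ /xB].
  have sqb x : (f x ^+ 2 <= b ^+ 2)%R.
    by rewrite -(real_normK (num_real (f x))) ler_sqr ?nnegrE// (le_trans _ (fb x)).
  have [Bz|Bz] := pselect (B z); have [By|By] := pselect (B y).
  - have [zy|zy] := ltP delta (mdist z y).
      by apply: le_trans S1; rewrite /T1 indicE mem_set ?mulr1.
    apply: le_trans S2; rewrite /T2 indicE mem_set ?mulr1; last first.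
      by split; [split; exact: subset_closure|rewrite /= ltNge zy].
    rewrite mulrA; apply: ler_wpM2r => //; rewrite -exprMn.
    by rewrite -(real_normK (num_real (f z - f y))) ler_sqr ?nnegrE// mulr_ge0// mdist_ge0.
  - rewrite (off y By) subr0; have [fz|/f0[Kz _]] := eqVneq (f z) 0%R.
      by rewrite fz expr0n mul0r.
    apply: le_trans S3; rewrite /T3 indicE mem_set ?mulr1; last by split.
    exact: ler_wpM2r.
  - rewrite (off z Bz) sub0r sqrrN; have [fy|/f0[Ky _]] := eqVneq (f y) 0%R.
      by rewrite fy expr0n mul0r.
    apply: le_trans S4; rewrite /T4 /T3 indicE mem_set ?mulr1; last by split.
    by rewrite (c_sym k0 y z); exact: ler_wpM2r.
  - by rewrite (off z Bz) (off y By) subrr expr0n mul0r.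
have jZ (a : R) (T : M -> M -> R) : jointly_measurable T -> jointly_measurable (fun z y => a * T z y)%R.
  by move=> mT; apply: jointly_measurableM; [exact: jointly_measurable_cst|exact: mT].
have G0 z y : (0 <= (f z - f y) ^+ 2 * c k z y)%R.
  by apply: mulr_ge0 => //; exact: sqr_ge0.
have m2 := jZ (L ^+ 2)%R _ mT2; have m3 := jZ (b ^+ 2)%R _ mT3; have m4 := jZ (b ^+ 2)%R _ mT4.
have m34 := jointly_measurableD m3 m4.
have n34 z y : (0 <= b ^+ 2 * T3 z y + b ^+ 2 * T4 z y)%R by exact: addr_ge0.
have n234 z y : (0 <= L ^+ 2 * T2 z y + (b ^+ 2 * T3 z y + b ^+ 2 * T4 z y))%R.
  exact: addr_ge0.
have two_half : (2 * 2^-1 = 1 :> R)%R by rewrite divff// pnatr_eq0.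
have b2E : 0 <= (b ^+ 2)%:E by rewrite lee_fin.
have L2E : 0 <= (L ^+ 2)%:E by rewrite lee_fin.
have bb : (2 * b ^+ 2)%R = (b ^+ 2 + b ^+ 2)%R by ring.
have I1 : double_integral m T1 <= 2%:E * form_energy m B delta (fun=> m) (c k) f.
  rewrite /form_energy muleA -EFinM two_half mul1e.
  apply: double_integral_restrict => // z y.
  - move=> _ _; apply: ler_piMr => //; apply: mulr_ge0 => //; exact: sqr_ge0.
  - by move=> h; rewrite /T1 indicE memNset ?mulr0// => -[[/= ? ?] ?]; apply: h.
have I2 : double_integral m T2 <= near_part K delta k.
  apply: double_integral_restrict => // z y.
  - move=> _ _; apply: ler_piMr => //; apply: mulr_ge0 => //; exact: sqr_ge0.
  - move=> h; rewrite /T2 indicE memNset ?mulr0// => -[[/= ? ?] zy]; apply: h.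
    by split => //; split => //; rewrite /= leNgt; apply/negP.
have I3 : double_integral m T3 <= far_part Kf i k.
  apply: double_integral_restrict => // z y.
  - by move=> _ _; apply: ler_piMr.
  - by move=> h; rewrite /T3 indicE memNset ?mulr0// => -[/= ? ?]; apply: h.
have I4 : double_integral m T4 = double_integral m T3.
  by rewrite /double_integral (ge0_tonelli sfm mT3 T30).
apply: le_trans (double_integral_le m G0 GS) _.
rewrite (double_integralD sfm mT1 (jointly_measurableD m2 m34) T10 n234).
rewrite (double_integralD sfm m2 m34 n2 n34) (double_integralD sfm m3 m4 n3 n4).
rewrite (double_integralZ sfm mT3 T30 b20) (double_integralZ sfm mT4 T40 b20).
rewrite (double_integralZ sfm mT2 T20 L20) I4.
apply: leeD; first exact: I1.
apply: leeD; first exact: (lee_wpmul2l L2E I2).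
rewrite bb EFinD (ge0_muleDl _ b2E b2E).
exact: leeD (lee_wpmul2l b2E I3) (lee_wpmul2l b2E I3).
Qed.

(** The order of choices matters, as each limit in [assumption_A4star] is for a fixed compact set:
    first the radius i, for the closed ball around the support of f, then delta, for the closed ball
    of radius i, and k last. *)
Lemma recovery_energy f (e : R) : Lip_c f -> jump_integral m j f < +oo -> (0 < e)%R ->
  \forall k \near \oo, discrete_energy m (V k) (U k) (C k) (avg f k) <=
    (2^-1)%:E * jump_integral m j f + e%:E.
Proof.
move=> cf Jf e0.
set X := (2^-1)%:E * jump_integral m j f.
have Xfin : X \is a fin_num.
  rewrite fin_numM// ge0_fin_numE//.
  by apply: integral_ge0 => x _; apply: integral_ge0 => y _; rewrite lee_fin sqr_ge0.
have [A4i [delta0 [i0 [delta0_gt0 A4ii]]]] := A4.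
have [L L0 lf] := Lip_c_lipschitz cf; have [b b0 fb] := Lip_c_bounded x0 cf.
have [i1 i1_gt0 f0] := Lip_c_support x0 cf.
pose Kf := closure (ball x0 i1%:R).
have cKf : compact Kf by apply: (mms_compact Mmms); rewrite ltr0n.
have mKf : measurable Kf.
  rewrite -(setCK Kf); apply: measurableC; apply: borel_open_measurable.
  by apply: closed_openC; exact: closed_closure.
(* The near part then costs e / 3, the pairs leaving B cost 2 e / 3, and the doubled truncated
   energy exceeds its limit by 2 e / 3; half of the sum is below e. The added 1 avoids division by
   0. *)
pose r1 := (e / (3 * (b ^+ 2 + 1)))%R; pose r2 := (e / (3 * (L ^+ 2 + 1)))%R.
have b2 : (0 < b ^+ 2 + 1)%R by rewrite ltr_wpDl// sqr_ge0.
have L2 : (0 < L ^+ 2 + 1)%R by rewrite ltr_wpDl// sqr_ge0.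
have r1_gt0 : (0 < r1)%R by rewrite divr_gt0// mulr_gt0.
have r2_gt0 : (0 < r2)%R by rewrite divr_gt0// mulr_gt0.
have [i [i_ge hfar]] : exists i, (maxn i0 i1 <= i)%N /\
    limn_esup (far_part Kf i) < r1%:E.
  have r1E : 0 < r1%:E by rewrite lte_fin.
  near \oo => i; exists i; split; near: i; first exact: nbhs_infty_ge.
  exact: (cvge_lt_near (A4i Kf cKf).2).
move: i_ge; rewrite geq_max => /andP[i0i i1i].
have i_gt0 : (0 < i)%N by exact: leq_trans i1_gt0 i1i.
pose B := ball x0 i%:R; pose K := closure B.
have cK : compact K by apply: (mms_compact Mmms); rewrite ltr0n.
have [delta [delta_gt0 delta_lt hnear]] : exists delta : R, [/\ (0 < delta)%R, (delta < delta0)%R &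
    limn_esup (near_part K delta) < r2%:E].
  have r2E : 0 < r2%:E by rewrite lte_fin.
  near (0%R : R)^'+ => delta; exists delta; split; near: delta.
  - exact: nbhs_right_gt.
  - exact: nbhs_right_lt.
  - exact: (cvge_lt_near (A4i K cK).1).
have hd : (0 < delta < delta0)%R by rewrite delta_gt0.
have [_ ce] := A4ii delta i hd i0i.
have bcf : bounded_continuous_on B f.
  split; last by exists b.
  by apply: continuous_subspaceT; exact: lipschitz_continuous lf.
have E1 : truncated_jump_energy m j B delta f < X + (e / 3)%:E.
  apply: le_lt_trans (truncated_le_jump B f (ltW delta_gt0)) _.
  by rewrite lteDl// lte_fin divr_gt0.
have supp x : f x != 0%R -> Kf x /\ B x.
  move=> fx; have xi : ball x0 i1%:R x.
    by apply: contrapT => h; move/eqP: fx; apply; exact: f0.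
  split; first exact: subset_closure.
  by move: xi; rewrite /B !in_ballE => /lt_le_trans; apply; rewrite ler_nat.
near=> k; have k0 : (0 < k)%N by near: k; exact: nbhs_infty_gt.
have h1 : truncated_conductance_energy m (c k) B delta f < X + (e / 3)%:E.
  by near: k; exact: (cvge_lt_near (ce f bcf)).
have h2 : near_part K delta k < r2%:E by near: k; exact: limn_esup_lt_near.
have h3 : far_part Kf i k < r1%:E by near: k; exact: limn_esup_lt_near.
apply: le_trans (cell_mean_energy_le cf k0) _.
apply: le_trans (lee_wpmul2l _ (double_integral_split delta k0 L0 lf mKf supp fb)) _.
  by rewrite lee_fin.
have -> : form_energy m B delta (fun=> m) (c k) f = truncated_conductance_energy m (c k) B delta f.
  by rewrite (truncated_conductance_energyE m B delta (c_sym k0) f).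
have Lr : (L ^+ 2 * r2 <= e / 3)%R.
  rewrite /r2 mulrA ler_pdivrMr ?mulr_gt0//.
  have -> : (e / 3 * (3 * (L ^+ 2 + 1)) = L ^+ 2 * e + e)%R by field.
  by rewrite lerDl ltW.
have br : (b ^+ 2 * r1 <= e / 3)%R.
  rewrite /r1 mulrA ler_pdivrMr ?mulr_gt0//.
  have -> : (e / 3 * (3 * (b ^+ 2 + 1)) = b ^+ 2 * e + e)%R by field.
  by rewrite lerDl ltW.
have g1 : 2%:E * truncated_conductance_energy m (c k) B delta f <= 2%:E * (X + (e / 3)%:E).
  by apply: lee_wpmul2l; [rewrite lee_fin|exact: ltW].
have g2 : (L ^+ 2)%:E * near_part K delta k <= (e / 3)%:E.
  apply: (@le_trans _ _ ((L ^+ 2)%:E * r2%:E)); last by rewrite -EFinM lee_fin.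
  by apply: lee_wpmul2l; [rewrite lee_fin sqr_ge0|exact: ltW].
have g3 : (2 * b ^+ 2)%:E * far_part Kf i k <= (2 * (e / 3))%:E.
  apply: (@le_trans _ _ ((2 * b ^+ 2)%:E * r1%:E)); last first.
    by rewrite -EFinM lee_fin -mulrA ler_wpM2l.
  by apply: lee_wpmul2l; [rewrite lee_fin mulr_ge0// sqr_ge0|exact: ltW].
apply: le_trans (lee_wpmul2l _ (leeD g1 (leeD g2 g3))) _; first by rewrite lee_fin.
have [q ->] : exists q : R, X = q%:E by exists (fine X); rewrite fineK.
have : (2^-1 * (2 * (q + e / 3) + (e / 3 + 2 * (e / 3))) <= q + e)%R by lra.
by rewrite -lee_fin.
Unshelve. all: by end_near.
Qed.

(** [form_energyD_le] applies to the truncated forms, given by finite kernels; the exhaustion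
    carries it over to the full integrals. *)
Lemma jump_integral_near f u (t : R) : measurable_fun setT f -> measurable_fun setT u ->
  (0 < t)%R ->
  (2^-1)%:E * jump_integral m j f <=
  (1 + t)%:E * ((2^-1)%:E * jump_integral m j u) +
  (1 + t^-1)%:E * ((2^-1)%:E * jump_integral m j (u \- f)%R).
Proof.
move=> mf mu t0.
apply: (jump_integral_exhaustion sepM mN N0 rates (i0 := 0%N) mf ltr01) => i delta _.
move=> /andP[delta0 _]; set B := ball x0 i%:R.
have mB : measurable B by exact: metric_ball_measurable.
have [rate r0 hr] := rates i delta0.
have enE g : truncated_jump_energy m j B delta g =
    form_energy m B delta (cut_kernel j delta mB N) (fun _ _ => 1%R) g.
  exact: (truncated_jump_energyE j delta mB mN N0 g).
have mkap := @measurable_cut_kernel_integral _ _ _ sepM j _ delta mB N mN rate hr r0.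
have m1 : jointly_measurable (fun _ _ : M => 1%R : R) by exact: jointly_measurable_cst.
have mfu : measurable_fun setT (fun x => f x - u x)%R by exact: measurable_funB.
have h := @form_energyD_le _ _ _ sepM m B delta _ _ mB (fun _ _ : M => @ler01 R) m1 mkap
  t _ _ t0 mu mfu.
have fE : (fun x => u x + (f x - u x))%R = f by apply/funext => x; ring.
rewrite fE -!enE in h; apply: le_trans h _.
have t1 : (0 <= 1 + t)%R by rewrite addr_ge0// ltW.
have t2 : (0 <= 1 + t^-1)%R by rewrite addr_ge0// invr_ge0 ltW.
apply: leeD; apply: lee_wpmul2l.
- by rewrite lee_fin.
- exact: (truncated_le_jump _ _ (ltW delta0)).
- by rewrite lee_fin.
- apply: le_trans (truncated_le_jump B _ (ltW delta0)) _.
  apply: lee_wpmul2l; first by rewrite lee_fin.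
  rewrite le_eqVlt; apply/orP; left; apply/eqP.
  apply: eq_integral => x _; apply: eq_integral => y _; congr EFin.
  by rewrite /= -sqrrN; congr (_ ^+ 2)%R; ring.
Qed.

Hypothesis Lip_dom : forall f, Lip_c f -> jump_domain m j f.
Hypothesis Lip_dense : forall u, jump_domain m j u -> forall eps : R, (0 < eps)%R ->
  exists2 f, Lip_c f & jump_energy m j (u \- f)%R + 'N[m]_2%:E[EFin \o (u \- f)%R] ^+ 2
    < eps%:E.

Let jump_integral_ge0 g : 0 <= jump_integral m j g.
Proof.
by apply: integral_ge0 => x _; apply: integral_ge0 => y _; rewrite lee_fin sqr_ge0.
Qed.

Let jump_energy_ge0 g : 0 <= jump_energy m j g.
Proof.
rewrite /jump_energy; case: ifP => // _.
by apply: mule_ge0; rewrite ?lee_fin ?jump_integral_ge0.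
Qed.

(** Off the domain the energy bound is void and density in L2 suffices. On the domain, density in
    the form norm makes the energy of u - f small, and [jump_integral_near] turns this into a bound
    on the energy of f. *)
Lemma Lip_c_jump_approx u (e : R) : u \in Lfun m 2%:E -> (0 < e)%R ->
  exists f, [/\ Lip_c f, sqnorm m setT (fun x => u x - f x)%R <= e%:E &
    (2^-1)%:E * jump_integral m j f <= jump_energy m j u + e%:E].
Proof.
move=> Lu e0; have L2u := (Lfun2P m u).1 Lu.
have [ud|nd] := pselect (jump_domain m j u); last first.
  have [f cf hf] := Lip_c_dense_L2 x0 Mmms L2u e0.
  exists f; split; [exact: cf|exact: ltW|].
  by rewrite /jump_energy asboolF// addye// leey.
have Efin : jump_energy m j u \is a fin_num.
  rewrite (ge0_fin_numE (jump_energy_ge0 u)) /jump_energy asboolT//; case: ud => _.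
  by apply: lte_mul_pinfty; rewrite ?lee_fin.
have [X EX] : exists X : R, jump_energy m j u = X%:E by exists (fine (jump_energy m j u)); rewrite fineK.
have X0 : (0 <= X)%R by rewrite -lee_fin -EX.
(* The factor 1 + t adds at most e / 2 to X; [eps] then absorbs the large factor 1 + 1 / t. *)
pose t := (e / (2 * (X + 1)))%R.
have t0 : (0 < t)%R by rewrite divr_gt0// mulr_gt0// ltr_wpDl.
have tX : (t * X <= e / 2)%R.
  have : (t * (2 * (X + 1)) = e)%R by rewrite /t mulfVK// gt_eqF// mulr_gt0// ltr_wpDl.
  by move: t0; lra.
have ti0 : (0 < 1 + t^-1)%R by rewrite addr_gt0// invr_gt0.
pose eps := Num.min e (e / 2 / (1 + t^-1))%R.
have eps0 : (0 < eps)%R by rewrite lt_min e0/= !divr_gt0.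
have [f cf hf] := Lip_dense ud eps0.
have mf := Lip_c_measurable cf.
have N2E : 'N[m]_2%:E[EFin \o (u \- f)%R] ^+ 2 = sqnorm m setT (fun x => u x - f x)%R.
  exact: Lnorm2_sqr.
have S0 := sqnorm_ge0 m setT (fun x => u x - f x)%R.
rewrite N2E in hf.
have h1 : jump_energy m j (u \- f)%R < eps%:E.
  by apply: le_lt_trans hf; rewrite leeDl.
have h2 : sqnorm m setT (fun x => u x - f x)%R < eps%:E.
  by apply: le_lt_trans hf; rewrite leeDr.
exists f; split => //.
  by apply: ltW; apply: lt_le_trans h2 _; rewrite lee_fin ge_min lexx.
have dE : jump_energy m j (u \- f)%R = (2^-1)%:E * jump_integral m j (u \- f)%R.
  by move: h1; rewrite /jump_energy; case: asboolP.
have uE : (2^-1)%:E * jump_integral m j u = X%:E by rewrite -EX /jump_energy asboolT.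
apply: le_trans (jump_integral_near mf L2u.1 t0) _; rewrite uE -dE EX.
apply: (@le_trans _ _ ((1 + t) * X + (1 + t^-1) * eps)%:E).
  rewrite [leRHS]EFinD; apply: leeD; first by rewrite -EFinM.
  rewrite EFinM; apply: lee_wpmul2l; last exact: ltW.
  by rewrite lee_fin ltW.
rewrite lee_fin.
have : ((1 + t^-1) * eps <= e / 2)%R.
  by rewrite mulrC -ler_pdivlMr// /eps ge_min lexx orbT.
by move: tX; move: ((1 + t^-1) * eps)%R => p; lra.
Qed.

(** At level k the cell means of the approximant number s k are taken, with s growing slowly enough
    for both of its estimates to hold at that level. *)
Lemma mosco_limsup u : u \in Lfun m 2%:E -> exists v : nat -> M -> R,
  [/\ forall k, (0 < k)%N -> discrete_L2 m (V k) (U k) (v k),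
      strongly_cvg_L2 m (fun k => extend (V k) (U k) (v k)) u &
      limn_esup (fun k => discrete_energy m (V k) (U k) (C k) (v k)) <= jump_energy m j u].
Proof.
move=> Lu; have L2u := (Lfun2P m u).1 Lu.
have e_gt0 (n : nat) : (0 < n.+1%:R^-1 :> R)%R by rewrite invr_gt0.
have [f_ hf] := choice (fun n => Lip_c_jump_approx Lu (e_gt0 n)).
pose P n k := [/\ (0 < k)%N,
  sqnorm m setT (fun z => w (avg (f_ n)) k z - f_ n z)%R <= (n.+1%:R^-1)%:E &
  discrete_energy m (V k) (U k) (C k) (avg (f_ n) k) <=
    jump_energy m j u + (2 * n.+1%:R^-1)%:E].
have nearP n : \forall k \near \oo, P n k.
  have [cf _ Ef] := hf n; near=> k; split.
  - by near: k; exact: nbhs_infty_gt.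
  - by near: k; exact: recovery_strong.
  - apply: (@le_trans _ _ ((2^-1)%:E * jump_integral m j (f_ n) + (n.+1%:R^-1)%:E)).
      by near: k; apply: recovery_energy => //; exact: (Lip_dom cf).2.
    rewrite mulr_natl mulr2n EFinD addeA; exact: leeD.
have [s [s_oo sP]] := diagonal_extraction nearP.
have small (e : R) : (0 < e)%R -> \forall k \near \oo, ((s k).+1%:R^-1 <= e)%R.
  move=> e0; near=> k; rewrite -[leRHS]invrK lef_pV2 ?posrE ?invr_gt0//.
  apply: ltW; apply: lt_le_trans (truncnS_gt _) _; rewrite ler_nat ltnS.
  by near: k; exact: s_oo.
exists (fun k => avg (f_ (s k)) k); split.
- by move=> k k0; apply: avg_discrete_L2 => //; case: (hf (s k)).
- pose wk k := w (avg (f_ (s k))) k.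
  have Nlt (e : R) : (0 < e)%R ->
      \forall k \near \oo, 'N[m]_2%:E[EFin \o (wk k \- u)%R] < e%:E.
    (* Two errors of e^2 / 8, doubled by [sqnormD_le], leave e^2 / 2, strictly below e^2. *)
    move=> e0; have e8 : (0 < e ^+ 2 / 8)%R by rewrite divr_gt0// exprn_gt0.
    near=> k.
    have [k0 h1 _] : P (s k) k by near: k.
    have [cf h2 _] := hf (s k).
    have sk : ((s k).+1%:R^-1 <= e ^+ 2 / 8)%R by near: k; exact: small.
    have mf := Lip_c_measurable cf.
    have mw : measurable_fun setT (wk k).
      exact: (measurable_extend sepM open_pos (mU k0) (disjU k0) (centerU k0)).
    have m1 : measurable_fun setT (fun z => wk k z - f_ (s k) z)%R by exact: measurable_funB.
    have m2 : measurable_fun setT (fun z => f_ (s k) z - u z)%R.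
      by apply: measurable_funB => //; exact: L2u.1.
    have h3 : sqnorm m setT (fun z => f_ (s k) z - u z)%R <= ((s k).+1%:R^-1)%:E.
      apply: le_trans h2; apply: le_sqnorm => z _; by rewrite distrC.
    have h4 := sqnormD_le m measurableT m1 m2.
    have S : sqnorm m setT (wk k \- u)%R < (e ^+ 2)%:E.
      have -> : (wk k \- u)%R = (fun z => (wk k z - f_ (s k) z) + (f_ (s k) z - u z))%R.
        by apply/funext => z /=; ring.
      apply: le_lt_trans h4 _.
      apply: le_lt_trans (lee_wpmul2l _ (leeD h1 h3)) _; first by rewrite lee_fin.
      have : (2 * ((s k).+1%:R^-1 + (s k).+1%:R^-1) < e ^+ 2)%R.
        by move: sk (e8); move: ((s k).+1%:R^-1)%R (e ^+ 2)%R => q q'; lra.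
      by rewrite -lte_fin.
    rewrite Lnorm2E; have S0 := sqnorm_ge0 m setT (wk k \- u)%R.
    have Sfin : sqnorm m setT (wk k \- u)%R \is a fin_num.
      by rewrite ge0_fin_numE//; apply: lt_trans S (ltry _).
    rewrite -(fineK Sfin) /= lte_fin -[ltRHS](ger0_norm (ltW e0)) -sqrtr_sqr.
    by rewrite ltr_sqrt ?exprn_gt0// -lte_fin fineK.
  apply/fine_cvgP; split.
    near=> k; rewrite ge0_fin_numE ?Lnorm_ge0//.
    apply: (@lt_trans _ _ 1); last exact: ltry.
    by near: k; exact: (Nlt 1%R ltr01).
  apply/cvgrPdist_lt => e e0; near=> k.
  have h : 'N[m]_2%:E[EFin \o (wk k \- u)%R] < e%:E by near: k; exact: Nlt.
  have N_ge0 : 0 <= 'N[m]_2%:E[EFin \o (wk k \- u)%R] by exact: Lnorm_ge0.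
  rewrite sub0r normrN ger0_norm ?fine_ge0// -lte_fin fineK// ge0_fin_numE//.
  exact: lt_trans h (ltry _).
- apply/lee_addgt0Pr => e e0; apply: limn_esup_le_near; near=> k.
  have [_ _ h] : P (s k) k by near: k.
  apply: le_trans h _; apply: leeD2l; rewrite lee_fin mulrC -ler_pdivlMr//.
  by near: k; apply: small; rewrite divr_gt0.
Unshelve. all: by end_near.
Qed.

End mosco.

Theorem theorem4p8 (R : realType) (d : measure_display)
    (M : borelMetricType R d) (m : {measure set M -> \bar R}) (x0 : M)
    (V : nat -> set M) (E : nat -> rel M) (U : nat -> M -> set M)
    (C : nat -> M -> M -> R) (j : R.-ker M ~> M) (N : set M)
    (Mmms : metric_measure_space m)
    (VEU : approximating_graphs m V E U)
    (C_sym : forall k, (0 < k)%N -> forall x y, V k x -> V k y ->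
       C k x y = C k y x)
    (C_ge0 : forall k, (0 < k)%N -> forall x y, V k x -> V k y ->
       (0 <= C k x y)%R)
    (N0 : m.-negligible N)
    (j_diag : forall x, ~ N x -> j x [set x] = 0)
    (A2 : assumption_A2 m j N)
    (A3 : assumption_A3star m j N x0)
    (A4 : assumption_A4star m j x0 (fun k => extend2 (V k) (U k) (C k))) :
  (forall (v : nat -> M -> R) (u : M -> R),
     (forall k, (0 < k)%N -> discrete_L2 m (V k) (U k) (v k)) ->
     u \in Lfun m 2%:E ->
     weakly_cvg_L2 m (fun k => extend (V k) (U k) (v k)) u ->
     jump_energy m j u <=
       limn_einf (fun k => discrete_energy m (V k) (U k) (C k) (v k))) /\
  (forall u : M -> R, u \in Lfun m 2%:E ->
     exists v : nat -> M -> R,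
       [/\ forall k, (0 < k)%N -> discrete_L2 m (V k) (U k) (v k),
           strongly_cvg_L2 m (fun k => extend (V k) (U k) (v k)) u &
           limn_esup (fun k => discrete_energy m (V k) (U k) (C k) (v k)) <=
             jump_energy m j u]).
Proof.
(* The exceptional set is enlarged to a measurable null set, so that cut kernels, which vanish on
   it, are measurable in the point. *)
have [N' [mN' N'0 NN']] := N0.
have [_ j_sym _] := A2; have [Lip_dom Lip_dense _] := A3.
have rates (i : nat) (delta : R) : (0 < delta)%R ->
    exists2 rate : R, (0 <= rate)%R & forall x, ball x0 i%:R x -> ~ N' x ->
      j x (far (ball x0 i%:R) delta x) <= rate%:E.
  move=> /(jump_rate x0 Mmms A2 i)[rate r0 hr]; exists rate => // x xB xN'.
  by apply: hr => // /NN'.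
split=> [v u Lv Lu wvu|u Lu].
  exact: (mosco_liminf Mmms VEU C_sym C_ge0 mN' N'0 j_sym rates A4 Lv Lu wvu).
exact: (mosco_limsup Mmms VEU C_sym C_ge0 mN' N'0 rates A4 Lip_dom Lip_dense Lu).
Qed.
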